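(* Let $-A$ be the generator of a bounded $C_0$-semigroup $(e^{-tA})_{t\ge 0}$ on a complex Banach space $X$. Suppose that $\overline{\mathrm{ran}}(A)=X$ and $$\{|s|:\ s\in\mathbb R,\ is\in\sigma(A)\}=\mathbb R_+ .$$ If $f\in\tilde{\mathcal S}_2$, then $$\|f(A)\Delta_{n,t}(A)\|\ge c\,f(\sqrt n/t),\qquad n\in\mathbb N,\ t>0,\qquad c=\frac12\left(1-\frac1{\sqrt2}\right).$$ In particular, $$\|A^{-\alpha}\Delta_{n,t}(A)\|\ge c\,(t/\sqrt n)^\alpha,\qquad n\in\mathbb N,\ t>0,$$ for any $\alpha\in(0,2]$.
   Context: $\mathbb C_+=\{z\in\mathbb C:\mathrm{Re}\,z>0\}$, $\mathbb R_+=[0,\infty)$; $\sigma(A)$ is the spectrum of $A$; $\mathrm{dom}$ and $\mathrm{ran}$ denote domain and range, and $\overline{\mathrm{ran}}(A)$ is the norm-closure of the range. For $n\in\mathbb N$, $t>0$: $\Delta_{n,t}(A):=\left(1+\frac tn A\right)^{-n}-e^{-tA}$. Stieltjes functions: a function $f:(0,\infty)\to[0,\infty)$ belongs to $\mathcal S$ if $f(z)=a+\int_0^\infty\frac{\mu(d\tau)}{z+\tau}$ for $z>0$, where $a\ge 0$ and $\mu$ is a positive Radon measure on $[0,\infty)$ with $\int_0^\infty\frac{\mu(d\tau)}{1+\tau}<\infty$; $f$ is identified with its unique analytic extension to $\mathbb C\setminus(-\infty,0]$. Further, $\tilde{\mathcal S}_2:=\{f_1\cdot f_2: f_1,f_2\in\mathcal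 S\}$. Functional calculus: $M(\mathbb R_+)$ is the Banach algebra of bounded (complex) Radon measures on $\mathbb R_+$, $(\mathcal L\mu)(z)=\int_0^\infty e^{-sz}\mu(ds)$ for $z\in\mathbb C_+$, and $A^1_+(\mathbb C_+)=\{\mathcal L\mu:\mu\in M(\mathbb R_+)\}$. For $g=\mathcal L\mu\in A^1_+(\mathbb C_+)$, $g(A)x:=\int_0^\infty e^{-sA}x\,\mu(ds)$ for $x\in X$. If $f:\mathbb C_+\to\mathbb C$ is holomorphic and there is $e\in A^1_+(\mathbb C_+)$ (a regularizer) with $ef\in A^1_+(\mathbb C_+)$ and $e(A)$ injective, then $f(A):=e(A)^{-1}(ef)(A)$ with $\mathrm{dom}(f(A))=\{x\in X:(ef)(A)x\in\mathrm{ran}(e(A))\}$; this does not depend on the choice of $e$ (extended Hille–Phillips calculus). For $\overline{\mathrm{ran}}(A)=X$ every $f\in\tilde{\mathcal S}_2$ is regularizable by $e(z)=z^2/(1+z)^2$, and $f(A)\Delta_{n,t}(A)$ (with natural domain) is an everywhere defined bounded operator on $X$; $\|\cdot\|$ is its operator norm. $A^{-\alpha}$ denotes $f(A)$ for $f(z)=z^{-\alpha}$ (principal branch). *)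

(* Defs.v *)
From HB Require Import structures.
From mathcomp Require Import all_boot all_order all_algebra.
From mathcomp Require Import complex.
From mathcomp Require Import all_classical all_reals all_analysis.

Set Implicit Arguments.
Unset Strict Implicit.
Unset Printing Implicit Defensive.

Import Order.TTheory GRing.Theory Num.Theory.
Import numFieldNormedType.Exports.

Local Open Scope classical_set_scope.
Local Open Scope ring_scope.
Local Open Scope complex_scope.

(* A complex Banach space is a
   [completeNormedModType R[i]] with [R : realType]; its norm has values in
   R[i] (with zero imaginary part), [rnorm] is the same norm seen in R. *)
Definition rnorm (R : realType) (X : normedModType R[i]) (x : X) : R :=
  complex.Re `|x|.

Definition nonneg_reals (R : realType) : set R := [set s | 0 <= s].

Definition right_half_plane (R : realType) : set R[i] :=
  [set z | 0 < complex.Re z].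

(* C \ (-oo, 0] *)
Definition cut_plane (R : realType) : set R[i] :=
  [set z | ~ (complex.Im z = 0 /\ complex.Re z <= 0)].

Definition holomorphic_on (R : realType) (D : set R[i]) (f : R[i] -> R[i]) :=
  forall z, D z -> derivable (f : R[i]^o -> R[i]^o) z 1.

Definition cexp (R : realType) (z : R[i]) : R[i] :=
  (expR (complex.Re z) * cos (complex.Im z))
    +i* (expR (complex.Re z) * sin (complex.Im z)).

Definition cmod (R : realType) (z : R[i]) : R := complex.Re `|z|.

(* Principal argument, with values in ]-pi, pi] for z != 0. *)
Definition carg (R : realType) (z : R[i]) : R :=
  let t := acos (complex.Re z / cmod z) in
  if 0 <= complex.Im z then t else - t.

(* Principal branch of z^a for real a and z != 0. *)
Definition cpow (R : realType) (z : R[i]) (a : R) : R[i] :=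
  ((cmod z) `^ a)%:C * cexp (0 +i* (a * carg z)).

Definition cintegral (R : realType)
    (nu : {measure set (measurableTypeR R) -> \bar R}) (D : set R)
    (f : R -> R[i]) : R[i] :=
  Rintegral nu D (fun s => complex.Re (f s))
    +i* Rintegral nu D (fun s => complex.Im (f s)).

(* Unbounded operators are given by their graphs; the operations below produce
   the natural domains. *)

Definition op_ran (X : Type) (G : set (X * X)) : set X :=
  [set y | exists x, G (x, y)].

Definition op_injective (X : Type) (G : set (X * X)) :=
  forall x x' y, G (x, y) -> G (x', y) -> x = x'.

Definition op_of (X : Type) (B : X -> X) : set (X * X) :=
  [set xy | xy.2 = B xy.1].

Definition op_inv (X : Type) (G : set (X * X)) : set (X * X) :=
  [set yx | G (yx.2, yx.1)].

(* [op_comp G H] is x |-> G (H x). *)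
Definition op_comp (X : Type) (G H : set (X * X)) : set (X * X) :=
  [set xz | exists2 y, H (xz.1, y) & G (y, xz.2)].

Definition op_pow (X : Type) (G : set (X * X)) (n : nat) : set (X * X) :=
  iter n (op_comp G) (op_of id).

Definition op_add (X : zmodType) (G H : set (X * X)) : set (X * X) :=
  [set xy | exists y1 y2, [/\ G (xy.1, y1), H (xy.1, y2) & xy.2 = y1 + y2]].

Definition op_scale (K : pzRingType) (X : lmodType K) (a : K)
    (G : set (X * X)) : set (X * X) :=
  [set xy | exists2 y, G (xy.1, y) & xy.2 = a *: y].

Definition op_opp (X : zmodType) (G : set (X * X)) : set (X * X) :=
  [set xy | exists2 y, G (xy.1, y) & xy.2 = - y].

(* For the graph of an everywhere defined operator this is the operator norm
   (+oo if the operator is unbounded). *)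
Definition op_norm (R : realType) (X : normedModType R[i])
    (G : set (X * X)) : \bar R :=
  ereal_sup [set r | exists x y,
    [/\ G (x, y), rnorm x <= 1 & r = (rnorm y)%:E]].

Definition resolvent_set (R : realType) (X : normedModType R[i])
    (A : set (X * X)) : set R[i] :=
  [set l | exists B : {linear X -> X},
     continuous B /\
     op_inv (op_add (op_of (fun x => l *: x)) (op_opp A)) = op_of B].

Definition spectrum (R : realType) (X : normedModType R[i])
    (A : set (X * X)) : set R[i] := ~` resolvent_set A.

(* Only the values T t with 0 <= t matter. *)
Record bounded_C0_semigroup (R : realType) (X : normedModType R[i])
    (T : R -> {linear X -> X}) : Prop := BoundedC0Semigroup {
  semigroup0 : forall x, T 0 x = x ;
  semigroupD : forall s t x, 0 <= s -> 0 <= t -> T (s + t) x = T s (T t x) ;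
  semigroup_cvg0 : forall x, T t x @[t --> 0^'+] --> x ;
  semigroup_bounded : exists M : R,
    forall t x, 0 <= t -> rnorm (T t x) <= M * rnorm x
}.

Definition generator (R : realType) (X : normedModType R[i])
    (T : R -> {linear X -> X}) : set (X * X) :=
  [set xy | (t^-1)%:C *: (T t xy.1 - xy.1) @[t --> 0^'+] --> xy.2].

(* The simple function \sum_i 1_(E_i) x_i is encoded by the list of the
   pairs (E_i, x_i). *)
Definition simple_val (R : realType) (X : normedModType R[i])
    (S : seq (set R * X)) (s : R) : X :=
  \sum_(p <- S) (\1_(p.1) s)%:C *: p.2.

Definition simple_integral (R : realType) (X : normedModType R[i])
    (nu : {finite_measure set (measurableTypeR R) -> \bar R}) (D : set R)
    (S : seq (set R * X)) : X :=
  \sum_(p <- S) (fine (nu (D `&` p.1)))%:C *: p.2.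

Definition bochner_integral (R : realType) (X : normedModType R[i])
    (nu : {finite_measure set (measurableTypeR R) -> \bar R}) (D : set R)
    (F : R -> X) (y : X) : Prop :=
  exists S : nat -> seq (set R * X),
    [/\ forall k p, p \in S k -> measurable (p.1 : set (measurableTypeR R)),
        {ae nu, forall s, D s -> simple_val (S k) s @[k --> \oo] --> F s},
        (\int[nu]_(s in D) (rnorm (F s - simple_val (S k) s))%:E)%E
          @[k --> \oo] --> 0%E
      & simple_integral nu D (S k) @[k --> \oo] --> y].

(* The bounded complex measure (mu1 - mu2) + i (mu3 - mu4); by the Jordan
   decomposition every element of M(R_+) is of this form. The measures live on
   the real line, but all integrals are over [0, +oo[. *)
Record cmeasure (R : realType) := CMeasure {
  re_pos : {finite_measure set (measurableTypeR R) -> \bar R} ;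
  re_neg : {finite_measure set (measurableTypeR R) -> \bar R} ;
  im_pos : {finite_measure set (measurableTypeR R) -> \bar R} ;
  im_neg : {finite_measure set (measurableTypeR R) -> \bar R}
}.

Definition laplace (R : realType) (mu : cmeasure R) (z : R[i]) : R[i] :=
  let I nu := cintegral nu (nonneg_reals (R := R))
                (fun s => cexp (- (s%:C * z))) in
  (I (re_pos mu) - I (re_neg mu)) + 'i * (I (im_pos mu) - I (im_neg mu)).

(* The graph of g(A) for g = laplace mu, where T t = e^(-tA). *)
Definition hp_calculus (R : realType) (X : normedModType R[i])
    (T : R -> {linear X -> X}) (mu : cmeasure R) : set (X * X) :=
  [set xy | exists y1 y2 y3 y4 : X,
     let I nu y := bochner_integral nu (nonneg_reals (R := R))
                     (fun s => T s xy.1) y in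
     [/\ I (re_pos mu) y1, I (re_neg mu) y2, I (im_pos mu) y3, I (im_neg mu) y4
       & xy.2 = (y1 - y2) + 'i *: (y3 - y4)]].

(* e = laplace mu_e is a regularizer of f and ef = laplace mu_ef. *)
Definition regularizes (R : realType) (X : normedModType R[i])
    (T : R -> {linear X -> X}) (f : R[i] -> R[i]) (mu_e mu_ef : cmeasure R) :=
  op_injective (hp_calculus T mu_e) /\
  (forall z, right_half_plane z -> laplace mu_ef z = laplace mu_e z * f z).

(* The graph of f(A) = e(A)^-1 (ef)(A); as it does not depend on the
   regularizer e, we take the union over all of them. *)
Definition ext_hp_calculus (R : realType) (X : normedModType R[i])
    (T : R -> {linear X -> X}) (f : R[i] -> R[i]) : set (X * X) :=
  [set xy | holomorphic_on (right_half_plane (R := R)) f /\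
     exists mu_e mu_ef, regularizes T f mu_e mu_ef /\
       op_comp (op_inv (hp_calculus T mu_e)) (hp_calculus T mu_ef) xy].

(* The formula, which for z > 0 is the definition of the class, is required on
   the whole of C \ (-oo, 0], where it gives the analytic extension with which
   a Stieltjes function is identified. That mu is finite on compact sets
   follows from the integrability condition. *)
Definition stieltjes (R : realType) (f : R[i] -> R[i]) : Prop :=
  exists (a : R) (mu : {measure set (measurableTypeR R) -> \bar R}),
    [/\ 0 <= a,
        (\int[mu]_(tau in nonneg_reals (R := R)) ((1 + tau)^-1)%:E < +oo)%E
      & forall z, cut_plane z ->
          f z = a%:C + cintegral mu (nonneg_reals (R := R))
                         (fun tau => (z + tau%:C)^-1)].

Definition stieltjes2 (R : realType) (f : R[i] -> R[i]) : Prop :=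
  exists f1 f2, [/\ stieltjes f1, stieltjes f2 &
    forall z, cut_plane z -> f z = f1 z * f2 z].

(* (1 + (t/n) A)^-n - e^(-tA), where T t = e^(-tA). *)
Definition euler_defect (R : realType) (X : normedModType R[i])
    (A : set (X * X)) (T : R -> {linear X -> X}) (n : nat) (t : R) :
    set (X * X) :=
  op_add
    (op_pow (op_inv (op_add (op_of id) (op_scale (t / n%:R)%:C A))) n)
    (op_opp (op_of (T t))).

(* Main.v *)
Require Import Defs.
From HB Require Import structures.
From mathcomp Require Import all_boot all_order all_algebra.
From mathcomp Require Import complex.
From mathcomp Require Import all_classical all_reals all_analysis.
From mathcomp Require Import ring lra.
From mathcomp Require Import measurable_realfun.
Set Implicit Arguments.
Unset Strict Implicit.
Unset Printing Implicit Defensive.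

Import Order.TTheory GRing.Theory Num.Theory.
Import numFieldNormedType.Exports.

Local Open Scope classical_set_scope.
Local Open Scope ring_scope.
Local Open Scope complex_scope.

(** Heuristically, a point [i l] of the spectrum of [A]
    puts [f(i l) Delta(i l)], where
    [Delta(z) = (1 + t z / n)^-n - e^(-t z)], in the spectrum of
    [f(A) Delta_{n,t}(A)], so that the norm of this operator is at least
    [|f(i l)| |Delta(i l)|].  By the hypothesis on the spectrum, [|l|] can be
    taken equal to [sqrt n / t].  Then [|1 + i l t / n|^2 = 1 + 1 / n], so the
    first term of [Delta(i l)] has modulus at most [1 / sqrt 2] by Bernoulli's
    inequality, while the second one has modulus 1: this gives the factor
    [1 - 1 / sqrt 2] ([euler_symbol_lower_bound]).  A Stieltjes function loses
    at most a factor [sqrt 2] between [s > 0] and [i s]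
    ([stieltjes_lower_bound]); for a product of two of them this gives the
    factor [1 / 2].

    The spectral part is made rigorous with approximate eigenvectors.  As [A]
    has its spectrum in the closed right half-plane, a spectral point [i l] is
    on the boundary and there are unit vectors [v] with [(A - i l) v] as small
    as wanted ([approximate_eigenvector]).  On such vectors [e^(-s A) v] stays
    close to [e^(-i s l) v], uniformly for bounded [s], so [g(A) v] is close to
    [g(i l) v] for every Laplace transform [g] of a bounded measure
    ([spectral_value_Tint]).  If [e] and [e f] are such transforms with
    [e(A)] injective, then [f(A) Delta(A)] maps [e(A) v] to
    [(e f)(A) Delta(A) v], and the quotient of the norms of these vectors
    tends to [|f(i l) Delta(i l)|] ([calculus_lower_bound]).

    The regularizer is [e(z) = z^2 / ((1 + z) (2 + z))]: it has simple poles,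
    so that [e(A)] is a linear combination of the identity and of two
    resolvents.  It is injective because [A] is, by the mean ergodic theorem
    and the density of the range ([negative_generator_injective],
    [regularizer_injective]); and [e f] is a Laplace transform since
    [z / (b + z)] times a Stieltjes function is one
    ([stieltjes_regularized]).

    The resolvent [b (b + A)^-1] is the mean of the semigroup under the
    exponential law of rate [b] ([resolvent_generator]).  The orbits being
    bounded and uniformly continuous, their Bochner integrals exist and are
    limits of Riemann sums on uniform grids ([bochner_exists],
    [bochner_rlim]), and this is how all their properties are proved.

    For the powers, [z^-alpha] is the square of [z^(-alpha / 2)], and for
    [0 < b < 1] the function [z^-b] is the Stieltjes transform of a multiple of
    [tau^-b d tau].  The latter transform is homogeneous of degree [-b] under
    real dilations because the measure is.  Being complex differentiable it
    then satisfies Euler's equation [z f' = - b f], which integrated along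
    circles determines it up to a constant factor ([homogeneous_cpow],
    [stieltjes_power_rep]). *)

Local Notation mR R := (measurableTypeR R).
Local Notation fmeas R := {finite_measure set (measurableTypeR R) -> \bar R}.

(** * Norms with real values *)

Section rnorm_theory.
Context (R : realType) (X : normedModType R[i]).
Implicit Types (x y : X) (a : R[i]) (r : R).

Lemma rnormE x : `|x| = (rnorm x)%:C.
Proof. by rewrite /rnorm RRe_real ?ger0_real. Qed.

Lemma rnorm_ge0 x : 0 <= rnorm x.
Proof. by have := normr_ge0 x; rewrite lecE => /andP[]. Qed.

Lemma rnorm0 : rnorm (0 : X) = 0.
Proof. by rewrite /rnorm normr0. Qed.

Lemma rnorm_eq0 x : rnorm x = 0 -> x = 0.
Proof. by move=> x0; apply/eqP; rewrite -normr_eq0 rnormE x0. Qed.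

Lemma rnormD x y : rnorm (x + y) <= rnorm x + rnorm y.
Proof. by rewrite -lecR rmorphD /= -!rnormE ler_normD. Qed.

Lemma rnormN x : rnorm (- x) = rnorm x.
Proof. by rewrite /rnorm normrN. Qed.

Lemma rnormB x y : rnorm (x - y) <= rnorm x + rnorm y.
Proof. by rewrite -(rnormN y) rnormD. Qed.

Lemma rnorm_distC x y : rnorm (x - y) = rnorm (y - x).
Proof. by rewrite -rnormN opprB. Qed.

Lemma rnorm_triangle z x y : rnorm (x - y) <= rnorm (x - z) + rnorm (z - y).
Proof. by rewrite (le_trans _ (rnormD _ _))// addrA subrK. Qed.

Lemma rnorm_lerB x y : rnorm x - rnorm y <= rnorm (x - y).
Proof. by rewrite lerBlDr (le_trans _ (rnormD _ _))// subrK. Qed.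

Lemma rnorm_ler_dist x y : `|rnorm x - rnorm y| <= rnorm (x - y).
Proof.
rewrite ler_norml rnorm_lerB andbT -lerN2 opprK opprB.
by rewrite rnorm_distC rnorm_lerB.
Qed.

Lemma cmodE a : `|a| = (cmod a)%:C.
Proof. by rewrite /cmod RRe_real ?ger0_real. Qed.

Lemma cmod_real r : cmod r%:C = `|r|.
Proof. by rewrite /cmod normc_def /= expr0n /= addr0 sqrtr_sqr. Qed.

Lemma rnormZ a x : rnorm (a *: x) = cmod a * rnorm x.
Proof. by apply: complexI; rewrite rmorphM /= -cmodE -!rnormE normrZ. Qed.

Lemma rnormZr r x : rnorm (r%:C *: x) = `|r| * rnorm x.
Proof. by rewrite rnormZ cmod_real. Qed.

Lemma rnorm_sum (I : Type) (s : seq I) (P : pred I) (F : I -> X) :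
  rnorm (\sum_(i <- s | P i) F i) <= \sum_(i <- s | P i) rnorm (F i).
Proof.
elim/big_rec2: _ => [|i y1 y2 _ le12]; first by rewrite rnorm0.
by rewrite (le_trans (rnormD _ _))// lerD2l.
Qed.

Lemma cvg_rnormP {T : Type} {F : set_system T} {FF : Filter F} (f : T -> X) (l : X) :
  f @ F --> l <-> forall e : R, 0 < e -> \forall t \near F, rnorm (f t - l) < e.
Proof.
split=> [/cvgrPdist_lt fl e e0|fl].
  have e0C : 0 < e%:C by rewrite ltcR.
  by apply: filterS (fl _ e0C) => t; rewrite rnormE ltcR rnorm_distC.
apply/cvgrPdist_lt => e; rewrite ltcE /= => /andP[/eqP ime e0].
apply: filterS (fl _ e0) => t lt_e.
by rewrite rnormE ltcE /= ime eqxx /= rnorm_distC.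
Qed.

Lemma cvg_rnorm_le {T : Type} {F : set_system T} {FF : Filter F} (f : T -> X) (l : X)
  (g : T -> R) : (\forall t \near F, rnorm (f t - l) <= g t) ->
  g @ F --> (0 : R) -> f @ F --> l.
Proof.
move=> fg /cvgrPdist_lt g0; apply/cvg_rnormP => e e0.
near=> t; apply: (@le_lt_trans _ _ (g t)); first by near: t.
apply: (@le_lt_trans _ _ `|0 - g t|); last by near: t; exact: g0.
by rewrite sub0r normrN ler_norm.
Unshelve. all: by end_near. Qed.

Lemma cvg_rnorm {T : Type} {F : set_system T} {FF : Filter F} (f : T -> X) (l : X) :
  f @ F --> l -> rnorm (f t) @[t --> F] --> rnorm l.
Proof.
move=> /cvg_rnormP fl; apply/cvgrPdist_lt => e e0.
apply: filterS (fl _ e0) => t; apply: le_lt_trans.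
by rewrite rnorm_distC rnorm_ler_dist.
Qed.

Lemma cvg_ler_rnorm {T : Type} {F : set_system T} {FF : ProperFilter F} (f : T -> X)
  (l y : X) (e : R) :
  f @ F --> l -> (\forall t \near F, rnorm (f t - y) <= e) -> rnorm (l - y) <= e.
Proof.
move=> fl fe; apply/ler_addgt0Pl => d d0.
have [t [fle fld]] := filter_ex (filterI fe ((cvg_rnormP _ _).1 fl _ d0)).
by rewrite (le_trans (rnorm_triangle (f t) _ _))// lerD// rnorm_distC ltW.
Qed.

Lemma rcvg_unique {T : Type} {F : set_system T} {FF : ProperFilter F} (f : T -> X)
  (l l' : X) : f @ F --> l -> f @ F --> l' -> l = l'.
Proof. exact: cvg_unique. Qed.

Lemma rcvg_near_eq {T : Type} {F : set_system T} {FF : Filter F} (f g : T -> X) (l : X) :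
  (\forall t \near F, f t = g t) -> f @ F --> l -> g @ F --> l.
Proof.
move=> fg /cvg_rnormP fl; apply/cvg_rnormP => e e0.
by apply: filterS2 fg (fl _ e0) => t ->.
Qed.

End rnorm_theory.

Lemma rnorm_bounded_cts (R : realType) (X Y : normedModType R[i]) (L : {linear X -> Y}) (M : R) :
  (forall x, rnorm (L x) <= M * rnorm x) -> continuous L.
Proof.
move=> LM x; apply/cvg_rnormP => e e0.
have M1 : 0 < `|M| + 1 by rewrite ltr_wpDl.
have H := (@cvg_rnormP _ X _ (nbhs x) (nbhs_filter x) id x).1 cvg_id _ (divr_gt0 e0 M1).
apply: (@filterS _ _ (nbhs_filter x) _ _ _ H) => y; rewrite ltr_pdivlMr// => xy; rewrite -raddfB.
apply: (le_lt_trans (LM _)); apply: (le_lt_trans _ xy).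
rewrite mulrC ler_wpM2l ?rnorm_ge0//.
by rewrite (le_trans (ler_norm _))// lerDl.
Qed.

Lemma rnorm_cauchy_cvg (R : realType) (X : completeNormedModType R[i]) (u : nat -> X) :
  (forall e : R, 0 < e -> exists N, forall m n, (N <= m)%N -> (N <= n)%N ->
     rnorm (u m - u n) <= e) ->
  exists l : X, u @ \oo --> l.
Proof.
move=> cu; suff : cvgn u by move=> cvu; exists (limn u).
apply/cauchy_cvgP/cauchy_ballP => e.
rewrite ltcE /= => /andP[/eqP ime e0].
have [N uN] := cu (complex.Re e / 2) (divr_gt0 e0 (ltr0Sn _ 1)).
exists (u @` [set n | N <= n]%N, u @` [set n | N <= n]%N) => /=.
  by split; exists N => // n Nn; exists n.
move=> _ [[m Nm <-] [n Nn <-]].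
rewrite -ball_normE /= rnormE ltcE /= ime eqxx /=.
by rewrite (le_lt_trans (uN _ _ Nm Nn))// ltr_pdivrMr// ltr_pMr// ltr1n.
Qed.

(** * Bounded uniformly continuous functions and simple functions *)

Lemma measurable_nonneg_reals (R : realType) :
  measurable (nonneg_reals (R := R) : set (mR R)).
Proof.
rewrite (_ : nonneg_reals (R := R) = `[0, +oo[%classic); first exact: measurable_itv.
by apply/seteqP; split => x /=; rewrite in_itv/= andbT.
Qed.
Hint Resolve measurable_nonneg_reals : core.

(** The integrands below, orbits and exponential kernels, are only considered
    on the half-line; uniform continuity there makes step functions on uniform
    grids converge uniformly on bounded intervals. *)
Definition buc (R : realType) (X : normedModType R[i]) (F : R -> X) :=
  (exists M, forall s, 0 <= s -> rnorm (F s) <= M) /\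
  (forall e, 0 < e -> exists2 d, 0 < d &
    forall s r, 0 <= s -> 0 <= r -> `|s - r| < d -> rnorm (F s - F r) <= e).

Section buc_theory.
Context (R : realType) (X : normedModType R[i]).
Implicit Types (F G : R -> X).

Lemma buc_cst (c : X) : buc (fun _ => c).
Proof.
split; first by exists (rnorm c).
by move=> e e0; exists 1 => // s r _ _ _; rewrite subrr rnorm0 ltW.
Qed.

Lemma bucD F G : buc F -> buc G -> buc (fun s => F s + G s).
Proof.
move=> [[M FM] Fu] [[N GN] Gu]; split.
  exists (M + N) => s s0; rewrite (le_trans (rnormD _ _))// lerD//.
  - exact: FM.
  - exact: GN.
move=> e e0; have e20 : 0 < e / 2 by rewrite divr_gt0.
have [d d0 Fd] := Fu _ e20; have [d' d'0 Gd] := Gu _ e20.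
exists (Num.min d d'); first by rewrite lt_min d0.
move=> s r s0 r0; rewrite lt_min => /andP[sr sr'].
rewrite opprD addrACA (le_trans (rnormD _ _))// [leRHS]splitr lerD//.
- exact: Fd.
- exact: Gd.
Qed.

Lemma bucZ (a : R[i]) F : buc F -> buc (fun s => a *: F s).
Proof.
move=> [[M FM] Fu]; split.
  exists (cmod a * M) => s s0; rewrite rnormZ ler_wpM2l ?FM//.
  exact: (@rnorm_ge0 R R[i]^o).
move=> e e0.
have a1 : 0 < cmod a + 1 by rewrite ltr_wpDl//; exact: (@rnorm_ge0 R R[i]^o).
have [d d0 Fd] := Fu _ (divr_gt0 e0 a1); exists d => // s r s0 r0 sr.
rewrite -scalerBr rnormZ (@le_trans _ _ ((cmod a + 1) * rnorm (F s - F r)))//.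
  by rewrite ler_wpM2r ?rnorm_ge0// lerDl.
by rewrite mulrC -ler_pdivlMr// Fd.
Qed.

Lemma bucB F G : buc F -> buc G -> buc (fun s => F s - G s).
Proof.
move=> bF bG; have := bucD bF (bucZ (-1) bG).
by under eq_fun do rewrite scaleN1r.
Qed.

Lemma buc_measurable F : buc F ->
  measurable_fun (nonneg_reals (R := R) : set (mR R)) (fun s => rnorm (F s)).
Proof.
move=> [_ Fu].
have Fc : {within nonneg_reals (R := R), continuous (fun s => rnorm (F s))}; last first.
  apply: subspace_continuous_measurable_fun => //. exact: measurable_nonneg_reals.
apply/subspace_continuousP => s /= s0.
apply/cvgrPdist_le => e e0; have [d d0 Fd] := Fu _ e0.
near=> r; rewrite (le_trans (rnorm_ler_dist _ _))// Fd//.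
- by near: r; exact: withinT.
- by near: r; apply: cvg_within; exact: (@cvgr_dist_lt _ R^o _ _ _ id s cvg_id).
Unshelve. all: by end_near. Qed.

Lemma simple_val_nil s : simple_val ([::] : seq (set R * X)) s = 0.
Proof. by rewrite /simple_val big_nil. Qed.

Lemma simple_val_cons p (S : seq (set R * X)) s :
  simple_val (p :: S) s = (\1_(p.1) s)%:C *: p.2 + simple_val S s.
Proof. by rewrite /simple_val big_cons. Qed.

Definition msimple (S : seq (set R * X)) :=
  forall p, p \in S -> measurable (p.1 : set (mR R)).

Lemma msimple_cons p S : msimple (p :: S) -> measurable (p.1 : set (mR R)) /\ msimple S.
Proof.
move=> mS; split; first by apply: mS; rewrite mem_head.
by move=> q qS; apply: mS; rewrite in_cons qS orbT.
Qed.

Lemma measurable_rnorm_sub_simple F S (E : set R) : buc F -> msimple S ->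
  measurable (E : set (mR R)) -> E `<=` nonneg_reals (R := R) ->
  measurable_fun (E : set (mR R)) (fun s => rnorm (F s - simple_val S s)).
Proof.
elim: S F E => [|[A x] S IH] F E bF mS mE ED.
  under eq_fun do rewrite simple_val_nil subr0.
  by apply: measurable_funS (buc_measurable bF).
have [/= mA {}mS] := msimple_cons mS.
rewrite (_ : E = (E `&` A) `|` (E `\` A)); last first.
  by rewrite setUIDK.
have mEA : measurable (E `&` A : set (mR R)) by exact: measurableI.
have mEDA : measurable (E `\` A : set (mR R)) by exact: measurableD.
apply/measurable_funU => //; split.
- apply: (eq_measurable_fun (fun s => rnorm ((F s - x) - simple_val S s))).
    move=> s; rewrite inE => -[_ As].
    by rewrite simple_val_cons /= indicE mem_set// scale1r opprD addrA.
  apply: IH => //; first exact: bucB (buc_cst _).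
  by apply: subset_trans ED; exact: subIsetl.
- apply: (eq_measurable_fun (fun s => rnorm (F s - simple_val S s))).
    move=> s; rewrite inE => -[_ As].
    by rewrite simple_val_cons /= indicE memNset// scale0r add0r.
  apply: IH => //.
  by apply: subset_trans ED; exact: subDsetl.
Qed.

Lemma measurable_rnorm_simple S (E : set R) (c : X) : msimple S ->
  measurable (E : set (mR R)) -> E `<=` nonneg_reals (R := R) ->
  measurable_fun (E : set (mR R)) (fun s => rnorm (c + simple_val S s)).
Proof.
move=> mS mE ED.
have := measurable_rnorm_sub_simple (buc_cst (- c)) mS mE ED.
apply: eq_measurable_fun => s _.
by rewrite -rnormN opprB opprK addrC.
Qed.

End buc_theory.

(** * Integrals of simple functions *)

Local Hint Resolve measurable_nonneg_reals : core.

Section simple_integral_theory.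
Context (R : realType) (X : normedModType R[i]) (nu : fmeas R).
Implicit Types (S : seq (set R * X)).
Local Notation D := (nonneg_reals (R := R)).

Lemma fine_measure_nonneg (A : set (mR R)) : measurable A -> 0 <= fine (nu A).
Proof. by move=> mA; rewrite fine_ge0. Qed.

(** The sets of [S] may overlap. In the induction on [S], [E] is split along the
    first set, and on the part inside it its vector is added to the constant
    [c]: hence the general [E] and [c]. *)
Lemma simple_integral_bound S (E : set R) (c : X) : msimple S ->
  measurable (E : set (mR R)) -> E `<=` D ->
  ((rnorm (\sum_(p <- S) (fine (nu (E `&` p.1)))%:C *: p.2
           + (fine (nu E))%:C *: c))%:E
   <= \int[nu]_(s in E) (rnorm (c + simple_val S s))%:E)%E.
Proof.
elim: S E c => [|[A x] S IH] E c mS mE ED.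
  rewrite big_nil add0r rnormZr ger0_norm ?fine_measure_nonneg//.
  under eq_integral do rewrite simple_val_nil addr0.
  by rewrite integral_cst// EFinM fineK ?fin_num_measure// muleC.
have [/= mA {}mS] := msimple_cons mS.
have mEA : measurable (E `&` A : set (mR R)) by exact: measurableI.
have mEDA : measurable (E `\` A : set (mR R)) by exact: measurableD.
have EU : E = (E `&` A) `|` (E `\` A) by rewrite setUIDK.
have EAD : E `&` A `<=` D by apply: subset_trans ED; exact: subIsetl.
have EDAD : E `\` A `<=` D by apply: subset_trans ED; exact: subDsetl.
have dEA : [disjoint (E `&` A) & (E `\` A)].
  by apply/disj_set2P; apply/seteqP; split => // s /= -[[_ As] [_ nAs]].
have splitE (B : set R) : measurable (B : set (mR R)) ->
    fine (nu (E `&` B)) = fine (nu ((E `&` A) `&` B)) + fine (nu ((E `\` A) `&` B)).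
  move=> mB; rewrite -fineD ?fin_num_measure//; [|exact: measurableI..].
  rewrite -measureU; [|exact: measurableI|exact: measurableI|].
  - by rewrite -setIUl -EU.
  - by apply/seteqP; split => // s /= -[[[_ As] _] [[_ nAs] _]].
have -> : \sum_(p <- (A, x) :: S) (fine (nu (E `&` p.1)))%:C *: p.2
    + (fine (nu E))%:C *: c =
  (\sum_(p <- S) (fine (nu ((E `&` A) `&` p.1)))%:C *: p.2
           + (fine (nu (E `&` A)))%:C *: (c + x)) +
  (\sum_(p <- S) (fine (nu ((E `\` A) `&` p.1)))%:C *: p.2
           + (fine (nu (E `\` A)))%:C *: c).
  rewrite big_cons /= addrACA -big_split /=.
  rewrite (eq_big_seq (fun p => (fine (nu ((E `&` A) `&` p.1)))%:C *: p.2 +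
                        (fine (nu ((E `\` A) `&` p.1)))%:C *: p.2)); last first.
    by move=> p pS; rewrite (splitE _ (mS _ pS)) rmorphD scalerDl.
  rewrite scalerDr -addrA addrC -!addrA; congr (_ + _).
  rewrite [in RHS]addrC -addrA addrC; congr (_ + _).
  have := splitE setT measurableT; rewrite !setIT => ->.
  by rewrite rmorphD scalerDl addrC.
rewrite [in leRHS]EU ge0_integral_setU//=; first last.
- by move=> s _; rewrite lee_fin rnorm_ge0.
- rewrite -EU; apply/measurable_EFinP; apply: measurable_rnorm_simple => //.
  by move=> p; rewrite in_cons => /orP[/eqP -> //|]; exact: mS.
apply: (@le_trans _ _ (_%:E + _%:E)%E).
  by rewrite -EFinD lee_fin; exact: rnormD.
apply: leeD.
- apply: (le_trans (IH _ (c + x) mS mEA EAD)); rewrite le_eqVlt; apply/orP; left.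
  apply/eqP/eq_integral => s; rewrite inE => -[_ As].
  by rewrite simple_val_cons /= indicE mem_set// scale1r addrA.
- apply: (le_trans (IH _ c mS mEDA EDAD)); rewrite le_eqVlt; apply/orP; left.
  apply/eqP/eq_integral => s; rewrite inE => -[_ As].
  by rewrite simple_val_cons /= indicE memNset// scale0r add0r.
Qed.

Definition simple_opp S := [seq (p.1, - p.2) | p <- S].

Lemma simple_val_sub S S' s :
  simple_val (S ++ simple_opp S') s = simple_val S s - simple_val S' s.
Proof.
rewrite /simple_val big_cat /= big_map; congr (_ + _).
by rewrite -sumrN; apply: eq_bigr => p _ /=; rewrite scalerN.
Qed.

Lemma simple_integral_sub S S' :
  simple_integral nu D (S ++ simple_opp S') =
  simple_integral nu D S - simple_integral nu D S'.
Proof.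
rewrite /simple_integral big_cat /= big_map; congr (_ + _).
by rewrite -sumrN; apply: eq_bigr => p _ /=; rewrite scalerN.
Qed.

Lemma msimple_sub S S' : msimple S -> msimple S' -> msimple (S ++ simple_opp S').
Proof.
move=> mS mS' p; rewrite mem_cat => /orP[/mS //|/mapP[q qS' ->] /=].
exact: mS'.
Qed.

Lemma simple_integral_sub_bound (F : R -> X) S S' : buc F -> msimple S -> msimple S' ->
  ((rnorm (simple_integral nu D S - simple_integral nu D S'))%:E <=
   \int[nu]_(s in D) (rnorm (F s - simple_val S s))%:E +
   \int[nu]_(s in D) (rnorm (F s - simple_val S' s))%:E)%E.
Proof.
move=> bF mS mS'.
have := simple_integral_bound 0 (msimple_sub mS mS') (@measurable_nonneg_reals R)
  (@subset_refl _ _).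
rewrite scaler0 addr0 -/(simple_integral nu D _) simple_integral_sub => /le_trans; apply.
have mf (S0 : seq (set R * X)) : msimple S0 ->
    measurable_fun (D : set (mR R)) (fun s => (rnorm (F s - simple_val S0 s))%:E).
  by move=> mS0; apply/measurable_EFinP; exact: measurable_rnorm_sub_simple.
rewrite -ge0_integralD//; try by [move=> s _; rewrite lee_fin rnorm_ge0|exact: mf].
apply: ge0_le_integral => //.
- by move=> s _; rewrite lee_fin rnorm_ge0.
- apply/measurable_EFinP; apply: measurable_rnorm_simple => //.
  exact: msimple_sub.
- by apply: emeasurable_funD; exact: mf.
- move=> s _; rewrite -EFinD lee_fin add0r simple_val_sub.
  by rewrite (le_trans (rnorm_triangle (F s) _ _))// lerD2r rnorm_distC.
Qed.

Lemma simple_integral_le (F : R -> X) S : buc F -> msimple S ->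
  ((rnorm (simple_integral nu D S))%:E <=
   \int[nu]_(s in D) (rnorm (F s - simple_val S s))%:E +
   \int[nu]_(s in D) (rnorm (F s))%:E)%E.
Proof.
move=> bF mS; have := @simple_integral_sub_bound F S [::] bF mS _.
rewrite {2}/simple_integral big_nil subr0; under [X in (_ + X)%E]eq_integral do rewrite simple_val_nil subr0.
by apply.
Qed.

End simple_integral_theory.

(** * Riemann sums over uniform grids *)

Definition cell (R : realType) (d : R) (j : nat) : set R :=
  [set s | j%:R * d <= s < j.+1%:R * d].

(** Left-endpoint Riemann sum over [0, N d), the integral of [grid F d N]. *)
Definition rsum (R : realType) (X : normedModType R[i]) (nu : fmeas R) (F : R -> X)
    (d : R) (N : nat) : X :=
  \sum_(0 <= j < N) (fine (nu (cell d j)))%:C *: F (j%:R * d).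

Definition grid (R : realType) (X : normedModType R[i]) (F : R -> X)
    (d : R) (N : nat) : seq (set R * X) :=
  [seq (cell d j, F (j%:R * d)) | j <- index_iota 0 N].

(** The mesh [d] and the length [N d] of the range vary independently, so that
    one grid can serve for several measures at once, and can be adapted to a
    given subdivision point. *)
Definition rlim (R : realType) (X : normedModType R[i]) (nu : fmeas R) (F : R -> X)
    (y : X) :=
  forall e : R, 0 < e -> exists d0 K : R, [/\ 0 < d0, 0 < K &
    forall d N, 0 < d -> d < d0 -> K <= N%:R * d -> rnorm (rsum nu F d N - y) <= e].

Section grid_theory.
Context (R : realType) (X : normedModType R[i]).
Implicit Types (F : R -> X) (nu : fmeas R).
Local Notation D := (nonneg_reals (R := R)).

Lemma measurable_cell (d : R) j : measurable (cell d j : set (mR R)).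
Proof.
rewrite (_ : cell d j = `[j%:R * d, j.+1%:R * d[%classic); first exact: measurable_itv.
by apply/seteqP; split => x /=; rewrite in_itv.
Qed.

Lemma msimple_grid F d N : msimple (grid F d N).
Proof. by move=> p /mapP[j _ ->] /=; exact: measurable_cell. Qed.

Lemma cell_nonneg (d : R) j : 0 <= d -> cell d j `<=` D.
Proof. by move=> d0 s /= /andP[+ _]; apply: le_trans; rewrite mulr_ge0. Qed.

Lemma simple_integral_grid nu F d N : 0 <= d ->
  simple_integral nu D (grid F d N) = rsum nu F d N.
Proof.
move=> d0; rewrite /simple_integral /grid big_map; apply: eq_bigr => j _ /=.
by rewrite setIidr//; exact: cell_nonneg.
Qed.

Lemma cell_inj (d s : R) j k : 0 < d -> cell d j s -> cell d k s -> j = k.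
Proof.
move=> d0 /= /andP[j1 j2] /andP[k1 k2].
have := le_lt_trans j1 k2; have := le_lt_trans k1 j2.
by rewrite !ltr_pM2r// !ltr_nat !ltnS => ? ?; apply/eqP; rewrite eqn_leq; apply/andP.
Qed.

Lemma cell_truncn (d s : R) : 0 < d -> 0 <= s -> cell d (Num.truncn (s / d)) s.
Proof.
move=> d0 s0 /=; have /truncn_itv/andP[h1 h2] : 0 <= s / d by rewrite divr_ge0// ltW.
by rewrite /cell /= -ler_pdivlMr// h1 -ltr_pdivrMr// h2.
Qed.

Lemma simple_val_grid F d N s : 0 < d -> 0 <= s ->
  simple_val (grid F d N) s =
    if s < N%:R * d then F ((Num.truncn (s / d))%:R * d) else 0.
Proof.
move=> d0 s0; have cs := cell_truncn d0 s0; set k := Num.truncn _ in cs *.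
rewrite /simple_val /grid big_map /=.
have vanish j : j != k -> (\1_(cell d j) s)%:C *: F (j%:R * d) = 0.
  move=> jk; rewrite indicE memNset ?scale0r// => cj.
  by move: jk; rewrite (cell_inj d0 cj cs) eqxx.
case: ifPn => [sN|].
  have kN : (k < N)%N.
    rewrite -(ltr_nat R) -(ltr_pM2r d0); apply: le_lt_trans sN.
    by move: cs => /andP[].
  rewrite (bigD1_seq k) ?mem_index_iota ?iota_uniq//= indicE mem_set//.
  rewrite scale1r big1 ?addr0// => j; exact: vanish.
rewrite -leNgt => Ns; rewrite big_seq big1// => j; rewrite mem_index_iota /= => jN.
apply: vanish; apply/eqP => jk; move: cs => /andP[_]; rewrite -jk ltNge.
by rewrite (le_trans _ Ns)// ler_pM2r// ler_nat.
Qed.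

Lemma grid_error F (M e d : R) N s : (forall s, 0 <= s -> rnorm (F s) <= M) ->
  0 <= e -> (forall s r, 0 <= s -> 0 <= r -> `|s - r| <= d -> rnorm (F s - F r) <= e) ->
  0 < d -> 0 <= s ->
  rnorm (F s - simple_val (grid F d N) s) <= e + M * \1_[set r | N%:R * d <= r] s.
Proof.
move=> FM e0 Fe d0 s0; have M0 : 0 <= M by apply: le_trans (FM _ s0); exact: rnorm_ge0.
rewrite simple_val_grid// indicE; case: ifPn => [sN|].
  rewrite (@le_trans _ _ e)//; last by rewrite lerDl mulr_ge0.
  apply: Fe => //; first by rewrite mulr_ge0// ltW.
  have /= /andP[h1 h2] := cell_truncn d0 s0.
  rewrite ger0_norm ?subr_ge0// lerBlDr ltW//.
  by move: h2; rewrite -natr1 mulrDl mul1r addrC.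
by rewrite -leNgt => Ns; rewrite mem_set// mulr1 subr0 ler_wpDl// FM.
Qed.

Lemma finite_measure_tail nu (e : R) : 0 < e ->
  exists2 K : R, 0 < K & forall r, K <= r -> (nu [set s : R | (r <= s)%R] <= e%:E)%E.
Proof.
move=> e0; pose F n := `[n%:R : R, +oo[%classic.
have mF n : measurable (F n : set (mR R)) by exact: measurable_itv.
have F0 : \bigcap_n F n = set0.
  apply/seteqP; split => // s /= Fs.
  have := Fs (Num.truncn s).+1 Logic.I; rewrite /F /= in_itv /= andbT.
  by rewrite leNgt truncnS_gt.
have : (nu \o F) n @[n --> \oo] --> nu (\bigcap_n F n).
  apply: nonincreasing_cvg_mu => //.
  - by rewrite -ge0_fin_numE// fin_num_measure.
  - by rewrite F0.
  - move=> m n mn; apply/subsetPset => s; rewrite /F /= !in_itv /= !andbT.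
    by apply: le_trans; rewrite ler_nat.
rewrite F0 measure0 => /fine_cvgP[_ /cvgrPdist_le /(_ _ e0)[N _ NF]].
exists N.+1%:R; first by rewrite ltr0n.
move=> r Nr; have /= := NF N.+1 (leqnSn _); rewrite sub0r normrN ger0_norm ?fine_ge0// => le_e.
have mr : measurable ([set s | r <= s] : set (mR R)).
  rewrite (_ : [set s | r <= s] = `[r, +oo[%classic); first exact: measurable_itv.
  by apply/seteqP; split => s /=; rewrite in_itv /= andbT.
apply: (@le_trans _ _ (nu (F N.+1))).
  apply: le_measure; rewrite ?inE// => s /= rs.
  by rewrite /F /= in_itv /= andbT (le_trans Nr).
by rewrite -(fineK (fin_num_measure nu _ (mF N.+1))) lee_fin.
Qed.

(** On [0, N d) the error is at most the modulus of continuity of [F]; beyond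
    it, the bound of [F] is multiplied by the small mass of the tail. *)
Lemma grid_integral_cvg nu F (e : R) : buc F -> 0 < e ->
  exists d0 K : R, [/\ 0 < d0, 0 < K &
    forall d N, 0 < d -> d < d0 -> K <= N%:R * d ->
      (\int[nu]_(s in D) (rnorm (F s - simple_val (grid F d N) s))%:E <= e%:E)%E].
Proof.
move=> bF e0; have [[M FM] Fu] := bF.
have M0 : 0 <= M by apply: le_trans (FM 0 _); rewrite ?rnorm_ge0.
pose m := fine (nu D); have m0 : 0 <= m by rewrite fine_ge0.
have e1 : 0 < e / 2 / (m + 1) by rewrite !divr_gt0// ltr_wpDl.
have e2 : 0 < e / 2 / (M + 1) by rewrite !divr_gt0// ltr_wpDl.
have [d0 d00 Fd] := Fu _ e1; have [K K0 tailK] := finite_measure_tail nu e2.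
exists d0, K; split => // d N dgt0 dd0 KN.
have mt : measurable ([set s | N%:R * d <= s] : set (mR R)).
  rewrite (_ : [set s | _ <= s] = `[N%:R * d, +oo[%classic); first exact: measurable_itv.
  by apply/seteqP; split => s /=; rewrite in_itv /= andbT.
apply: (@le_trans _ _ (\int[nu]_(s in D) ((e / 2 / (m + 1))%:E +
   M%:E * (\1_[set r : R | (N%:R * d <= r)%R] s)%:E))%E).
  apply: ge0_le_integral => //.
  - by move=> s _; rewrite lee_fin rnorm_ge0.
  - apply/measurable_EFinP; apply: measurable_rnorm_sub_simple => //.
    exact: msimple_grid.
  - apply: emeasurable_funD => //; apply: emeasurable_funM => //.
    by apply/measurable_EFinP; exact: measurable_indic.
  - move=> s s0; rewrite -EFinM -EFinD lee_fin grid_error// ?ltW//.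
    by move=> s1 r1 s10 r10 sr; apply: Fd => //; exact: le_lt_trans sr dd0.
rewrite ge0_integralD//; first last.
- apply: emeasurable_funM => //.
  by apply/measurable_EFinP; exact: measurable_indic.
- by move=> s _; rewrite -EFinM lee_fin mulr_ge0.
- by move=> s _; rewrite lee_fin ltW.
rewrite ge0_integralZl//; first last.
- by apply/measurable_EFinP; exact: measurable_indic.
rewrite integral_cst// integral_indic//.
have nuD : nu D = m%:E by rewrite /m fineK ?fin_num_measure.
rewrite [X in (_ * X + _)%E](_ : _ = m%:E)//.
rewrite [leRHS](_ : _ = (e / 2)%:E + (e / 2)%:E)%E; last by rewrite -EFinD -splitr.
apply: leeD.
  rewrite -EFinM lee_fin mulrAC ler_pdivrMr ?ltr_wpDl//.
  by rewrite ler_pM2l ?divr_gt0// lerDl.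
apply: (@le_trans _ _ (M%:E * (e / 2 / (M + 1))%:E)%E).
  apply: lee_pmul => //.
  apply: (le_trans _ (tailK _ KN)); apply: le_measure.
  - by rewrite inE; apply: measurableI => //; exact: measurable_nonneg_reals.
  - by rewrite inE.
  - exact: subIsetl.
rewrite -EFinM lee_fin mulrA ler_pdivrMr ?ltr_wpDl// mulrC.
by rewrite ler_pM2l ?divr_gt0// lerDl.
Qed.

End grid_theory.

(** * Bochner integrals as limits of Riemann sums *)

Section rsum_limits.
Context (R : realType) (X : normedModType R[i]).
Implicit Types (F : R -> X) (nu : fmeas R).
Local Notation D := (nonneg_reals (R := R)).

Lemma rlim_cvg nu F y (h : R) (N : nat -> nat) : rlim nu F y -> 0 < h ->
  (forall m, m.+1 ^ 2 <= N m)%N ->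
  rsum nu F (h / m.+1%:R) (N m) @[m --> \oo] --> y.
Proof.
move=> Fy h0 mN; apply/cvg_rnormP => e e0.
have [d0 [K [d00 K0 Fe]]] := Fy _ (divr_gt0 e0 (ltr0Sn _ 1)).
exists (maxn (Num.truncn (h / d0)) (Num.truncn (K / h))) => // m /=.
rewrite geq_max => /andP[m1 m2].
rewrite (@le_lt_trans _ _ (e / 2))// ?ltr_pdivrMr ?ltr_pMr// ?ltr1n//.
apply: Fe; first by rewrite divr_gt0.
  rewrite ltr_pdivrMr// mulrC -ltr_pdivrMr//.
  by rewrite (lt_le_trans (truncnS_gt _))// ler_nat.
rewrite mulrCA mulrC -ler_pdivrMr//.
rewrite (@le_trans _ _ m.+1%:R)//.
  by rewrite ltW// (lt_le_trans (truncnS_gt _))// ler_nat.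
rewrite ler_pdivlMr// -natrM ler_nat.
by rewrite (leq_trans _ (mN m))// expnS expn1.
Qed.

Lemma rlim_unique nu F y y' : rlim nu F y -> rlim nu F y' -> y = y'.
Proof.
move=> Fy Fy'.
have c := rlim_cvg Fy ltr01 (fun m => leqnn _).
have c' := rlim_cvg Fy' ltr01 (fun m => leqnn _).
exact: rcvg_unique c c'.
Qed.

(** Grids approximate [F] in mean, as do the simple functions of a Bochner
    integral, so both have integrals close to each other. In particular the
    integral is unique ([rlim_unique]). *)
Lemma bochner_rlim nu F y : buc F -> bochner_integral nu D F y -> rlim nu F y.
Proof.
move=> bF [S [mS _ /fine_cvgP[Sfin /cvgrPdist_lt SF] /cvg_rnormP Sy]] e e0.
have e3 : 0 < e / 3 by rewrite divr_gt0.
have [d0 [K [d00 K0 gF]]] := grid_integral_cvg nu bF e3.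
exists d0, K; split => // d N dgt0 dd0 KN.
have [k [[Sf SFk] Syk]] := filter_ex (filterI (filterI Sfin (SF _ e3)) (Sy _ e3)).
have mSk : msimple (S k) by move=> p pS; exact: (mS k p pS).
have := simple_integral_sub_bound nu bF (@msimple_grid _ _ F d N) mSk.
rewrite (simple_integral_grid _ _ _ (ltW dgt0)) => le1.
have {}le1 : rnorm (rsum nu F d N - simple_integral nu D (S k)) <= e / 3 + e / 3.
  rewrite -lee_fin (le_trans le1)// EFinD leeD//; first exact: gF.
  rewrite -(fineK Sf) lee_fin ltW//.
  apply: le_lt_trans SFk; rewrite sub0r normrN.
  exact: ler_norm.
have := rnorm_triangle (simple_integral nu D (S k)) (rsum nu F d N) y.
by move: le1 (ltW Syk) => /=; lra.
Qed.

Lemma rlim_bound nu F y : buc F -> rlim nu F y ->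
  ((rnorm y)%:E <= \int[nu]_(s in D) (rnorm (F s))%:E)%E.
Proof.
move=> bF Fy; apply/lee_addgt0Pr => e e0.
have e2 : 0 < e / 2 by rewrite divr_gt0.
have [d0 [K [d00 K0 gF]]] := grid_integral_cvg nu bF e2.
have [d1 [K1 [d10 K10 gy]]] := Fy _ e2.
pose d := Num.min d0 d1 / 2; have dgt0 : 0 < d by rewrite divr_gt0// lt_min d00.
have dmin : d < Num.min d0 d1 by rewrite ltr_pdivrMr// ltr_pMr ?ltr1n// lt_min d00.
move: dmin; rewrite lt_min => /andP[dd0 dd1].
pose N := (Num.truncn (Num.max K K1 / d)).+1.
have : Num.max K K1 <= N%:R * d.
  by rewrite -ler_pdivrMr// ltW// truncnS_gt.
rewrite ge_max => /andP[KN KN1].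
have := simple_integral_le nu bF (@msimple_grid _ _ F d N).
rewrite (simple_integral_grid _ _ _ (ltW dgt0)) => le1.
apply: (@le_trans _ _ ((rnorm (rsum nu F d N))%:E + (e / 2)%:E)%E).
  rewrite -EFinD lee_fin addrC -lerBlDr (le_trans (rnorm_lerB _ _))// rnorm_distC.
  exact: gy.
rewrite [e in leRHS]splitr EFinD addeA leeD2r//.
by apply: (le_trans le1); rewrite addeC leeD2l// gF.
Qed.

Lemma rlim_bound_le nu F y (g : R -> R) : buc F -> rlim nu F y ->
  measurable_fun (D : set (mR R)) g ->
  (forall s, 0 <= s -> rnorm (F s) <= g s) ->
  ((rnorm y)%:E <= \int[nu]_(s in D) (g s)%:E)%E.
Proof.
move=> bF Fy mg Fg; apply: (le_trans (rlim_bound bF Fy)).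
apply: ge0_le_integral => //.
- by move=> s _; rewrite lee_fin rnorm_ge0.
- by apply/measurable_EFinP; exact: buc_measurable.
- exact/measurable_EFinP.
Qed.

Lemma rlim_bound_cst nu F y (M : R) : buc F -> rlim nu F y ->
  (forall s, 0 <= s -> rnorm (F s) <= M) -> rnorm y <= M * fine (nu D).
Proof.
move=> bF Fy FM.
have := rlim_bound_le bF Fy (measurable_cst M) FM.
rewrite (@integral_cst _ _ _ nu _ (@measurable_nonneg_reals R) M%:E).
by rewrite -lee_fin EFinM fineK// fin_num_measure.
Qed.

Lemma rsumD nu F G d N :
  rsum nu (fun s => F s + G s) d N = rsum nu F d N + rsum nu G d N.
Proof. by rewrite -big_split /=; apply: eq_bigr => j _; rewrite scalerDr. Qed.

Lemma rsumZ nu F (a : R[i]) d N :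
  rsum nu (fun s => a *: F s) d N = a *: rsum nu F d N.
Proof.
by rewrite /rsum scaler_sumr; apply: eq_bigr => j _; rewrite !scalerA mulrC.
Qed.

Lemma rsum_lin nu F (L : {linear X -> X}) d N :
  rsum nu (fun s => L (F s)) d N = L (rsum nu F d N).
Proof. by rewrite /rsum linear_sum; apply: eq_bigr => j _; rewrite linearZ. Qed.

(** Only the masses of the cells enter the Riemann sums; a relation between
    them is a relation between the integrals. *)
Lemma rlim_measureD (nu1 nu2 nu3 : fmeas R) (a b : R) F y1 y2 y3 :
  rlim nu1 F y1 -> rlim nu2 F y2 -> rlim nu3 F y3 ->
  (forall d j, 0 < d -> fine (nu3 (cell d j)) =
     a * fine (nu1 (cell d j)) + b * fine (nu2 (cell d j))) ->
  y3 = a%:C *: y1 + b%:C *: y2.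
Proof.
move=> F1 F2 F3 nuE; apply: rcvg_unique (rlim_cvg F3 ltr01
  (fun m => leqnn (m.+1 ^ 2))) _.
rewrite (_ : (fun m => _) = (fun m =>
   a%:C *: rsum nu1 F (1 / m.+1%:R) (m.+1 ^ 2) +
   b%:C *: rsum nu2 F (1 / m.+1%:R) (m.+1 ^ 2))); last first.
  apply/funext => m; rewrite /rsum !scaler_sumr -big_split /=.
  apply: eq_bigr => j _; rewrite nuE ?divr_gt0//.
  by rewrite rmorphD !rmorphM scalerDl !scalerA.
by apply: cvgD; apply: cvgZr; apply: rlim_cvg => // m; exact: leqnn.
Qed.

End rsum_limits.

Section bochner_existence.
Context (R : realType) (X : completeNormedModType R[i]).
Implicit Types (F G : R -> X) (nu : fmeas R).
Local Notation D := (nonneg_reals (R := R)).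

Lemma bochner_exists nu F : buc F -> exists y, bochner_integral nu D F y.
Proof.
move=> bF; pose S m := grid F (m.+1%:R)^-1 (m.+1 ^ 2).
have bS e : 0 < e -> \forall k \near \oo,
    (\int[nu]_(s in D) (rnorm (F s - simple_val (S k) s))%:E <= e%:E)%E.
  move=> e0; have [d0 [K [d00 K0 gF]]] := grid_integral_cvg nu bF e0.
  exists (maxn (Num.truncn d0^-1) (Num.truncn K)) => // k /=.
  rewrite geq_max => /andP[k1 k2]; apply: gF => //.
  - rewrite -[ltRHS]invrK ltf_pV2 ?posrE ?invr_gt0//.
    by rewrite (lt_le_trans (truncnS_gt _))// ler_nat.
  - rewrite natrX expr2 mulfK//.
    by rewrite ltW// (lt_le_trans (truncnS_gt _))// ler_nat.
have S0 k : (0 <= \int[nu]_(s in D) (rnorm (F s - simple_val (S k) s))%:E)%E.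
  by apply: integral_ge0 => s _; rewrite lee_fin rnorm_ge0.
have fS k (e : R) : (\int[nu]_(s in D) (rnorm (F s - simple_val (S k) s))%:E <= e%:E)%E ->
    (\int[nu]_(s in D) (rnorm (F s - simple_val (S k) s))%:E)%E \is a fin_num.
  by move=> le_e; rewrite ge0_fin_numE// (le_lt_trans le_e)// ltry.
have SF : (\int[nu]_(s in D) (rnorm (F s - simple_val (S k) s))%:E)%E
          @[k --> \oo] --> 0%E.
  apply/fine_cvgP; split; first by apply: filterS (bS _ ltr01) => k; exact: fS.
  apply/cvgrPdist_le => e e0; apply: filterS (bS _ e0) => k le_e.
  rewrite sub0r normrN ger0_norm ?fine_ge0//.
  by rewrite -lee_fin fineK// (fS _ _ le_e).
have mS k : msimple (S k) by exact: msimple_grid.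
have [y Sy] : exists y : X, simple_integral nu D (S k) @[k --> \oo] --> y.
  apply: rnorm_cauchy_cvg => e e0.
  have e2 : 0 < (e / 2) by rewrite divr_gt0.
  move: SF => /fine_cvgP[[N1 _ Sfin] /cvgrPdist_lt /(_ _ e2)[N2 _ SFe]].
  exists (maxn N1 N2) => m n; rewrite !geq_max => /andP[m1 m2] /andP[n1 n2].
  have bd k : (N1 <= k)%N -> (N2 <= k)%N ->
      (\int[nu]_(s in D) (rnorm (F s - simple_val (S k) s))%:E <= (e / 2)%:E)%E.
    move=> k1 k2; rewrite -(fineK (Sfin _ k1)) lee_fin ltW//.
    by apply: le_lt_trans (SFe _ k2); rewrite sub0r normrN ler_norm.
  rewrite -lee_fin (le_trans (simple_integral_sub_bound nu bF (mS m) (mS n)))//.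
  by rewrite [e in leRHS]splitr EFinD leeD// bd.
exists y, S; split; [by move=> k p /mS | | exact: SF | exact: Sy].
apply: aeW => s s0; apply/cvg_rnormP => e e0.
have [[M FM] Fu] := bF; have [d d0 Fd] := Fu _ (divr_gt0 e0 (ltr0Sn _ 1)).
exists (maxn (Num.truncn d^-1) (Num.truncn s)) => // k /=.
rewrite geq_max => /andP[k1 k2]; rewrite rnorm_distC.
rewrite (@le_lt_trans _ _ (e / 2))// ?ltr_pdivrMr ?ltr_pMr// ?ltr1n//.
have k0 : 0 < (k.+1%:R)^-1 :> R by rewrite invr_gt0.
have ge := @grid_error _ _ F M (e / 2) _ (k.+1 ^ 2) s FM _ _ k0 s0.
apply: (le_trans (ge _ _)).
- by rewrite divr_ge0// ltW.
- move=> s1 r1 s10 r10 sr; apply: Fd => //; apply: (le_lt_trans sr).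
  rewrite -[ltRHS]invrK ltf_pV2 ?posrE ?invr_gt0//.
  by rewrite (lt_le_trans (truncnS_gt _))// ler_nat.
- rewrite indicE memNset ?mulr0 ?addr0//= natrX expr2 mulfK//.
  by apply/negP; rewrite -ltNge (lt_le_trans (truncnS_gt _))// ler_nat.
Unshelve. all: by end_near. Qed.

(** The default value 0 is never met for [buc] functions ([BintP]). *)
Definition Bint nu F : X := xget 0 [set y | bochner_integral nu D F y].

Lemma BintP nu F : buc F -> bochner_integral nu D F (Bint nu F).
Proof.
move=> bF; have [y Fy] := bochner_exists nu bF.
exact: (@xgetPex _ 0 [set y | bochner_integral nu D F y]) (ex_intro _ y Fy).
Qed.

Lemma rlim_Bint nu F : buc F -> rlim nu F (Bint nu F).
Proof. by move=> bF; apply: bochner_rlim => //; exact: BintP. Qed.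

Lemma rlim_BintE nu F y : buc F -> rlim nu F y -> Bint nu F = y.
Proof. by move=> bF; apply: rlim_unique; exact: rlim_Bint. Qed.

Lemma bochner_BintE nu F y : buc F -> bochner_integral nu D F y -> Bint nu F = y.
Proof. by move=> bF /(bochner_rlim bF); exact: rlim_BintE. Qed.

Lemma BintD nu F G : buc F -> buc G ->
  Bint nu (fun s => F s + G s) = Bint nu F + Bint nu G.
Proof.
move=> bF bG; apply: rcvg_unique (rlim_cvg (rlim_Bint nu (bucD bF bG)) ltr01
  (fun m => leqnn (m.+1 ^ 2))) _.
under eq_fun do rewrite rsumD.
by apply: cvgD; exact: rlim_cvg (rlim_Bint _ _) ltr01 _.
Qed.

Lemma BintZ nu F (a : R[i]) : buc F -> Bint nu (fun s => a *: F s) = a *: Bint nu F.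
Proof.
move=> bF; apply: rcvg_unique (rlim_cvg (rlim_Bint nu (bucZ a bF)) ltr01
  (fun m => leqnn (m.+1 ^ 2))) _.
under eq_fun do rewrite rsumZ.
by apply: cvgZr; exact: rlim_cvg (rlim_Bint _ _) ltr01 _.
Qed.

Lemma Bint_lin nu F (L : {linear X -> X}) : continuous L -> buc F ->
  buc (fun s => L (F s)) -> Bint nu (fun s => L (F s)) = L (Bint nu F).
Proof.
move=> cL bF bLF; apply: rcvg_unique (rlim_cvg (rlim_Bint nu bLF) ltr01
  (fun m => leqnn (m.+1 ^ 2))) _.
under eq_fun do rewrite rsum_lin.
apply: continuous_cvg; first exact: cL.
exact: rlim_cvg (rlim_Bint _ _) ltr01 _.
Qed.

Lemma Bint_measureD (nu1 nu2 nu3 : fmeas R) (a b : R) F : buc F ->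
  (forall d j, 0 < d -> fine (nu3 (cell d j)) =
     a * fine (nu1 (cell d j)) + b * fine (nu2 (cell d j))) ->
  Bint nu3 F = a%:C *: Bint nu1 F + b%:C *: Bint nu2 F.
Proof. by move=> bF nuE; apply: rlim_measureD nuE; exact: rlim_Bint. Qed.

Lemma Bint_bound nu F (M : R) : buc F -> (forall s, 0 <= s -> rnorm (F s) <= M) ->
  rnorm (Bint nu F) <= M * fine (nu D).
Proof. by move=> bF; apply: rlim_bound_cst => //; exact: rlim_Bint. Qed.

End bochner_existence.

(** * The complex exponential *)

Section complex_plane.
Context (R : realType).
Implicit Types (z w : R[i]) (r s h : R).

Lemma cmod_ge0 z : 0 <= cmod z.
Proof. exact: (@rnorm_ge0 R R[i]^o). Qed.

Lemma cmod_def z : cmod z = Num.sqrt (complex.Re z ^+ 2 + complex.Im z ^+ 2).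
Proof. by rewrite /cmod normc_def. Qed.

Lemma cmodM z w : cmod (z * w) = cmod z * cmod w.
Proof. exact: (@rnormZ R R[i]^o). Qed.

Lemma cmodD z w : cmod (z + w) <= cmod z + cmod w.
Proof. exact: (@rnormD R R[i]^o). Qed.

Lemma cmodN z : cmod (- z) = cmod z.
Proof. exact: (@rnormN R R[i]^o). Qed.

Lemma cmod1 : cmod (1 : R[i]) = 1.
Proof. by rewrite /cmod normr1. Qed.

Lemma cmod0 : cmod (0 : R[i]) = 0.
Proof. by rewrite /cmod normr0. Qed.

Lemma cmod_eq0 z : cmod z = 0 -> z = 0.
Proof. exact: (@rnorm_eq0 R R[i]^o). Qed.

Lemma cmod_gt0 z : (0 < cmod z) = (z != 0).
Proof.
rewrite lt_def cmod_ge0 andbT; congr negb; apply/eqP/eqP => [/cmod_eq0//|->].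
exact: cmod0.
Qed.

Lemma cmodV z : cmod z^-1 = (cmod z)^-1.
Proof.
have [->|z0] := eqVneq z 0; first by rewrite invr0 cmod0 invr0.
have := cmodM z z^-1; rewrite divff// cmod1 => h.
by apply: (@mulfI _ (cmod z)); rewrite ?gt_eqF ?cmod_gt0// divff ?gt_eqF ?cmod_gt0.
Qed.

Lemma cmodX z n : cmod (z ^+ n) = cmod z ^+ n.
Proof. by elim: n => [|n IH]; rewrite ?expr0 ?cmod1// !exprS cmodM IH. Qed.

Lemma cReD z w : complex.Re (z + w) = complex.Re z + complex.Re w.
Proof. by case: z; case: w. Qed.

Lemma cImD z w : complex.Im (z + w) = complex.Im z + complex.Im w.
Proof. by case: z; case: w. Qed.

Lemma cReN z : complex.Re (- z) = - complex.Re z. Proof. by case: z. Qed.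

Lemma cImN z : complex.Im (- z) = - complex.Im z. Proof. by case: z. Qed.

Lemma cReM z w : complex.Re (z * w) =
  complex.Re z * complex.Re w - complex.Im z * complex.Im w.
Proof. by case: z; case: w. Qed.

Lemma cImM z w : complex.Im (z * w) =
  complex.Re z * complex.Im w + complex.Im z * complex.Re w.
Proof. by case: z => a b; case: w. Qed.

Lemma ler_Re_cmod z : `|complex.Re z| <= cmod z.
Proof. by rewrite cmod_def -sqrtr_sqr ler_wsqrtr// lerDl sqr_ge0. Qed.

Lemma ler_Im_cmod z : `|complex.Im z| <= cmod z.
Proof. by rewrite cmod_def -sqrtr_sqr ler_wsqrtr// lerDr sqr_ge0. Qed.

Lemma cmod_le z : cmod z <= `|complex.Re z| + `|complex.Im z|.
Proof.
rewrite cmod_def -[leRHS]ger0_norm ?addr_ge0// -sqrtr_sqr ler_wsqrtr//.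
by rewrite sqrrD !real_normK ?num_real// -addrA addrCA lerDr mulrn_wge0// mulr_ge0.
Qed.

Lemma cvg_complexP {T : Type} {F : set_system T} {FF : Filter F} (f : T -> R[i]) (l : R[i]) :
  complex.Re (f t) @[t --> F] --> complex.Re l ->
  complex.Im (f t) @[t --> F] --> complex.Im l -> (f : T -> R[i]^o) @ F --> (l : R[i]^o).
Proof.
move=> /cvgrPdist_lt fr /cvgrPdist_lt fi; apply/cvg_rnormP => e e0.
have e2 : 0 < e / 2 by rewrite divr_gt0.
apply: filterS2 (fr _ e2) (fi _ e2) => t tr ti.
apply: le_lt_trans (cmod_le _) _; rewrite [ltRHS]splitr.
by rewrite cReD cImD cReN cImN ltrD// distrC.
Qed.

Lemma cexpD z w : cexp (z + w) = cexp z * cexp w.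
Proof.
case: z => a b; case: w => c d; rewrite /cexp /= expRD cosD sinD.
by apply/eqP; rewrite eq_complex /=; apply/andP; split; apply/eqP; ring.
Qed.

Lemma cexp0 : cexp 0 = 1 :> R[i].
Proof. by rewrite /cexp /= expR0 cos0 sin0 mulr1 mulr0. Qed.

Lemma cmod_cexp z : cmod (cexp z) = expR (complex.Re z).
Proof.
rewrite cmod_def /cexp /= !exprMn -mulrDr cos2Dsin2 mulr1 sqrtr_sqr.
by rewrite ger0_norm ?expR_ge0.
Qed.

Lemma cexp_neq0 z : cexp z != 0.
Proof. by rewrite -cmod_gt0 cmod_cexp expR_gt0. Qed.

Lemma cexpN z : cexp (- z) = (cexp z)^-1.
Proof.
apply: (@mulfI _ (cexp z)); rewrite ?cexp_neq0// divff ?cexp_neq0//.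
by rewrite -cexpD subrr cexp0.
Qed.

Lemma cexp_real r : cexp r%:C = (expR r)%:C.
Proof. by rewrite /cexp /= cos0 sin0 mulr1 mulr0. Qed.

(** One-sided difference quotients, the form in which derivatives occur in
    generators of semigroups. *)
Lemma is_derive_cvg_right (f : R -> R) (x l : R) : is_derive x 1 f l ->
  h^-1 * (f (h + x) - f x) @[h --> 0^'+] --> l.
Proof.
move=> fl; have [+ <-] := fl.
rewrite /derivable /derive => fx.
apply: cvg_dnbhs_at_right => //.
rewrite [X in X @ _ --> _](_ : _ = (fun h => h^-1 *: ((f \o shift x) (h *: 1) - f x)))//.
by apply/funext => h /=; rewrite /GRing.scale /= mulr1.
Qed.

Lemma cexp_derive0 z : (h^-1)%:C * (cexp (h%:C * z) - 1) @[h --> 0^'+] --> (z : R[i]^o).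
Proof.
case: z => x y.
have E h : (h^-1)%:C * (cexp (h%:C * (x +i* y)) - 1) =
    (h^-1 * (expR (h * x) * cos (h * y) - 1)) +i*
    (h^-1 * (expR (h * x) * sin (h * y) - 0)).
  by rewrite /cexp /= !mul0r !subr0 !addr0; apply/eqP; rewrite eq_complex /= !mul0r !subr0 !addr0 !eqxx.
under eq_fun do rewrite E.
apply: cvg_complexP => /=.
- have d : is_derive (0 : R) (1 : R) (fun h : R => expR (h * x) * cos (h * y)) x.
    apply: is_derive_eq; rewrite !mul0r expR0 cos0 sin0 /GRing.scale /=.
    by rewrite !(mulr1, mul1r, mulr0, mul0r, oppr0, addr0, add0r).
  have := is_derive_cvg_right d; under eq_fun do rewrite addr0.
  by rewrite !mul0r expR0 cos0 mulr1.
- have d : is_derive (0 : R) (1 : R) (fun h : R => expR (h * x) * sin (h * y)) y.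
    apply: is_derive_eq; rewrite !mul0r expR0 cos0 sin0 /GRing.scale /=.
    by rewrite !(mulr1, mul1r, mulr0, mul0r, oppr0, addr0, add0r).
  have := is_derive_cvg_right d; under eq_fun do rewrite addr0.
  by rewrite !mul0r expR0 sin0 mulr0.
Qed.

End complex_plane.

(** * Bounded semigroups and exponential laws *)

(** Only the masses of intervals are prescribed: these are all that Riemann
    sums see. *)
Definition exponential_law (R : realType) (a : R) (nu : fmeas R) :=
  forall s r, 0 <= s -> s <= r ->
    fine (nu [set x | s <= x < r]) = expR (- (a * s)) - expR (- (a * r)).

Lemma sum_nat_shift (V : zmodType) m n (F : nat -> V) :
  \sum_(m <= j < m + n) F j = \sum_(0 <= j < n) F (m + j)%N.
Proof.
rewrite -{1}[m]add0n big_addn addKn.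
by apply: eq_bigr => j _; rewrite addnC.
Qed.

Section semigroup_theory.
Context (R : realType) (X : normedModType R[i]) (T : R -> {linear X -> X}).
Hypothesis hT : bounded_C0_semigroup T.
Local Notation D := (nonneg_reals (R := R)).

Lemma semigroup_bound : exists2 M : R, 0 < M &
  forall t x, 0 <= t -> rnorm (T t x) <= M * rnorm x.
Proof.
have [M TM] := semigroup_bounded hT; exists (`|M| + 1); first by rewrite ltr_wpDl.
move=> t x t0; rewrite (le_trans (TM _ _ t0))// ler_wpM2r ?rnorm_ge0//.
by rewrite (le_trans (ler_norm _))// lerDl.
Qed.

Lemma semigroup_continuous t : 0 <= t -> continuous (T t).
Proof.
have [M _ TM] := semigroup_bound.
by move=> t0; apply: rnorm_bounded_cts => x; exact: TM.
Qed.

Lemma semigroup_near0 x (e : R) : 0 < e ->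
  exists2 d : R, 0 < d & forall h, 0 <= h -> h < d -> rnorm (T h x - x) <= e.
Proof.
move=> e0; have : T h x @[h --> 0^'+] --> x by exact: semigroup_cvg0.
move=> /cvg_rnormP/(_ _ e0).
case=> d /= d0 dT; exists d => // h; rewrite le_eqVlt => /orP[/eqP <- _|h0 hd].
  by rewrite (semigroup0 hT) subrr rnorm0 ltW.
by apply/ltW/dT => //=; rewrite sub0r normrN gtr0_norm.
Qed.

(** A bounded strongly continuous semigroup has uniformly continuous orbits,
    because [T s x - T r x = T r (T (s - r) x - x)]. *)
Lemma semigroup_buc x : buc (fun s => T s x).
Proof.
have [M M0 TM] := semigroup_bound; split.
  by exists (M * rnorm x) => s; exact: TM.
move=> e e0; have [d d0 Td] := semigroup_near0 x (divr_gt0 e0 M0).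
exists d => // s r.
wlog sr : s r / r <= s => [H s0 r0|s0 r0].
  have /orP[rs|sr] := le_total r s; first exact: (H s r rs s0 r0).
  by rewrite distrC rnorm_distC; exact: (H r s sr r0 s0).
rewrite ger0_norm ?subr_ge0// => dsr.
have -> : T s x = T r (T (s - r) x).
  by rewrite -(semigroupD hT) ?subr_ge0// addrC subrK.
rewrite -raddfB.
rewrite (le_trans (TM _ _ r0))// mulrC -ler_pdivlMr//.
by apply: Td; rewrite ?subr_ge0.
Qed.

Lemma cell_shift (a d : R) (nu : fmeas R) m i : exponential_law a nu -> 0 <= d ->
  fine (nu (cell d (m + i))) = expR (- (a * (m%:R * d))) * fine (nu (cell d i)).
Proof.
move=> nua d0; have mono j : j%:R * d <= j.+1%:R * d by rewrite ler_wpM2r// ler_nat.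
rewrite /cell !nua ?mulr_ge0// mulrBr -!expRD.
by congr (expR _ - expR _); rewrite -?addnS natrD; ring.
Qed.

Lemma sum_cell_exponential (a d : R) (nu : fmeas R) m : exponential_law a nu -> 0 <= d ->
  \sum_(0 <= j < m) fine (nu (cell d j)) = 1 - expR (- (a * (m%:R * d))).
Proof.
move=> nua d0.
rewrite (eq_bigr (fun j => (- expR (- (a * (j.+1%:R * d)))) - (- expR (- (a * (j%:R * d)))))).
  by rewrite telescope_sumr// !mul0r mulr0 oppr0 expR0 opprK addrC.
move=> j _; rewrite /cell nua ?mulr_ge0// ?opprK 1?addrC//.
by rewrite ler_wpM2r// ler_nat.
Qed.

(** Splitting a Riemann sum of the exponential law at [h] uses only that the
    law is memoryless; what is left over is an average of [T s x] for
    [s < h]. *)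
Lemma resolvent_shift (a h e : R) (nu : fmeas R) x y : exponential_law a nu ->
  rlim nu (fun s => T s x) y -> 0 < h ->
  (forall r, 0 <= r -> r < h -> rnorm (T r x - x) <= e) ->
  rnorm ((y - (expR (- (a * h)))%:C *: T h y) - (1 - expR (- (a * h)))%:C *: x)
    <= (1 - expR (- (a * h))) * e.
Proof.
move=> nua Fy h0 Te; set q := expR _; pose F s := T s x.
(* With mesh [h / m.+1] the first [m.+1] cells fill [0, h), and the remaining
   ones are the cells of [v m] shifted by [h]. *)
pose u m := rsum nu F (h / m.+1%:R) (m.+1 + m.+1 ^ 2).
pose v m := rsum nu F (h / m.+1%:R) (m.+1 ^ 2).
have uy : u m @[m --> \oo] --> y by apply: rlim_cvg => // m; exact: leq_addl.
have vy : v m @[m --> \oo] --> y by exact: rlim_cvg.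
have Tv : T h (v m) @[m --> \oo] --> T h y.
  by apply: continuous_cvg => //; exact: semigroup_continuous (ltW h0) _.
have wy : u m - q%:C *: T h (v m) @[m --> \oo] --> y - q%:C *: T h y.
  by apply: cvgB => //; apply: cvgZr.
apply: (cvg_ler_rnorm wy); apply: nearW => m.
set d := h / m.+1%:R; have d0 : 0 < d by rewrite divr_gt0.
have md : m.+1%:R * d = h by rewrite /d mulrCA divff ?mulr1// pnatr_eq0.
have -> : u m - q%:C *: T h (v m) = rsum nu F d m.+1.
  rewrite /u /v /rsum (@big_cat_nat _ _ _ m.+1) ?leq_addr//= -addrA.
  rewrite [X in _ + X](_ : _ = 0) ?addr0//; apply/eqP; rewrite subr_eq0; apply/eqP.
  rewrite sum_nat_shift linear_sum scaler_sumr; apply: eq_big_nat => j _ /=.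
  rewrite -/d (cell_shift _ _ nua) ?ltW// md -/q linearZ rmorphM scalerA.
  congr (_ *: _); rewrite /F -(semigroupD hT) ?mulr_ge0 ?(ltW h0) ?(ltW d0)//.
  by rewrite natrD mulrDl md.
have qE : 1 - q = \sum_(0 <= j < m.+1) fine (nu (cell d j)).
  by rewrite (sum_cell_exponential _ nua (ltW d0)) md.
rewrite qE rmorph_sum scaler_suml mulr_suml
  /rsum -sumrB (le_trans (rnorm_sum _ _ _))// ler_sum_nat// => j /= jm.
have nuj : 0 <= fine (nu (cell d j)).
  by apply: fine_ge0.
have jd : 0 <= j%:R * d by apply: mulr_ge0 => //; exact: ltW.
rewrite -scalerBr rnormZr ger0_norm// ler_wpM2l// Te//.
by rewrite -md ltr_pM2r// ltr_nat.
Qed.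

Lemma expR_quotient (a : R) : h^-1 * (expR (a * h) - 1) @[h --> 0^'+] --> a.
Proof.
have d : is_derive (0 : R) (1 : R) (fun h : R => expR (a * h)) a.
  by apply: is_derive_eq; rewrite mulr0 expR0 /GRing.scale /= !mulr1 mul1r.
have := is_derive_cvg_right d; under eq_fun do rewrite addr0.
by rewrite mulr0 expR0.
Qed.

(** Divide the previous estimate by [h] and let [h] tend to 0. For the negative
    generator [A] the relation reads [y = (1 + A / a)^-1 x]. *)
Lemma resolvent_generator (a : R) (nu : fmeas R) x y : 0 < a -> exponential_law a nu ->
  rlim nu (fun s => T s x) y -> generator T (y, a%:C *: (y - x)).
Proof.
move=> a0 nua Fy; rewrite /generator /=.
apply/cvg_rnormP => e e0.
have /cvgrPdist_lt qcv := @expR_quotient a.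
have C0 : 0 < a + 1 by rewrite ltr_wpDl// ltW.
have N0 : 0 < rnorm (y - x) + 1 by rewrite ltr_wpDl// rnorm_ge0.
have e1 : 0 < e / 3 / (a + 1) by rewrite !divr_gt0.
have e2 : 0 < e / 3 / (rnorm (y - x) + 1) by rewrite !divr_gt0.
have [d d0 Td] := semigroup_near0 x e1.
near=> h.
have h0 : 0 < h by near: h; exact: nbhs_right_gt.
have hd : h < d by near: h; exact: nbhs_right_lt.
set p := h^-1 * (expR (a * h) - 1).
have p1 : `|a - p| < 1 by rewrite /p; near: h; exact: qcv ltr01.
have p2 : `|a - p| < e / 3 / (rnorm (y - x) + 1).
  by rewrite /p; near: h; exact: qcv e2.
have p0 : 0 <= p.
  apply: mulr_ge0; first by rewrite invr_ge0 ltW.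
  by rewrite subr_ge0 -[leLHS]expR0 ler_expR; apply: mulr_ge0; exact: ltW.
have sh := resolvent_shift nua Fy h0 (fun r r0 rh => Td r r0 (lt_trans rh hd)).
have EE : expR (a * h) * expR (- (a * h)) = 1 by rewrite -expRD subrr expR0.
set E := _ - _ in sh; pose p' := h^-1 * expR (a * h).
have p'E : p' = p + h^-1 by rewrite /p' /p mulrBr mulr1 subrK.
have -> : (h^-1)%:C *: (T h y - y) - a%:C *: (y - x) =
   - (p'%:C *: E) + (p - a)%:C *: (y - x).
  have -> : E = (y - x) - (expR (- (a * h)))%:C *: (T h y - x).
    rewrite /E rmorphB scalerBl scale1r scalerBr !opprB addrACA [RHS]addrACA.
    by congr (_ + _); rewrite addrC.
  have -> : T h y - y = (T h y - x) - (y - x) by rewrite opprB addrA subrK.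
  rewrite [in RHS]scalerBr scalerA -rmorphM /=.
  have -> : p' * expR (- (a * h)) = h^-1 by rewrite /p' -mulrA EE mulr1.
  rewrite p'E rmorphD rmorphB /= scalerDl scalerBl scalerBr.
  set HB := _ *: (T h y - x); set HA := (h^-1)%:C *: (y - x); set P := p%:C *: _.
  by rewrite opprB opprD !addrA [HB - P - HA + P]addrAC subrK.
rewrite (le_lt_trans (rnormD _ _))// rnormN !rnormZr.
have p'0 : 0 <= p' by rewrite mulr_ge0 ?invr_ge0 ?expR_ge0 ?ltW.
have b1 : `|p'| * rnorm E <= e / 3.
  rewrite ger0_norm// (le_trans (ler_wpM2l p'0 sh))// mulrA.
  have -> : p' * (1 - expR (- (a * h))) = p by rewrite /p' -mulrA mulrBr EE mulr1.
  rewrite mulrA ler_pdivrMr// mulrC ler_wpM2l ?divr_ge0 ?(ltW e0)//.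
  by move: p1; rewrite ltr_norml => /andP[]; lra.
have b2 : `|p - a| * rnorm (y - x) <= e / 3.
  rewrite distrC; have := ltW p2; rewrite ler_pdivlMr// => /(le_trans _); apply.
  by rewrite ler_wpM2l// lerDl.
by move: b1 b2; lra.
Unshelve. all: by end_near. Qed.

End semigroup_theory.

(** * Measures with a density *)

Lemma finite_measure_pack d (T : measurableType d) (R : realType)
    (mu : {measure set T -> \bar R}) : (mu setT < +oo)%E ->
  exists nu : {finite_measure set T -> \bar R}, forall A, nu A = mu A.
Proof.
move=> muT.
have fin : fin_num_fun mu.
  move=> A mA; rewrite ge0_fin_numE//; apply: le_lt_trans muT.
  by apply: le_measure; rewrite ?inE.
have sf : sigma_finite setT mu.
  by apply: fin_num_fun_sigma_finite => //; rewrite measure0.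
pose H1 := isFinite.Build _ _ _ _ fin.
pose H2 := isSFinite.Build _ _ _ _ (sfinite_measure_sigma_finite sf).
pose H3 := isSigmaFinite.Build _ _ _ _ sf.
pose nu := HB.pack_for (FiniteMeasure.type T R) (Measure.sort mu) H1 H2 H3.
by exists nu.
Qed.

Definition weighted d (T : measurableType d) (R : realType)
    (mu : {measure set T -> \bar R}) (g : T -> R) (A : set T) : \bar R :=
  (\int[mu]_(x in A) (g x)%:E)%E.

Section weighted_measure.
Context d (T : measurableType d) (R : realType) (mu : {measure set T -> \bar R}).
Variables (g : T -> R) (g0 : forall x, 0 <= g x) (mg : measurable_fun setT g).

Let weighted0 : weighted mu g set0 = 0%E.
Proof. by rewrite /weighted integral_set0. Qed.

Let weighted_ge0 A : (0 <= weighted mu g A)%E.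
Proof. by apply: integral_ge0 => x _; rewrite lee_fin. Qed.

Let weighted_sigma_additive : semi_sigma_additive (weighted mu g).
Proof.
move=> /= F mF tF mUF; rewrite /weighted; apply: cvg_toP.
  apply: ereal_nondecreasing_is_cvgn => m n mn.
  by apply: lee_sum_nneg_natr => // k _ _; apply: integral_ge0 => x _; rewrite lee_fin.
rewrite ge0_integral_bigcup//=.
- by apply/measurable_EFinP; exact: measurable_funTS.
- by move=> x _; rewrite lee_fin.
Qed.

Let mixin := isMeasure.Build _ _ _ (weighted mu g)
  weighted0 weighted_ge0 weighted_sigma_additive.
Let wm : {measure set T -> \bar R} := HB.pack (weighted mu g) mixin.

Import HBNNSimple.

(** The change of density is clear for simple functions and passes to the limit
    by monotone convergence. *)
Lemma weighted_measure : exists nu : {measure set T -> \bar R},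
  (forall A, nu A = \int[mu]_(x in A) (g x)%:E)%E /\
  (forall (D : set T) (f : T -> \bar R), measurable D -> measurable_fun D f ->
     (forall x, D x -> 0 <= f x)%E ->
     \int[nu]_(x in D) f x = \int[mu]_(x in D) (f x * (g x)%:E))%E.
Proof.
exists wm; split => // D f mD mf f0.
pose f_ := nnsfun_approx mD mf.
have mgE : measurable_fun D (EFin \o g) by apply/measurable_EFinP; exact: measurable_funTS.
have cvf x : D x -> (f_ n x)%:E @[n --> \oo] --> f x.
  by move=> Dx; apply: cvg_nnsfun_approx => // y Dy; exact: f0.
transitivity (limn (fun n => \int[wm]_(x in D) (f_ n x)%:E))%E.
  rewrite -monotone_convergence//.
  - by apply: eq_integral => x /[!inE] Dx; apply/esym/cvg_lim => //; exact: cvf.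
  - by move=> n; apply/measurable_EFinP/measurable_funTS.
  - by move=> n x _; rewrite lee_fin.
  - by move=> x _ m n mn; rewrite lee_fin; exact/lefP/nd_nnsfun_approx.
transitivity (limn (fun n => \int[mu]_(x in D) ((f_ n x)%:E * (g x)%:E)))%E; last first.
  rewrite -monotone_convergence//.
  - apply: eq_integral => x /[!inE] Dx; apply/cvg_lim => //.
    by apply: cvgeZr => //; exact: cvf.
  - move=> n; apply: emeasurable_funM => //.
    by apply/measurable_EFinP/measurable_funTS.
  - by move=> n x _; rewrite mule_ge0// lee_fin.
  - move=> x _ m n mn; apply: lee_wpmul2r; rewrite ?lee_fin//.
    exact/lefP/nd_nnsfun_approx.
congr (limn _); apply/funext => n; set h := f_ n.
have mh (k : R) : measurable (h @^-1` [set k]) by [].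
transitivity (\sum_(k \in range h) (k%:E * wm (h @^-1` [set k] `&` D)))%E.
  rewrite (eq_integral (fun x => \sum_(k \in range h) (k * \1_(h @^-1` [set k]) x)%:E)%E); last first.
    by move=> x _; rewrite fimfunE -fsumEFin.
  rewrite ge0_integral_fsum//; last 2 first.
  - by move=> y; exact/measurable_EFinP/measurable_funM.
  - by move=> y x _; rewrite nnfun_muleindic_ge0.
  apply: eq_fsbigr => k _.
  by rewrite integralZl_indic_nnsfun// integral_indic.
rewrite [RHS](eq_integral (fun x => \sum_(k \in range h)
    ((k * \1_(h @^-1` [set k]) x)%:E * (g x)%:E))%E); last first.
  by move=> x _; rewrite -ge0_mule_fsuml ?fsumEFin -?fimfunE// => k; rewrite nnfun_muleindic_ge0.
rewrite ge0_integral_fsum//; last 2 first.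
- move=> y; apply: emeasurable_funM => //.
  exact/measurable_EFinP/measurable_funM.
- move=> y x _; apply: mule_ge0; last by rewrite lee_fin.
  exact: nnfun_muleindic_ge0.
apply: eq_fsbigr => k; rewrite inE => -[x _ hk].
have k0 : 0 <= k by rewrite -hk.
rewrite [RHS](eq_integral (fun x => k%:E * ((g x)%:E * (\1_(h @^-1` [set k]) x)%:E))%E); last first.
  by move=> y _; rewrite EFinM -muleA; congr (_ * _)%E; rewrite muleC.
rewrite ge0_integralZl//; last 2 first.
- by apply: emeasurable_funM => //; apply/measurable_EFinP; exact: measurable_indic.
- by move=> y _; rewrite mule_ge0// lee_fin.
by congr (_ * _)%E; rewrite /= /weighted setIC integral_mkcondr epatch_indic.
Qed.

End weighted_measure.

Lemma weighted_finite_measure d (T : measurableType d) (R : realType)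
    (mu : {measure set T -> \bar R}) (g : T -> R) (D : set T) : measurable D ->
    measurable_fun D g -> (forall x, D x -> 0 <= g x) ->
    (\int[mu]_(x in D) (g x)%:E < +oo)%E ->
  exists nu : {finite_measure set T -> \bar R},
  forall (E : set T) (f : T -> \bar R), measurable E -> measurable_fun E f ->
     (forall x, E x -> 0 <= f x)%E ->
     (\int[nu]_(x in E) f x = \int[mu]_(x in E `&` D) (f x * (g x)%:E))%E.
Proof.
move=> mD mg g0 intg; pose h := g \_ D.
have h0 x : 0 <= h x by rewrite /h patchE; case: ifPn => // /[!inE]; exact: g0.
have mh : measurable_fun setT h by exact/(measurable_restrictT _ _).1.
have [nu0 [nu0E nu0f]] := weighted_measure mu h0 mh.
have [nu nuE] : exists nu : {finite_measure set T -> \bar R}, forall A, nu A = nu0 A.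
  apply: finite_measure_pack; rewrite nu0E.
  by move: intg; rewrite integral_mkcond /h restrict_EFin.
exists nu => E f mE mf f0.
transitivity (\int[nu0]_(x in E) f x)%E.
  by apply: eq_measure_integral => A _ _; exact: nuE.
rewrite nu0f// integral_mkcondr; apply: eq_integral => x xE.
by rewrite /h !patchE; case: ifPn; rewrite ?mule0.
Qed.

(** * Integrals of bounded complex functions *)

(** [cintegral] over an arbitrary measurable space. *)
Definition cint d (T : measurableType d) (R : realType)
    (mu : {measure set T -> \bar R}) (D : set T) (f : T -> R[i]) : R[i] :=
  Rintegral mu D (fun s => complex.Re (f s)) +i* Rintegral mu D (fun s => complex.Im (f s)).

(** Measurability and boundedness make a function integrable for every finite
    measure, and pass to sums and products. *)
Definition cbounded d (T : measurableType d) (R : realType) (D : set T) (f : T -> R[i]) :=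
  [/\ measurable_fun D (fun s => complex.Re (f s)),
      measurable_fun D (fun s => complex.Im (f s))
    & exists M, forall x, D x -> cmod (f x) <= M].

Lemma eq_cint d (T : measurableType d) (R : realType) (mu : {measure set T -> \bar R})
    (D : set T) (f g : T -> R[i]) :
  (forall x, D x -> f x = g x) -> cint mu D f = cint mu D g.
Proof.
by move=> fg; congr (_ +i* _); apply: eq_Rintegral => x /[!inE] Dx; rewrite fg.
Qed.

Lemma eq_cbounded d (T : measurableType d) (R : realType) (D : set T) (f g : T -> R[i]) :
  (forall x, D x -> f x = g x) -> cbounded D f -> cbounded D g.
Proof.
move=> fg [mr mi [M fM]]; split.
- by apply: eq_measurable_fun mr => x /[!inE] Dx; rewrite fg.
- by apply: eq_measurable_fun mi => x /[!inE] Dx; rewrite fg.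
- by exists M => x Dx; rewrite -fg// fM.
Qed.

Section bounded_integrable.
Context d (T : measurableType d) (R : realType).
Implicit Types (mu : {finite_measure set T -> \bar R}) (D : set T).

Lemma bounded_integrable mu D (f : T -> R) (M : R) : measurable D ->
  measurable_fun D f -> (forall x, D x -> `|f x| <= M) -> mu.-integrable D (EFin \o f).
Proof.
move=> mD mf fM; apply: (@le_integrable _ _ _ mu D mD _ (EFin \o cst M)).
- exact/measurable_EFinP.
- move=> x Dx /=; rewrite lee_fin (le_trans (fM _ Dx))// ler_norm//.
- by apply: finite_measure_integrable_cst.
Qed.

Lemma cbounded_Re_integrable mu D f : measurable D -> cbounded D f ->
  mu.-integrable D (EFin \o (fun s => complex.Re (f s))).
Proof.
move=> mD [mr _ [M fM]]; apply: (@bounded_integrable mu D _ M) => // x Dx.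
exact: le_trans (ler_Re_cmod _) (fM _ Dx).
Qed.

Lemma cbounded_Im_integrable mu D f : measurable D -> cbounded D f ->
  mu.-integrable D (EFin \o (fun s => complex.Im (f s))).
Proof.
move=> mD [_ mi [M fM]]; apply: (@bounded_integrable mu D _ M) => // x Dx.
exact: le_trans (ler_Im_cmod _) (fM _ Dx).
Qed.

Lemma cboundedD D (f g : T -> R[i]) : cbounded D f -> cbounded D g ->
  cbounded D (fun x => f x + g x).
Proof.
move=> [fr fi [M fM]] [gr gi [N gN]]; split.
- by under eq_fun do rewrite cReD; exact: measurable_funD.
- by under eq_fun do rewrite cImD; exact: measurable_funD.
- by exists (M + N) => x Dx; rewrite (le_trans (cmodD _ _))// lerD ?fM ?gN.
Qed.

Lemma cboundedM D (f g : T -> R[i]) : cbounded D f -> cbounded D g ->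
  cbounded D (fun x => f x * g x).
Proof.
move=> [fr fi [M fM]] [gr gi [N gN]]; split.
- by under eq_fun do rewrite cReM; apply: measurable_funB; exact: measurable_funM.
- by under eq_fun do rewrite cImM; apply: measurable_funD; exact: measurable_funM.
- by exists (M * N) => x Dx; rewrite cmodM ler_pM ?cmod_ge0 ?fM ?gN.
Qed.

Lemma cbounded_cst D (c : R[i]) : cbounded D (fun _ : T => c).
Proof. by split; [exact: measurable_cst|exact: measurable_cst|exists (cmod c)]. Qed.

Lemma cintD mu D f g : measurable D -> cbounded D f -> cbounded D g ->
  cint mu D (fun x => f x + g x) = cint mu D f + cint mu D g.
Proof.
move=> mD bf bg; rewrite /cint; apply/eqP; rewrite eq_complex /=; apply/andP; split; apply/eqP.
- rewrite -RintegralD//; try exact: cbounded_Re_integrable.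
  by apply: eq_Rintegral => x _; rewrite cReD.
- rewrite -RintegralD//; try exact: cbounded_Im_integrable.
  by apply: eq_Rintegral => x _; rewrite cImD.
Qed.

Lemma integrableZ_R mu D (c : R) (f : T -> R) : measurable D ->
  mu.-integrable D (EFin \o f) -> mu.-integrable D (EFin \o (fun x => c * f x)).
Proof.
move=> mD fi; rewrite [X in integrable _ _ X](_ : _ = (fun x => c%:E * (EFin \o f) x)%E).
  exact: integrableZl.
by apply/funext => x /=; rewrite EFinM.
Qed.

Lemma cintZ mu D (c : R[i]) f : measurable D -> cbounded D f ->
  cint mu D (fun x => c * f x) = c * cint mu D f.
Proof.
move=> mD bf; have rf := cbounded_Re_integrable mu mD bf.
have imf := cbounded_Im_integrable mu mD bf.
rewrite /cint; apply/eqP; rewrite eq_complex cReM cImM /=; apply/andP; split; apply/eqP.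
- rewrite -!RintegralZl// -RintegralB//; try exact: integrableZ_R.
  by apply: eq_Rintegral => x _; rewrite cReM.
- rewrite -!RintegralZl// -RintegralD//; try exact: integrableZ_R.
  by apply: eq_Rintegral => x _; rewrite cImM.
Qed.

Lemma cintB mu D f g : measurable D -> cbounded D f -> cbounded D g ->
  cint mu D (fun x => f x - g x) = cint mu D f - cint mu D g.
Proof.
move=> mD bf bg.
rewrite -[X in _ - X]mul1r -mulNr -cintZ// -cintD//.
  by congr cint; apply/funext => x; rewrite mulN1r.
by apply: cboundedM => //; exact: cbounded_cst.
Qed.

Lemma cint_cst mu D (c : R[i]) : measurable D ->
  cint mu D (fun _ => c) = c * (fine (mu D))%:C.
Proof.
move=> mD; apply/eqP; rewrite eq_complex cReM cImM /= !Rintegral_cst//.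
by rewrite !mulr0 subr0 add0r !eqxx.
Qed.

Lemma cint_bound mu D f (M : R) : measurable D -> cbounded D f ->
  (forall x, D x -> cmod (f x) <= M) ->
  cmod (cint mu D f) <= (M * fine (mu D)) *+ 2.
Proof.
move=> mD bf fM; rewrite (le_trans (cmod_le _))//= mulr2n.
have bd g : mu.-integrable D (EFin \o g) -> (forall x, D x -> `|g x| <= M) ->
    `|Rintegral mu D g| <= M * fine (mu D).
  move=> ig gM; rewrite (le_trans (le_normr_Rintegral mD ig))//.
  rewrite -Rintegral_cst//; apply: le_Rintegral => //.
  - exact: integrable_norm.
  - exact: finite_measure_integrable_cst.
apply: lerD; apply: bd.
- exact: cbounded_Re_integrable.
- by move=> x Dx; rewrite (le_trans (ler_Re_cmod _))// fM.
- exact: cbounded_Im_integrable.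
- by move=> x Dx; rewrite (le_trans (ler_Im_cmod _))// fM.
Qed.

End bounded_integrable.

(** Both push-forwards (through [phi]) and densities ([g]) are changes of
    measure of this form; the formula, known for nonnegative functions, is
    extended to complex ones. *)
Section change_of_measure.
Context d1 d2 (T1 : measurableType d1) (T2 : measurableType d2) (R : realType).
Context (nu : {measure set T1 -> \bar R}) (mu : {measure set T2 -> \bar R}).
Context (E : set T1) (D : set T2) (phi : T2 -> T1) (g : T2 -> R).
Hypothesis g0 : forall x, D x -> 0 <= g x.
Hypothesis numu : forall f : T1 -> \bar R, measurable_fun E f ->
  (forall x, E x -> 0 <= f x)%E ->
  (\int[nu]_(x in E) f x = \int[mu]_(x in D) (f (phi x) * (g x)%:E))%E.

Lemma Rintegral_change (f : T1 -> R) : measurable_fun E f ->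
  Rintegral nu E f = Rintegral mu D (fun x => g x * f (phi x)).
Proof.
move=> mf; rewrite /Rintegral; congr fine.
have mfE : measurable_fun E (EFin \o f) by exact/measurable_EFinP.
rewrite [LHS]integralE [RHS]integralE; congr (_ - _)%E.
- rewrite numu; [|exact: measurable_funepos|by move=> x _; exact: funepos_ge0].
  apply: eq_integral => x /[!inE] Dx.
  rewrite !funeposE -!EFin_max -EFinM; congr EFin.
  by rewrite mulrC maxr_pMr ?g0// mulr0.
- rewrite numu; [|exact: measurable_funeneg|by move=> x _; exact: funeneg_ge0].
  apply: eq_integral => x /[!inE] Dx.
  rewrite !funenegE -!EFinN -!EFin_max -EFinM; congr EFin.
  by rewrite mulrC maxr_pMr ?g0// mulr0 mulrN.
Qed.

Lemma cint_change f : cbounded E f ->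
  cint nu E f = cint mu D (fun x => (g x)%:C * f (phi x)).
Proof.
move=> [fr fi _]; rewrite /cint !Rintegral_change//.
by congr (_ +i* _); apply: eq_Rintegral => x _; rewrite ?cReM ?cImM /= mul0r ?subr0 ?addr0.
Qed.

End change_of_measure.

(** * Laplace transforms on the closed half-plane *)

Local Hint Extern 0 (measurable _) => solve [exact: measurable_nonneg_reals] : core.

Section cint_riemann_sums.
Context (R : realType) (nu : fmeas R).
Local Notation D := (nonneg_reals (R := R)).

Lemma cbounded_indic (A : set (mR R)) : measurable A ->
  cbounded (D : set (mR R)) (fun s => (\1_A s : R)%:C).
Proof.
move=> mA; split => /=.
- exact: measurable_indic.
- exact: measurable_cst.
- exists 1 => x _; rewrite cmod_real indicE.
  by case: (_ \in _); rewrite ?normr1 ?normr0.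
Qed.

Lemma cint_indic (A : set (mR R)) : measurable A ->
  cint nu D (fun s => (\1_A s : R)%:C) = (fine (nu (D `&` A)))%:C.
Proof.
move=> mA; apply/eqP; rewrite eq_complex /=; apply/andP; split; apply/eqP.
  by congr fine; rewrite integral_indic//; congr (nu _); rewrite setIC.
by rewrite /Rintegral integral0_eq.
Qed.

Lemma cbounded_simple (S : seq (set R * R[i]^o)) : msimple S ->
  cbounded (D : set (mR R)) (simple_val S).
Proof.
elim: S => [_|p S IH /msimple_cons[mA mS]].
  rewrite (_ : simple_val _ = fun _ => (0 : R[i]^o)); first exact: cbounded_cst.
  by apply/funext => s; rewrite simple_val_nil.
rewrite (_ : simple_val _ = (fun s => (\1_(p.1) s)%:C * p.2 + simple_val S s) :> (R -> R[i]^o)); last first.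
  by apply/funext => s; rewrite simple_val_cons.
apply: cboundedD; last exact: IH.
by apply: cboundedM; [exact: cbounded_indic|exact: cbounded_cst].
Qed.

Lemma cint_simple (S : seq (set R * R[i]^o)) : msimple S ->
  cint nu D (simple_val S) = simple_integral nu D S.
Proof.
elim: S => [_|p S IH /msimple_cons[mA mS]].
  rewrite (_ : simple_val _ = fun _ => (0 : R[i]^o)); last first.
    by apply/funext => s; rewrite simple_val_nil.
  by rewrite cint_cst// mul0r /simple_integral big_nil.
rewrite (_ : simple_val _ = (fun s => p.2 * (\1_(p.1) s)%:C + simple_val S s) :> (R -> R[i]^o)); last first.
  by apply/funext => s; rewrite simple_val_cons mulrC.
rewrite cintD//; last 2 first.
- by apply: cboundedM; [exact: cbounded_cst|exact: cbounded_indic].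
- exact: cbounded_simple.
rewrite cintZ//; last exact: cbounded_indic.
by rewrite cint_indic// IH// /simple_integral big_cons mulrC.
Qed.

(** The factor 2 comes from treating the real and imaginary parts separately. *)
Lemma cmod_cint_le (f : R -> R[i]) (e : R) : cbounded (D : set (mR R)) f ->
  measurable_fun (D : set (mR R)) (fun s => cmod (f s)) ->
  (\int[nu]_(s in D) (cmod (f s))%:E <= e%:E)%E -> cmod (cint nu D f) <= e *+ 2.
Proof.
move=> bf mf le_e; rewrite (le_trans (cmod_le _))//= mulr2n.
have bd (g : R -> R) : nu.-integrable D (EFin \o g) ->
    (forall x, `|g x| <= cmod (f x)) -> `|Rintegral nu D g| <= e.
  move=> ig gM; have mg := measurable_int _ ig.
  rewrite -lee_fin EFin_normr_Rintegral//.
  apply: (le_trans (le_abse_integral _ _ mg)) => //.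
  apply: le_trans le_e; apply: ge0_le_integral => //.
  - exact: measurableT_comp.
  - exact/measurable_EFinP.
  - by move=> s _ /=; rewrite lee_fin.
apply: lerD; apply: bd.
- exact: cbounded_Re_integrable.
- by move=> x; exact: ler_Re_cmod.
- exact: cbounded_Im_integrable.
- by move=> x; exact: ler_Im_cmod.
Qed.

(** Complex integrals, defined by real and imaginary parts, are limits of the
    same Riemann sums as vector-valued ones; this links [lap] to averages of
    semigroups. *)
Lemma cint_rlim (F : R -> R[i]^o) : buc F -> cbounded (D : set (mR R)) F ->
  rlim nu F (cint nu D F).
Proof.
move=> bF cF e e0; have e2 : 0 < e / 2 by rewrite divr_gt0.
have [d0 [K [d00 K0 gF]]] := grid_integral_cvg nu bF e2.
exists d0, K; split => // d N dgt0 dd0 KN.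
rewrite -(simple_integral_grid _ _ _ (ltW dgt0)) -cint_simple; last exact: msimple_grid.
rewrite rnorm_distC -[_ - _](@cintB _ _ _ nu)//; last by apply: cbounded_simple; exact: msimple_grid.
rewrite [leRHS]splitr -mulr2n; apply: cmod_cint_le.
- rewrite (_ : (fun x => _) = fun x => F x + -1 * simple_val (grid F d N) x); last first.
    by apply/funext => x; rewrite mulN1r.
  apply: cboundedD => //; apply: cboundedM; first exact: cbounded_cst.
  by apply: cbounded_simple; exact: msimple_grid.
- apply: (@measurable_rnorm_sub_simple _ R[i]^o) => //; exact: msimple_grid.
- exact: gF.
Qed.

End cint_riemann_sums.

Section laplace_kernel.
Context (R : realType).
Local Notation D := (nonneg_reals (R := R)).

Lemma cexp_kernel_measurable d (T : measurableType d) (E : set T) (u : T -> R) (z : R[i]) :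
  measurable_fun E u -> (forall x, E x -> 0 <= u x) -> 0 <= complex.Re z ->
  cbounded E (fun x => cexp (- ((u x)%:C * z))).
Proof.
move=> mu u0 z0; case: z z0 => a b /= a0.
have mc (f : R -> R) : continuous f -> measurable_fun [set: R] f.
  exact: continuous_measurable_fun.
split.
- rewrite (_ : (fun x => _) = fun x => expR (- (u x * a)) * cos (- (u x * b))).
    apply: measurable_funM.
    + apply: measurableT_comp => //; apply: measurableT_comp => //.
      exact: measurable_funM.
    + apply: measurableT_comp; first by apply: mc; exact: continuous_cos.
      by apply: measurableT_comp => //; exact: measurable_funM.
  by apply/funext => x; rewrite /cexp /= !mul0r subr0 addr0.
- rewrite (_ : (fun x => _) = fun x => expR (- (u x * a)) * sin (- (u x * b))).
    apply: measurable_funM.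
    + apply: measurableT_comp => //; apply: measurableT_comp => //.
      exact: measurable_funM.
    + apply: measurableT_comp; first by apply: mc; exact: continuous_sin.
      by apply: measurableT_comp => //; exact: measurable_funM.
  by apply/funext => x; rewrite /cexp /= !mul0r subr0 addr0.
- exists 1 => x Ex; rewrite cmod_cexp /= mul0r subr0 -expR0 ler_expR.
  by rewrite oppr_le0 mulr_ge0// u0.
Qed.

Definition lap (nu : fmeas R) (z : R[i]) : R[i] :=
  cintegral nu D (fun s => cexp (- (s%:C * z))).

Lemma cbounded_kernel (z : R[i]) : 0 <= complex.Re z ->
  cbounded (D : set (mR R)) (fun s => cexp (- (s%:C * z))).
Proof. by move=> z0; apply: cexp_kernel_measurable => //; exact: measurable_id. Qed.

Lemma cexp_cvg1 (z : R[i]) : cexp (h%:C * z) @[h --> 0^'+] --> (1 : R[i]^o).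
Proof.
apply: (@cvg_rnorm_le R R[i]^o _ _ _ _ _ (fun h => h * (cmod z + 1))); last first.
  have H : h * (cmod z + 1) @[h --> (0 : R)] --> 0 * (cmod z + 1).
    by apply: cvgM => //; exact: cvg_cst.
  by rewrite mul0r in H; exact: cvg_at_right_filter.
have H := (@cvg_rnormP R R[i]^o _ _ _ _ _).1 (@cexp_derive0 R z) _ ltr01.
near=> h; have h0 : 0 < h by near: h; exact: nbhs_right_gt.
have hq : rnorm ((h^-1)%:C * (cexp (h%:C * z) - 1) - z : R[i]^o) < 1 by near: h; exact: H.
have -> : cexp (h%:C * z) - 1 = h%:C * ((h^-1)%:C * (cexp (h%:C * z) - 1)).
  by rewrite mulrA -rmorphM /= mulfV ?mul1r// gt_eqF.
rewrite -[rnorm _]/(cmod (_ * _)) cmodM cmod_real gtr0_norm// ler_pM2l//.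
by have := rnorm_lerB ((h^-1)%:C * (cexp (h%:C * z) - 1) : R[i]^o) z; move: hq; rewrite /cmod /rnorm; lra.
Unshelve. all: by end_near. Qed.

(** The one-dimensional semigroup [w |-> e^(-s z) w]. *)
Definition scalar_semigroup (z : R[i]) (s : R) : {linear R[i]^o -> R[i]^o} :=
  cexp (- (s%:C * z)) \*: (@idfun R[i]^o : {linear R[i]^o -> R[i]^o}).

Lemma scalar_semigroup_C0 (z : R[i]) : 0 <= complex.Re z ->
  bounded_C0_semigroup (scalar_semigroup z).
Proof.
move=> z0; split.
- by move=> x; rewrite /scalar_semigroup /= mul0r oppr0 cexp0 scale1r.
- move=> s t x s0 t0; rewrite /scalar_semigroup /= scalerA -cexpD.
  by rewrite rmorphD mulrDl opprD.
- move=> x; rewrite -[X in _ --> X](scale1r x).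
  apply: cvgZr_tmp; under eq_fun do rewrite -mulrN.
  exact: cexp_cvg1.
- exists 1 => t x t0; rewrite rnormZ cmod_cexp ler_wpM2r ?rnorm_ge0// -expR0 ler_expR.
  by case: z z0 => a b /= a0; rewrite mul0r subr0 oppr_le0 mulr_ge0.
Qed.

Lemma kernel_buc (z : R[i]) : 0 <= complex.Re z ->
  buc ((fun s => cexp (- (s%:C * z))) : R -> R[i]^o).
Proof.
move=> z0; have := semigroup_buc (scalar_semigroup_C0 z0) 1.
by rewrite /scalar_semigroup /=; under eq_fun do rewrite [_ *: _]mulr1.
Qed.

Lemma lap_rlim (nu : fmeas R) (z : R[i]) : 0 <= complex.Re z ->
  rlim nu ((fun s => cexp (- (s%:C * z))) : R -> R[i]^o) (lap nu z).
Proof. by move=> z0; apply: cint_rlim; [exact: kernel_buc|exact: cbounded_kernel]. Qed.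

Lemma lap_measureD (nu1 nu2 nu3 : fmeas R) (a b : R) (z : R[i]) : 0 <= complex.Re z ->
  (forall d j, 0 < d -> fine (nu3 (cell d j)) =
     a * fine (nu1 (cell d j)) + b * fine (nu2 (cell d j))) ->
  lap nu3 z = a%:C * lap nu1 z + b%:C * lap nu2 z.
Proof. by move=> z0 nuE; exact: (@rlim_measureD R R[i]^o nu1 nu2 nu3 a b _ _ _ _ (lap_rlim nu1 z0) (lap_rlim nu2 z0) (lap_rlim nu3 z0) nuE). Qed.

(** For the scalar semigroup, [resolvent_generator] reads
    [a (y - 1) = - z y] for the Laplace transform [y]. *)
Lemma lap_exponential (nu : fmeas R) (a : R) (z : R[i]) : 0 < a -> 0 <= complex.Re z ->
  exponential_law a nu -> lap nu z = a%:C / (a%:C + z).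
Proof.
move=> a0 z0 nua; have hS := scalar_semigroup_C0 z0; set y := lap nu z.
have az0 : a%:C + z != 0.
  by apply/eqP => /(congr1 (@complex.Re R)); rewrite cReD /= => /eqP; rewrite gt_eqF// ltr_wpDr.
have Fy : rlim nu (fun s => scalar_semigroup z s 1) y.
  have := lap_rlim nu z0.
  by rewrite /scalar_semigroup /=; under [in X in _ -> X]eq_fun do rewrite [_ *: _]mulr1.
have gy := resolvent_generator hS a0 nua Fy.
have gy' : (t^-1)%:C *: (scalar_semigroup z t y - y) @[t --> 0^'+] --> (- z * y : R[i]^o).
  have H : ((t^-1)%:C * (cexp (t%:C * - z) - 1)) *: (y : R[i]^o) @[t --> (0 : R)^'+] --> - z *: (y : R[i]^o).
    by apply: cvgZr_tmp; exact: cexp_derive0.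
  apply: (rcvg_near_eq _ H); near=> h.
  by rewrite /scalar_semigroup /= -scalerA mulrN scalerBl scale1r.
have E : a%:C * (y - 1) = - z * y by exact: rcvg_unique gy gy'.
apply: (mulIf az0); rewrite divfK// mulrDr -[RHS](subrK (z * y)) [y * a%:C]mulrC [y * z]mulrC.
congr (_ + _); apply/eqP; rewrite eq_sym subr_eq -subr_eq eq_sym; apply/eqP.
by move/eqP: E; rewrite mulrBr mulr1 mulNr subr_eq addrC => /eqP.
Unshelve. all: by end_near. Qed.

End laplace_kernel.

(** * Operations on measures and their Laplace transforms *)

Lemma pushforward_finite_measure d1 d2 (T1 : measurableType d1) (T2 : measurableType d2)
    (R : realType) (mu : {finite_measure set T1 -> \bar R}) (phi : T1 -> T2) :
  measurable_fun setT phi ->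
  exists nu : {finite_measure set T2 -> \bar R},
    forall (D : set T2) (f : T2 -> \bar R), measurable D -> measurable_fun D f ->
    (forall y, D y -> 0 <= f y)%E ->
    (\int[nu]_(y in D) f y = \int[mu]_(x in phi @^-1` D) f (phi x))%E.
Proof.
move=> mphi; pose pm : {measure set T2 -> \bar R} :=
  measure_function_pushforward__canonical__measure_function_Measure mu mphi.
have [|nu nuE] := @finite_measure_pack _ _ _ pm.
  by rewrite /pm /= /pushforward preimage_setT -ge0_fin_numE// fin_num_measure.
exists nu => D f mD mf f0.
rewrite -[RHS](ge0_integral_pushforward mphi mu mD mf); last by move=> y /[!inE]; exact: f0.
by apply: eq_measure_integral => A _ _; exact: nuE.
Qed.

Lemma cbounded_inv d (T : measurableType d) (R : realType) (E : set T) (u : T -> R[i]) (c : R) :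
  measurable_fun E (fun x => complex.Re (u x)) ->
  measurable_fun E (fun x => complex.Im (u x)) ->
  0 < c -> (forall x, E x -> c <= cmod (u x)) -> cbounded E (fun x => (u x)^-1).
Proof.
move=> mr mi c0 cu.
pose n2 x := complex.Re (u x) ^+ 2 + complex.Im (u x) ^+ 2.
have n2E x : n2 x = cmod (u x) ^+ 2.
  by rewrite cmod_def sqr_sqrtr// addr_ge0 ?sqr_ge0.
have n20 x : E x -> 0 < n2 x.
  by move=> Ex; rewrite n2E exprn_gt0// (lt_le_trans c0)// cu.
have mn2 : measurable_fun E (fun x => expR (- ln (n2 x))).
  apply: measurableT_comp => //; apply: measurableT_comp => //.
  apply: measurableT_comp; first exact: measurable_ln.
  by apply: measurable_funD; apply: measurable_funX.
have invE x : E x -> (n2 x)^-1 = expR (- ln (n2 x)).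
  by move=> Ex; rewrite expRN lnK// posrE n20.
split.
- apply: (eq_measurable_fun (fun x => complex.Re (u x) * expR (- ln (n2 x)))).
    by move=> x /[!inE] Ex; rewrite -invE// /n2; case: (u x).
  exact: measurable_funM.
- apply: (eq_measurable_fun (fun x => - (complex.Im (u x) * expR (- ln (n2 x))))).
    by move=> x /[!inE] Ex; rewrite -invE// /n2; case: (u x) => a b /=; rewrite ?mulNr.
  by apply: measurableT_comp => //; exact: measurable_funM.
- exists c^-1 => x Ex; rewrite cmodV lef_pV2 ?posrE// ?cu//.
  by rewrite (lt_le_trans c0)// cu.
Qed.

Section product_of_finite_measures.
Context d1 d2 (T1 : measurableType d1) (T2 : measurableType d2) (R : realType).
Context (m1 : {finite_measure set T1 -> \bar R}) (m2 : {finite_measure set T2 -> \bar R}).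

Lemma product_finite_measure :
  exists m : {finite_measure set (T1 * T2)%type -> \bar R},
    forall f : T1 * T2 -> R[i], cbounded setT f ->
    cint m setT f = cint m1 setT (fun x => cint m2 setT (fun y => f (x, y))).
Proof.
pose pm : {measure set (T1 * T2)%type -> \bar R} :=
  lebesgue_integral_fubini_product_measure1__canonical__measure_function_Measure m1 m2.
have [|m mE] := @finite_measure_pack _ _ _ pm.
  have -> : pm setT = (m1 setT * m2 setT)%E.
    by rewrite -product_measure1E// setXTT.
  by rewrite -ge0_fin_numE ?mule_ge0// fin_numM// fin_num_measure.
have key (f : T1 * T2 -> R) (M : R) : measurable_fun setT f -> (forall x, `|f x| <= M) ->
    Rintegral m setT f = Rintegral m1 setT (fun x => Rintegral m2 setT (fun y => f (x, y))).
  move=> mf fM.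
  have fi : pm.-integrable setT (EFin \o f).
    have /integrableP[mfE fi] := @bounded_integrable _ _ _ m setT f M measurableT mf
      (fun x _ => fM x).
    apply/integrableP; split => //; apply: le_lt_trans fi.
    rewrite le_eqVlt; apply/orP; left; apply/eqP.
    by apply: eq_measure_integral => A _ _; rewrite [RHS]mE.
  rewrite /Rintegral; congr fine.
  transitivity (\int[pm]_x (f x)%:E)%E.
    by apply: eq_measure_integral => A _ _; exact: mE.
  rewrite -(integral12_prod_meas1 fi).
  apply: eq_integral => x _; rewrite /fubini_F fineK//.
  apply: integrable_fin_num => //.
  apply: (@bounded_integrable _ _ _ m2 setT (fun y => f (x, y)) M) => //.
  exact: measurable_fun_pair2.
exists m => f [mr mi [M fM]]; rewrite {1}/cint (key _ M)//; last first.
  by move=> x; rewrite (le_trans (ler_Re_cmod _))// fM.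
rewrite (key _ M)//.
by move=> x; rewrite (le_trans (ler_Im_cmod _))// fM.
Qed.

End product_of_finite_measures.

Section laplace_measures.
Context (R : realType).
Local Notation D := (nonneg_reals (R := R)).

Lemma exponential_law_exists (a : R) : 0 < a -> exists nu : fmeas R, exponential_law a nu.
Proof.
move=> a0; pose g := exponential_pdf a.
have g0 x : 0 <= g x by apply: exponential_pdf_ge0; exact: ltW.
have mg : measurable_fun setT g by exact: measurable_exponential_pdf.
have [nu0 [nu0E _]] := weighted_measure (@lebesgue_measure R) g0 mg.
have [|nu nuE] := @finite_measure_pack _ _ _ nu0.
  by rewrite nu0E integral_exponential_pdf// ltry.
exists nu => s r s0; rewrite le_eqVlt => /orP[/eqP <-|sr].
  rewrite subrr (_ : [set x | _] = set0) ?measure0//.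
  by apply/seteqP; split => // x /= /andP[/le_lt_trans h /h]; rewrite ltxx.
have -> : nu [set x | s <= x < r] = (\int[lebesgue_measure]_(x in `[s, r]) (g x)%:E)%E.
  rewrite nuE nu0E -(integral_itv_bndo_bndc (r := r)); last first.
    by apply/measurable_EFinP; exact: measurable_funTS.
  by congr (integral _ _ _); apply/seteqP; split => x /=; rewrite in_itv.
have cF : continuous (fun x : R => - expR (- (a * x))).
  move=> x; apply: cvgN; apply: continuous_comp; last exact: continuous_expR.
  by apply: cvgN; apply: cvgMr; exact: cvg_id.
rewrite (@continuous_FTC2 _ g (fun x => - expR (- (a * x))))//.
- by rewrite /= opprK addrC.
- apply: (@continuous_subspaceW R^o _ _ [set` `[0, +oo[%R]).
    by move=> x /=; rewrite !in_itv /= andbT => /andP[+ _]; exact: le_trans.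
  exact: within_continuous_exponential_pdf.
- split.
  + by move=> z _; exact: ex_derive.
  + by apply: cvg_at_right_filter; exact: cF.
  + by apply: cvg_at_left_filter; exact: cF.
- move=> z; rewrite in_itv /= => /andP[sz _].
  rewrite /g -derive1_exponential_pdf; last by rewrite in_itv /= andbT (le_lt_trans s0).
  by congr (derive1 _ z); apply/funext => x; rewrite mulNr.
Qed.

Lemma measure_combination (nu1 nu2 : fmeas R) (a b : R) : 0 <= a -> 0 <= b ->
  exists nu : fmeas R, forall A : set (mR R), measurable A ->
    fine (nu A) = a * fine (nu1 A) + b * fine (nu2 A).
Proof.
move=> a0 b0.
pose m1 : {measure set (mR R) -> \bar R} := mscale (NngNum a0) nu1.
pose m2 : {measure set (mR R) -> \bar R} := mscale (NngNum b0) nu2.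
pose m : {measure set (mR R) -> \bar R} := measure_add m1 m2.
have mE (A : set (mR R)) : measurable A -> m A = (a * fine (nu1 A) + b * fine (nu2 A))%:E.
  move=> mA; rewrite (_ : m A = (m1 A + m2 A)%E); last exact: measure_addE.
  rewrite /m1 /m2 /= /mscale /=.
  by rewrite EFinD !EFinM !fineK// fin_num_measure.
have [|nu nuE] := @finite_measure_pack _ _ _ m; first by rewrite mE// ltry.
by exists nu => A mA; rewrite nuE mE.
Qed.

Lemma lap_combination (nu1 nu2 : fmeas R) (a b : R) : 0 <= a -> 0 <= b ->
  exists nu : fmeas R, forall z, 0 <= complex.Re z ->
    lap nu z = a%:C * lap nu1 z + b%:C * lap nu2 z.
Proof.
move=> a0 b0; have [nu nuE] := measure_combination nu1 nu2 a0 b0.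
exists nu => z z0; apply: lap_measureD => // d j d0.
by rewrite nuE//; exact: measurable_cell.
Qed.

Lemma dirac0_cell (d : R) j : 0 < d ->
  fine (\d_(0 : mR R) (cell d j)) = (j == 0%N)%:R :> R.
Proof.
move=> d0; rewrite diracE; congr (_%:R); congr nat_of_bool.
apply/idP/eqP => [|->]; rewrite inE /cell /=; last by rewrite mul0r lexx mul1r.
by move=> /andP[+ _]; case: j => // j; rewrite leNgt mulr_gt0.
Qed.

Lemma rlim_dirac0 (X : normedModType R[i]) (F : R -> X) y :
  rlim (\d_(0 : mR R) : fmeas R) F y -> y = F 0.
Proof.
move=> Fy; apply: rcvg_unique (rlim_cvg Fy ltr01 (fun m => leqnn (m.+1 ^ 2))) _.
rewrite (_ : (fun m => _) = cst (F 0)); first exact: cvg_cst.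
apply/funext => m; rewrite /rsum.
have -> : (m.+1 ^ 2 = (m.+1 ^ 2).-1.+1)%N by rewrite prednK ?expn_gt0.
rewrite big_nat_recl// dirac0_cell ?divr_gt0// mul0r scale1r.
by rewrite big1 ?addr0// => j _; rewrite dirac0_cell ?divr_gt0// scale0r.
Qed.

Lemma lap_dirac0 z : 0 <= complex.Re z -> lap (\d_(0 : mR R) : fmeas R) z = 1.
Proof.
move=> z0; have := @rlim_dirac0 R[i]^o _ _ (lap_rlim _ z0).
by rewrite mul0r oppr0 cexp0.
Qed.

Lemma restrict_finite_measure (nu : fmeas R) (P : set (mR R)) : measurable P ->
  exists nu' : fmeas R, forall f, cbounded setT f ->
    cint nu' setT f = cint nu D (fun s => (\1_P s)%:C * f s).
Proof.
move=> mP.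
have fin : (\int[nu]_(s in D) (\1_P s : R)%:E < +oo)%E.
  rewrite integral_indic// -ge0_fin_numE// fin_num_measure//.
  by apply: measurableI => //; exact: measurable_nonneg_reals.
have [nu' nu'E] := weighted_finite_measure (@measurable_nonneg_reals R)
  (measurable_indic mP) (fun _ _ => ler0n _ _) fin.
exists nu' => f bf; apply: cint_change => //.
move=> g mg g0; rewrite nu'E//; first by rewrite setTI.
Qed.

Lemma norm_kernel_cbounded (z : R[i]) : 0 <= complex.Re z ->
  cbounded (setT : set (mR R)) (fun s => cexp (- (`|s|%:C * z))).
Proof.
by move=> z0; apply: cexp_kernel_measurable.
Qed.

(** Absolute values extend the kernel from the half-line to the real line,
    where product measures are formed. *)
Lemma lap_restrict (nu : fmeas R) : exists nu' : fmeas R, forall z, 0 <= complex.Re z ->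
  cint nu' setT (fun s => cexp (- (`|s|%:C * z))) = lap nu z.
Proof.
have [nu' nu'E] := restrict_finite_measure nu measurableT.
exists nu' => z z0; rewrite nu'E; last exact: norm_kernel_cbounded.
by apply: eq_cint => s s0; rewrite indicT mul1r ger0_norm.
Qed.

Lemma lap_pushforward d (T : measurableType d) (P : {finite_measure set T -> \bar R})
    (phi : T -> mR R) : measurable_fun setT phi -> (forall x, 0 <= phi x) ->
  exists nu : fmeas R, forall z, 0 <= complex.Re z ->
    lap nu z = cint P setT (fun x => cexp (- ((phi x)%:C * z))).
Proof.
move=> mphi phi0; have [nu nuE] := pushforward_finite_measure P mphi; exists nu => z z0.
rewrite -[LHS]/(cint nu D _) (@cint_change _ _ _ _ _ nu P D setT phi (cst 1)).
- by apply: eq_cint => x _; rewrite mul1r.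
- by move=> x _; exact: ler01.
- move=> f mf f0; rewrite nuE// (_ : phi @^-1` D = setT).
    by apply: eq_integral => x _; rewrite mule1.
  by apply/seteqP; split => // x _; exact: phi0.
- exact: cbounded_kernel.
Qed.

(** The law of the sum of two independent variables. *)
Lemma lap_convolution (nu1 nu2 : fmeas R) : exists nu : fmeas R,
  forall z, 0 <= complex.Re z -> lap nu z = lap nu1 z * lap nu2 z.
Proof.
have [mu1 mu1E] := lap_restrict nu1; have [mu2 mu2E] := lap_restrict nu2.
pose phi (x : mR R * mR R) : mR R := `|x.1| + `|x.2|.
have phi0 x : 0 <= phi x by rewrite addr_ge0.
have mphi : measurable_fun setT phi.
  by apply: measurable_funD; apply: measurableT_comp.
have [P PE] := product_finite_measure mu1 mu2.
have [nu nuE] := lap_pushforward P mphi phi0.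
exists nu => z z0; rewrite -mu1E// -mu2E// nuE// PE; last first.
  by apply: cexp_kernel_measurable => // x _; exact: phi0.
rewrite [RHS]mulrC -cintZ//; last exact: norm_kernel_cbounded.
apply: eq_cint => s _; rewrite mulrC -cintZ//; last exact: norm_kernel_cbounded.
by apply: eq_cint => t _; rewrite -cexpD /phi /= rmorphD mulrDl opprD.
Qed.

(** The average of the exponential laws of rate [tau] against [m], whose
    Laplace transform is [tau / (z + tau)], is the law of [u / tau] for an
    exponential variable [u] of rate 1 independent of [tau]. *)
Lemma lap_mixture (m : fmeas R) : exists nu : fmeas R,
  forall z, 0 <= complex.Re z -> z != 0 ->
    lap nu z = cint m D (fun tau => tau%:C / (z + tau%:C)).
Proof.
pose P : set (mR R) := `]0, +oo[%classic.
have mP : measurable P by exact: measurable_itv.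
have [m' m'E] := restrict_finite_measure m mP.
have [ex exlaw] := exponential_law_exists ltr01.
have [mu2 mu2E] := lap_restrict ex.
(* A measurable version of [1 / tau]; the mass of [m] at 0 has been removed, the
   right-hand side being 0 there. *)
pose iv (tau : R) : R := expR (- ln `|tau|).
have miv : measurable_fun (setT : set (mR R)) iv.
  apply: measurableT_comp => //; apply: measurableT_comp => //.
  by apply: measurableT_comp; [exact: measurable_ln|by []].
pose phi (x : mR R * mR R) : mR R := `|x.2| * iv x.1.
have phi0 x : 0 <= phi x by rewrite mulr_ge0// expR_ge0.
have mphi : measurable_fun setT phi.
  by apply: measurable_funM; apply: measurableT_comp.
have [Q QE] := product_finite_measure m' mu2.
have [nu nuE] := lap_pushforward Q mphi phi0.
exists nu => z z0 zn0; rewrite nuE// QE; last first.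
  by apply: cexp_kernel_measurable => // x _; exact: phi0.
have Rez tau : 0 <= complex.Re ((iv tau)%:C * z).
  by rewrite cReM /= mul0r subr0 mulr_ge0// expR_ge0.
have inner tau : cint mu2 setT (fun u => cexp (- ((phi (tau, u))%:C * z))) =
    (1 + (iv tau)%:C * z)^-1.
  rewrite -[RHS]mul1r -(lap_exponential ltr01 (Rez tau) exlaw) -mu2E//.
  by apply: eq_cint => u _; rewrite /phi /= rmorphM mulrA.
rewrite (@eq_cint _ _ _ m' setT _ (fun tau => (1 + (iv tau)%:C * z)^-1)); last first.
  by move=> tau _; exact: inner.
rewrite m'E; last first.
  apply: (@cbounded_inv _ _ _ _ _ 1) => //.
  - apply: (eq_measurable_fun (fun x => 1 + iv x * complex.Re z)).
      by move=> x _; rewrite cReD cReM /= mul0r subr0.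
    by apply: measurable_funD => //; exact: measurable_funM.
  - apply: (eq_measurable_fun (fun x => iv x * complex.Im z)).
      by move=> x _; rewrite cImD cImM /= mul0r addr0 add0r.
    exact: measurable_funM.
  - move=> x _; apply: le_trans (ler_Re_cmod _).
    by rewrite cReD /= (le_trans _ (ler_norm _))// lerDl.
apply: eq_cint => tau; rewrite /nonneg_reals /= le_eqVlt => /orP[/eqP <-|tau0].
  by rewrite indicE memNset ?mul0r// /P /= in_itv /= ltxx.
rewrite indicE mem_set ?mul1r; last by rewrite /P /= in_itv /= tau0.
have ivE : iv tau = tau^-1 by rewrite /iv gtr0_norm// expRN lnK.
have taun0 : tau%:C != 0 :> R[i] by rewrite eq_complex /= gt_eqF.
rewrite ivE -[tau%:C / _]invf_div; congr (_^-1).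
by rewrite mulrDl divff// addrC mulrC -fmorphV.
Qed.

End laplace_measures.

(** * Regularization of Stieltjes functions *)

Section stieltjes_functions.
Context (R : realType).
Local Notation D := (nonneg_reals (R := R)).
Implicit Types (z w : R[i]) (f : R[i] -> R[i]) (m : fmeas R).

Lemma cmod_add_nonneg z (tau : R) : 0 <= complex.Re z -> 0 <= tau ->
  cmod z <= cmod (z + tau%:C).
Proof.
move=> z0 tau0; rewrite !cmod_def ler_wsqrtr// cReD cImD /= addr0 lerD2r.
by rewrite ler_sqr ?nnegrE// ?addr_ge0// lerDl.
Qed.

Lemma add_nonneg_neq0 z (tau : R) : 0 <= complex.Re z -> z != 0 -> 0 <= tau ->
  z + tau%:C != 0.
Proof.
move=> z0 zn0 tau0; rewrite -cmod_gt0.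
by apply: lt_le_trans (cmod_add_nonneg z0 tau0); rewrite cmod_gt0.
Qed.

Lemma cbounded_resolvent z : 0 <= complex.Re z -> z != 0 ->
  cbounded (D : set (mR R)) (fun tau => (z + tau%:C)^-1).
Proof.
move=> z0 zn0; apply: (@cbounded_inv _ _ _ _ _ (cmod z)).
- apply: (eq_measurable_fun (fun tau : mR R => complex.Re z + tau)).
    by move=> tau _; rewrite cReD.
  exact: measurable_funD.
- apply: (eq_measurable_fun (fun tau : mR R => complex.Im z)).
    by move=> tau _; rewrite cImD /= addr0.
  exact: measurable_cst.
- by rewrite cmod_gt0.
- by move=> tau tau0; exact: cmod_add_nonneg.
Qed.

(** A Stieltjes measure is replaced by its finite weighted version
    [(1 + tau)^-1 mu(d tau)]. *)
Definition stieltjes_kernel z (tau : R) : R[i] := (1 + tau)%:C / (z + tau%:C).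

(** The closed half-plane is included because the function is evaluated on the
    imaginary axis. *)
Definition stieltjes_rep f (a : R) m := 0 <= a /\
  forall z, 0 <= complex.Re z -> z != 0 -> f z = a%:C + cint m D (stieltjes_kernel z).

Lemma stieltjes_kernelE z (tau : R) : 0 <= complex.Re z -> z != 0 -> 0 <= tau ->
  stieltjes_kernel z tau = 1 + (1 - z) * (z + tau%:C)^-1.
Proof.
move=> z0 zn0 tau0; have n0 := add_nonneg_neq0 z0 zn0 tau0.
rewrite /stieltjes_kernel -[X in _ = X + _](divff n0) -mulrDl; congr (_ / _).
by rewrite rmorphD /=; ring.
Qed.

Lemma cbounded_stieltjes_kernel z : 0 <= complex.Re z -> z != 0 ->
  cbounded (D : set (mR R)) (stieltjes_kernel z).
Proof.
move=> z0 zn0; apply: (@eq_cbounded _ (mR R) R D (fun tau => 1 + (1 - z) * (z + tau%:C)^-1)).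
  by move=> tau tau0; rewrite stieltjes_kernelE.
apply: cboundedD; first exact: cbounded_cst.
by apply: cboundedM; [exact: cbounded_cst|exact: cbounded_resolvent].
Qed.

Lemma stieltjes_has_rep f : stieltjes f -> exists a m, stieltjes_rep f a m.
Proof.
move=> [a [mu [a0 fin fE]]].
have g0 (tau : R) : D tau -> 0 <= (1 + tau)^-1.
  by move=> tau0; rewrite invr_ge0 addr_ge0.
have mg : measurable_fun (D : set (mR R)) (fun tau => (1 + tau)^-1).
  have [mr _ _] := @cbounded_resolvent 1 (ler01 : 0 <= complex.Re 1) (oner_neq0 _).
  apply: eq_measurable_fun mr => tau _.
  by rewrite (_ : 1 + tau%:C = (1 + tau)%:C) -?fmorphV// rmorphD rmorph1.
have [m mE] := weighted_finite_measure (@measurable_nonneg_reals R) mg g0 fin.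
exists a, m; split => // z z0 zn0; rewrite fE; last first.
  move=> [imz rez]; move/eqP: zn0; apply; apply/eqP.
  by rewrite eq_complex imz /= eqxx andbT eq_le rez.
congr (_ + _); rewrite -[LHS]/(cint mu D _).
rewrite (@cint_change _ _ _ _ _ m mu D D id (fun tau => (1 + tau)^-1))//.
- apply: eq_cint => tau tau0; rewrite /stieltjes_kernel mulrA -rmorphM /= mulVf ?mul1r//.
  by rewrite gt_eqF// ltr_wpDr.
- by move=> g mg' g0'; rewrite mE// setIid.
- exact: cbounded_stieltjes_kernel.
Qed.

(** The Laplace transforms of real measures, in Jordan form. *)
Definition laplace_difference (g : R[i] -> R[i]) := exists p q : fmeas R,
  forall z, 0 <= complex.Re z -> z != 0 -> g z = lap p z - lap q z.

Lemma laplace_difference_ext g g' :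
  (forall z, 0 <= complex.Re z -> z != 0 -> g z = g' z) ->
  laplace_difference g -> laplace_difference g'.
Proof. by move=> gg' [p [q pq]]; exists p, q => z z0 zn0; rewrite -gg'// pq. Qed.

Lemma laplace_differenceD g g' : laplace_difference g -> laplace_difference g' ->
  laplace_difference (fun z => g z + g' z).
Proof.
move=> [p [q pq]] [p' [q' pq']].
have [u uE] := lap_combination p p' (ler01 : 0 <= 1 :> R) ler01.
have [v vE] := lap_combination q q' (ler01 : 0 <= 1 :> R) ler01.
exists u, v => z z0 zn0; rewrite uE// vE// !mul1r pq// pq'//.
by rewrite opprD addrACA.
Qed.

Lemma laplace_differenceZ (c : R) g : laplace_difference g ->
  laplace_difference (fun z => c%:C * g z).
Proof.
move=> [p [q pq]].
have [u uE] := lap_combination p p (normr_ge0 c) (lexx 0).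
have [v vE] := lap_combination q q (normr_ge0 c) (lexx 0).
have [c0|c0] := lerP 0 c.
  exists u, v => z z0 zn0; rewrite uE// vE// !mul0r !addr0 pq//.
  by rewrite ger0_norm// mulrBr.
exists v, u => z z0 zn0; rewrite uE// vE// !mul0r !addr0 pq//.
by rewrite ltr0_norm// rmorphN /= !mulNr opprK mulrBr addrC.
Qed.

Lemma laplace_differenceM g g' : laplace_difference g -> laplace_difference g' ->
  laplace_difference (fun z => g z * g' z).
Proof.
move=> [p [q pq]] [p' [q' pq']].
have [pp ppE] := lap_convolution p p'; have [qq qqE] := lap_convolution q q'.
have [pq1 pq1E] := lap_convolution p q'; have [pq2 pq2E] := lap_convolution q p'.
have [u uE] := lap_combination pp qq (ler01 : 0 <= 1 :> R) ler01.
have [v vE] := lap_combination pq1 pq2 (ler01 : 0 <= 1 :> R) ler01.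
exists u, v => z z0 zn0; rewrite uE// vE// !mul1r ppE// qqE// pq1E// pq2E// pq// pq'//.
by ring.
Qed.

Lemma laplace_difference_of (nu : fmeas R) : laplace_difference (lap nu).
Proof.
have [u uE] := lap_combination nu nu (lexx 0) (lexx 0 : 0 <= 0 :> R).
by exists nu, u => z z0 _; rewrite uE// !mul0r addr0 subr0.
Qed.

Lemma laplace_difference_cst (c : R) : laplace_difference (fun _ => c%:C).
Proof.
apply: (laplace_difference_ext _ (laplace_differenceZ c (laplace_difference_of
  (\d_(0 : mR R) : fmeas R)))) => z z0 _.
by rewrite lap_dirac0// mulr1.
Qed.

Lemma laplace_difference_exp (b : R) : 0 < b ->
  laplace_difference (fun z => b%:C / (b%:C + z)).
Proof.
move=> b0; have [nu nub] := exponential_law_exists b0.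
apply: (laplace_difference_ext _ (laplace_difference_of nu)) => z z0 _.
exact: lap_exponential.
Qed.

(** The singularities of a Stieltjes function at 0 and at infinity are
    compensated by the factor [z / (b + z)]: with [W_c = c / (c + z)],
    [z (1 + tau) / ((b + z) (z + tau)) = W_b / b + W_tau - (1 + 1 / b) W_b W_tau]
    is a combination of Laplace transforms of probabilities with coefficients
    independent of [tau]. *)
Lemma stieltjes_regularized f a m (b : R) : stieltjes_rep f a m -> 0 < b ->
  laplace_difference (fun z => z / (b%:C + z) * f z).
Proof.
move=> [a0 fE] b0.
have [mix mixE] := lap_mixture m.
pose W z := b%:C / (b%:C + z).
have LW : laplace_difference W := laplace_difference_exp b0.
pose c := fine (m D).
have L : laplace_difference (fun z => (a%:C + (- a)%:C * W z) +
   ((c / b)%:C * W z + (lap mix z + (- (1 + b^-1))%:C * (W z * lap mix z)))).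
  apply: laplace_differenceD.
    by apply: laplace_differenceD; [exact: laplace_difference_cst|exact: laplace_differenceZ].
  apply: laplace_differenceD; first exact: laplace_differenceZ.
  apply: laplace_differenceD; first exact: laplace_difference_of.
  by apply/laplace_differenceZ/laplace_differenceM => //; exact: laplace_difference_of.
apply: (laplace_difference_ext _ L) => z z0 zn0.
have bz : b%:C + z != 0 by rewrite addrC add_nonneg_neq0// ltW.
have bn0 : b%:C != 0 :> R[i] by rewrite eq_complex /= gt_eqF.
have bR : cbounded (D : set (mR R)) (fun tau => tau%:C / (z + tau%:C)).
  apply: (@eq_cbounded _ (mR R) R D (fun tau => 1 + (- z) * (z + tau%:C)^-1)).
    move=> tau tau0; have n0 := add_nonneg_neq0 z0 zn0 tau0.
    rewrite -[X in X + _ = _](divff n0) -mulrDl; congr (_ / _).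
    by rewrite addrC addKr.
  apply: cboundedD; first exact: cbounded_cst.
  by apply: cboundedM; [exact: cbounded_cst|exact: cbounded_resolvent].
have key : z / (b%:C + z) * cint m D (stieltjes_kernel z) =
    (c / b)%:C * W z + (lap mix z + (- (1 + b^-1))%:C * (W z * lap mix z)).
  rewrite mixE// -cintZ//; last exact: cbounded_stieltjes_kernel.
  rewrite (@eq_cint _ (mR R) R _ _ _ (fun tau : R => b^-1%:C * W z +
     ((1 + (- (1 + b^-1))%:C * W z) * (tau%:C / (z + tau%:C))))); last first.
    move=> tau tau0; have n0 := add_nonneg_neq0 z0 zn0 tau0.
    rewrite /stieltjes_kernel /W rmorphN !rmorphD /= !fmorphV /= ?rmorph1.
    by field; rewrite n0 bz bn0.
  rewrite cintD//; last 2 first.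
  - exact: cbounded_cst.
  - by apply: cboundedM => //; exact: cbounded_cst.
  rewrite cint_cst// cintZ// -/c; congr (_ + _).
    by rewrite rmorphM /= fmorphV; ring.
  by rewrite mulrDl mul1r mulrA.
rewrite fE// mulrDr key; congr (_ + _).
by rewrite /W rmorphN /=; field.
Qed.

End stieltjes_functions.

(** * Stieltjes functions in the right half-plane *)

Section stieltjes_analytic.
Context (R : realType).
Local Notation D := (nonneg_reals (R := R)).
Implicit Types (z w : R[i]) (f : R[i] -> R[i]) (m : fmeas R).

Lemma Re_gt0_neq0 z : 0 < complex.Re z -> z != 0.
Proof. by move=> z0; apply/eqP => z00; rewrite z00 ltxx in z0. Qed.

Lemma dnbhs0_cmod (e : R) : 0 < e -> \forall h \near (0 : R[i]^o)^', cmod h < e.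
Proof.
move=> e0; have e0C : 0 < e%:C :> R[i] by rewrite ltcR.
by have := @dnbhs0_lt R[i] R[i]^o _ e0C; apply: filterS => h; rewrite cmodE ltcR.
Qed.

Lemma ler_cmod_resolvent z (tau : R) : 0 <= complex.Re z -> z != 0 -> 0 <= tau ->
  cmod (z + tau%:C)^-1 <= (cmod z)^-1.
Proof.
move=> z0 zn0 tau0; have cz : 0 < cmod z by rewrite cmod_gt0.
by rewrite cmodV lef_pV2 ?posrE ?cmod_add_nonneg// (lt_le_trans cz)// cmod_add_nonneg.
Qed.

(** The derivative, obtained by differentiation under the integral sign. *)
Definition stieltjes_slope m z : R[i] :=
  - cint m D (fun tau => stieltjes_kernel z tau * (z + tau%:C)^-1).

(** [1 / (w + tau) - 1 / (z + tau) + (w - z) / (z + tau)^2 =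
    (w - z)^2 / ((z + tau)^2 (w + tau))]. The points may lie on the imaginary
    axis, where the estimate serves along the unit circle. *)
Lemma stieltjes_increment f a m z w (K : R) : stieltjes_rep f a m ->
  0 <= complex.Re z -> z != 0 -> 0 <= complex.Re w -> w != 0 ->
  (forall tau, 0 <= tau -> cmod (stieltjes_kernel z tau) <= K) ->
  cmod (f w - f z - stieltjes_slope m z * (w - z)) <=
    (K * (cmod z)^-1 * (cmod w)^-1 * fine (m D)) *+ 2 * cmod (w - z) ^+ 2.
Proof.
move=> [a0 fE] z0 zn0 w0 wn0 kK.
have bk := cbounded_stieltjes_kernel z0 zn0.
have bz := cbounded_resolvent z0 zn0.
have bw := cbounded_resolvent w0 wn0.
have mD := @measurable_nonneg_reals R.
have -> : f w - f z - stieltjes_slope m z * (w - z) = (w - z) ^+ 2 *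
    cint m D (fun tau => stieltjes_kernel z tau * (z + tau%:C)^-1 * (w + tau%:C)^-1).
  have -> : f w - f z = cint m D (stieltjes_kernel w) - cint m D (stieltjes_kernel z).
    by rewrite !fE// opprD addrACA subrr add0r.
  rewrite -cintB//; last exact: cbounded_stieltjes_kernel.
  rewrite /stieltjes_slope mulNr opprK mulrC -!cintZ//; try exact: cboundedM.
    rewrite -cintD//.
    - apply: eq_cint => tau tau0; rewrite /stieltjes_kernel.
      have n1 := add_nonneg_neq0 z0 zn0 tau0; have n2 := add_nonneg_neq0 w0 wn0 tau0.
      by field; rewrite n1 n2.
    - rewrite /GRing.add /=; have b2 := cbounded_stieltjes_kernel w0 wn0.
      apply: eq_cbounded (cboundedD b2 (cboundedM (cbounded_cst D (-1)) bk)) => tau _.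
      by rewrite mulN1r.
    - by apply: cboundedM; [exact: cbounded_cst|exact: cboundedM].
  by apply: cboundedM => //; exact: cboundedM.
rewrite cmodM cmodX mulrC ler_wpM2r ?exprn_ge0 ?cmod_ge0//; apply: cint_bound => //.
  by apply: cboundedM => //; exact: cboundedM.
move=> tau tau0; rewrite cmodM; apply: ler_pM; [exact: cmod_ge0|exact: cmod_ge0| |exact: ler_cmod_resolvent].
by rewrite cmodM; apply: ler_pM; [exact: cmod_ge0|exact: cmod_ge0|exact: kK|exact: ler_cmod_resolvent].
Qed.

Lemma stieltjes_rep_derivable f a m z : stieltjes_rep f a m -> 0 < complex.Re z ->
  derivable (f : R[i]^o -> R[i]^o) z 1.
Proof.
move=> fr z0; have z0' := ltW z0; have zn0 := Re_gt0_neq0 z0.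
set r := complex.Re z in z0.
have [_ _ [K kK]] := cbounded_stieltjes_kernel z0' zn0.
have K0 : 0 <= K by apply: (le_trans (cmod_ge0 _) (kK 0 _)); exact: lexx.
pose C := (K * (cmod z)^-1 * (r / 2)^-1 * fine (m D)) *+ 2.
apply/cvg_ex; exists (stieltjes_slope m z).
apply: (@cvg_rnorm_le R R[i]^o _ _ _ _ _ (fun h => C * cmod h)); last first.
  apply/cvgrPdist_lt => e e0; have C1 : 0 < `|C| + 1 by rewrite ltr_wpDl.
  have := @dnbhs0_cmod (e / (`|C| + 1)) (divr_gt0 e0 C1).
  apply: filterS => h; rewrite ltr_pdivlMr// => hC.
  rewrite sub0r normrN normrM (ger0_norm (cmod_ge0 _)).
  by move: (cmod_ge0 h) hC; rewrite mulrDr mulr1 mulrC; lra.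
near=> h.
have hn0 : h != 0 by near: h; apply: withinT.
have hr : cmod h < r / 2 by near: h; apply: dnbhs0_cmod; rewrite divr_gt0.
have wE : (h *: (1 : R[i]^o)) + z = h + z by rewrite [h *: _]mulr1.
set w := h + z in wE.
have wr : r / 2 <= complex.Re w.
  have := le_trans (ler_norm _) (le_trans (ler_Re_cmod (- h)) (_ : _ <= r / 2)).
  rewrite cmodN => /(_ (ltW hr)); rewrite /w cReD cReN -/r; lra.
have r20 : 0 < r / 2 by rewrite divr_gt0.
have w0 : 0 < complex.Re w by exact: lt_le_trans wr.
have wn0 := Re_gt0_neq0 w0.
have inc := stieltjes_increment fr z0' zn0 (ltW w0) wn0 kK.
suff : cmod (h^-1 * (f w - f z) - stieltjes_slope m z) <= C * cmod h by rewrite /= wE.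
have wz : w - z = h by rewrite /w addrK.
have h0 : 0 < cmod h by rewrite cmod_gt0.
have -> : h^-1 * (f w - f z) - stieltjes_slope m z =
    h^-1 * (f w - f z - stieltjes_slope m z * h).
  by rewrite [RHS]mulrBr [h^-1 * (_ * h)]mulrCA mulVf// mulr1.
rewrite wz in inc.
rewrite cmodM cmodV mulrC ler_pdivrMr// -mulrA -expr2 (le_trans inc)//.
rewrite ler_wpM2r ?exprn_ge0 ?cmod_ge0// /C lerMn2r/=.
rewrite ler_wpM2r ?fine_ge0// ler_wpM2l ?mulr_ge0 ?invr_ge0 ?cmod_ge0//.
rewrite lef_pV2 ?posrE ?cmod_gt0// (le_trans wr)// (le_trans (ler_norm _))//.
exact: ler_Re_cmod.
Unshelve. all: by end_near. Qed.

Lemma derivable_right_half_plane_ext f g z : 0 < complex.Re z ->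
  (forall w, 0 < complex.Re w -> f w = g w) ->
  derivable (f : R[i]^o -> R[i]^o) z 1 -> derivable (g : R[i]^o -> R[i]^o) z 1.
Proof.
move=> z0 fg; apply: near_eq_derivable.
have H := (@cvg_rnormP R R[i]^o _ (nbhs (z : R[i]^o)) (nbhs_filter _) id z).1 cvg_id _ z0.
apply: (@filterS _ _ (nbhs_filter (z : R[i]^o)) _ _ _ H) => w wz; apply: fg.
have := le_lt_trans (le_trans (ler_norm _) (ler_Re_cmod (- (w - z)))) (_ : _ < complex.Re z).
by rewrite cmodN => /(_ wz); rewrite cReN cReD cReN; lra.
Qed.

Lemma stieltjes_product_holomorphic f f1 f2 a1 a2 m1 m2 :
  stieltjes_rep f1 a1 m1 -> stieltjes_rep f2 a2 m2 ->
  (forall z, 0 <= complex.Re z -> z != 0 -> f z = f1 z * f2 z) ->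
  holomorphic_on (right_half_plane (R := R)) f.
Proof.
move=> r1 r2 fE z z0.
apply: (@derivable_right_half_plane_ext (fun z => f1 z * f2 z)) => //.
  by move=> w w0; rewrite fE ?ltW// Re_gt0_neq0.
by apply: (@derivableM R[i] R[i]^o); [exact: stieltjes_rep_derivable r1 z0|exact: stieltjes_rep_derivable r2 z0].
Qed.

(** The values of [1 / (i s + tau)] for [tau >= 0] lie in one quadrant, and
    [|Re| + |Im| = (tau + |s|) / (tau^2 + s^2) >= 1 / (tau + |s|)]:
    they do not cancel, and at most a factor [sqrt 2] is lost. *)
Lemma stieltjes_lower_bound f a m (s : R) : stieltjes_rep f a m -> s != 0 ->
  complex.Re (f `|s|%:C) <= Num.sqrt 2 * cmod (f (0 +i* s)).
Proof.
move=> [a0 fE] sn0; pose t := `|s|; have t0 : 0 < t by rewrite normr_gt0.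
have tn0 : t%:C != 0 :> R[i] by rewrite eq_complex /= gt_eqF.
have isn0 : (0 +i* s) != 0 by rewrite eq_complex /= negb_and sn0 orbT.
have is0 : 0 <= complex.Re (0 +i* s) by [].
have t0' : 0 <= complex.Re t%:C by rewrite /= ltW.
have bt := cbounded_stieltjes_kernel t0' tn0.
have bs := cbounded_stieltjes_kernel is0 isn0.
have it := cbounded_Re_integrable m (@measurable_nonneg_reals R) bt.
have ir := cbounded_Re_integrable m (@measurable_nonneg_reals R) bs.
have ii := cbounded_Im_integrable m (@measurable_nonneg_reals R) bs.
pose g := Num.sg s.
have le1 : complex.Re (f t%:C) <= complex.Re (f (0 +i* s)) - g * complex.Im (f (0 +i* s)).
  have -> : complex.Re (f t%:C) =
      a + Rintegral m D (fun tau => complex.Re (stieltjes_kernel t%:C tau)).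
    by rewrite fE.
  have -> : complex.Re (f (0 +i* s)) =
      a + Rintegral m D (fun tau => complex.Re (stieltjes_kernel (0 +i* s) tau)).
    by rewrite fE.
  have -> : complex.Im (f (0 +i* s)) =
      Rintegral m D (fun tau => complex.Im (stieltjes_kernel (0 +i* s) tau)).
    by rewrite fE// cImD add0r.
  rewrite -addrA lerD2l.
  rewrite -RintegralZl// -RintegralB//; last exact: integrableZ_R.
  apply: le_Rintegral => //.
    by rewrite /comp; under eq_fun do rewrite EFinB; apply: integrableB => //; exact: integrableZ_R.
  move=> tau tau0.
  have kt : stieltjes_kernel t%:C tau = ((1 + tau) / (t + tau))%:C.
    by rewrite /stieltjes_kernel -rmorphD /= -fmorphV -rmorphM.
  have q0 : 0 < tau ^+ 2 + t ^+ 2 by rewrite ltr_wpDl ?sqr_ge0 ?exprn_gt0.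
  have s2 : s ^+ 2 = t ^+ 2 by rewrite /t real_normK ?num_real.
  have gs : g * s = t by rewrite /g /t -normrEsg.
  have kr : complex.Re (stieltjes_kernel (0 +i* s) tau) = (1 + tau) * tau / (tau ^+ 2 + t ^+ 2).
    by rewrite /stieltjes_kernel cReM /= add0r addr0 mul0r subr0 s2 mulrA.
  have ki : complex.Im (stieltjes_kernel (0 +i* s) tau) = - ((1 + tau) * s / (tau ^+ 2 + t ^+ 2)).
    by rewrite /stieltjes_kernel cImM /= add0r addr0 mul0r addr0 s2 mulrN mulrA.
  rewrite kt kr ki mulrN opprK mulrA mulrCA gs -mulrDl -mulrDr /=.
  rewrite ler_pdivrMr ?ltr_wpDr// mulrAC ler_pdivlMr// -mulrA.
  rewrite ler_wpM2l ?addr_ge0//.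
  by have := mulr_ge0 tau0 (ltW t0); nra.
rewrite (le_trans le1)// cmod_def -sqrtrM//.
set x := complex.Re _; set y := complex.Im _.
rewrite (le_trans (ler_norm _))// -sqrtr_sqr ler_wsqrtr//.
have g2 : g ^+ 2 = 1 by rewrite /g sqr_sg sn0.
have := sqr_ge0 (x + g * y); rewrite sqrrD sqrrB exprMn g2; nra.
Qed.

End stieltjes_analytic.

(** * Averages of a semigroup and resolvents *)

Section semigroup_integral.
Context (R : realType) (X : completeNormedModType R[i]) (T : R -> {linear X -> X}).
Hypothesis hT : bounded_C0_semigroup T.
Local Notation D := (nonneg_reals (R := R)).
Implicit Types (nu : fmeas R) (x : X).

(** The operator [g(A)] for the Laplace transform [g] of [nu]. *)
Definition Tint nu x : X := Bint nu (fun s => T s x).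

Lemma Tint_is_linear nu : linear (Tint nu).
Proof.
move=> a x y; rewrite /Tint -BintZ; last exact: semigroup_buc.
rewrite -BintD; [|exact/bucZ/semigroup_buc|exact: semigroup_buc].
by congr Bint; apply/funext => s; rewrite linearP.
Qed.

HB.instance Definition _ nu :=
  GRing.isLinear.Build R[i] X X *:%R (Tint nu) (Tint_is_linear nu).

(** The linear structure of [Tint nu] rests on the hypotheses on the
    semigroup. *)
Definition Tint_linear nu : {linear X -> X} := Tint nu.

Lemma Tint_bounded nu : exists2 M : R, 0 < M & forall x, rnorm (Tint nu x) <= M * rnorm x.
Proof.
have [M M0 TM] := semigroup_bound hT; pose m := fine (nu D).
have m0 : 0 <= m by rewrite fine_ge0.
exists (M * (m + 1)) => [|x]; first by rewrite mulr_gt0// ltr_wpDl.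
apply: (@le_trans _ _ (M * rnorm x * m)).
  by apply: Bint_bound => [|s s0]; [exact: semigroup_buc|exact: TM].
by rewrite mulrAC ler_wpM2r ?rnorm_ge0// ler_wpM2l ?ltW// ltrDl.
Qed.

Lemma Tint_continuous nu : continuous (Tint nu).
Proof. by have [M _ TM] := Tint_bounded nu; exact: rnorm_bounded_cts TM. Qed.

Lemma Tint_commute nu (L : {linear X -> X}) x : continuous L ->
  (forall s y, 0 <= s -> L (T s y) = T s (L y)) -> L (Tint nu x) = Tint nu (L x).
Proof.
move=> cL LT.
have bLT : buc (fun s => L (T s x)).
  have [[M FM] Fu] := semigroup_buc hT (L x); split.
    by exists M => s s0; rewrite LT// FM.
  move=> e e0; have [d d0 Fd] := Fu _ e0; exists d => // s r s0 r0 sr.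
  by rewrite !LT//; exact: Fd.
apply: (etrans (esym (Bint_lin nu cL (semigroup_buc hT x) bLT))).
apply: rlim_BintE => // e e0.
have [d0 [K [d00 K0 H]]] := rlim_Bint nu (semigroup_buc hT (L x)) e0.
exists d0, K; split => // d N dgt0 dd0 KN.
have -> : rsum nu (fun s => L (T s x)) d N = rsum nu (fun s => T s (L x)) d N.
  by apply: eq_bigr => j _; rewrite LT// mulr_ge0// ltW.
exact: H.
Qed.

Lemma semigroup_commute s r x : 0 <= s -> 0 <= r -> T s (T r x) = T r (T s x).
Proof. by move=> s0 r0; rewrite -!(semigroupD hT)// addrC. Qed.

Lemma Tint_semigroup nu s x : 0 <= s -> T s (Tint nu x) = Tint nu (T s x).
Proof.
move=> s0; apply: Tint_commute; first exact: semigroup_continuous.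
by move=> r y r0; rewrite semigroup_commute.
Qed.

Lemma Tint_Tint nu nu' x : Tint nu (Tint nu' x) = Tint nu' (Tint nu x).
Proof.
apply: Tint_commute; first exact: Tint_continuous.
by move=> s y s0; rewrite Tint_semigroup.
Qed.

Section resolvent.
Context (a : R) (nu : fmeas R) (a0 : 0 < a) (nua : exponential_law a nu).

Lemma resolvent_bound (M : R) : (forall t x, 0 <= t -> rnorm (T t x) <= M * rnorm x) ->
  forall x, rnorm (Tint nu x) <= M * rnorm x.
Proof.
move=> TM x; have M0 : 0 <= M * rnorm x by apply: le_trans (TM 0 x (lexx 0)); exact: rnorm_ge0.
rewrite -[Tint nu x]subr0.
apply: (cvg_ler_rnorm (rlim_cvg (rlim_Bint nu (semigroup_buc hT x)) ltr01
  (fun m => leqnn (m.+1 ^ 2)))).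
apply: nearW => m; set d := 1 / _; have d0 : 0 < d by rewrite divr_gt0.
rewrite subr0 (le_trans (rnorm_sum _ _ _))//.
apply: (@le_trans _ _ (\sum_(0 <= j < m.+1 ^ 2) fine (nu (cell d j)) * (M * rnorm x))).
  apply: ler_sum => j _; have nuj : 0 <= fine (nu (cell d j)) by rewrite fine_ge0.
  by rewrite rnormZr ger0_norm// ler_wpM2l// TM// mulr_ge0// ltW.
rewrite -mulr_suml (sum_cell_exponential _ nua (ltW d0)).
by rewrite ler_piMl// gerBl expR_ge0.
Qed.

Lemma generator_resolvent x : generator T (Tint nu x, a%:C *: (Tint nu x - x)).
Proof. by apply: (resolvent_generator hT a0 nua); apply: rlim_Bint; exact: semigroup_buc. Qed.

Lemma generator_unique x g g' : generator T (x, g) -> generator T (x, g') -> g = g'.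
Proof. by rewrite /generator /= => h h'; exact: rcvg_unique h h'. Qed.

(** [Tint nu] commutes with the semigroup, hence with its generator, and
    [generator_resolvent] can be read from the other side. *)
Lemma resolvent_of_generator x g : generator T (x, g) -> Tint nu (x - a^-1%:C *: g) = x.
Proof.
move=> xg.
have gJ : generator T (Tint nu x, Tint nu g).
  rewrite /generator /=.
  have H : Tint nu ((t^-1)%:C *: (T t x - x)) @[t --> 0^'+] --> Tint nu g.
    by apply: continuous_cvg => //; exact: Tint_continuous.
  apply: (rcvg_near_eq _ H); near=> t.
  by rewrite linearZ linearB /= -Tint_semigroup//; near: t; exact: nbhs_right_ge.
have E := generator_unique gJ (@generator_resolvent x).
have an0 : a%:C != 0 :> R[i] by rewrite eq_complex /= gt_eqF.
by rewrite linearB linearZ /= E scalerA -rmorphM /= mulVf ?gt_eqF// scale1r opprB addrC subrK.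
Unshelve. all: by end_near. Qed.

End resolvent.

(** Telescoping [T t x - x] over a fine subdivision of [0, t]. *)
Lemma semigroup_increment (M : R) x g t :
  (forall t x, 0 <= t -> rnorm (T t x) <= M * rnorm x) ->
  generator T (x, g) -> 0 <= t -> rnorm (T t x - x) <= t * (M * rnorm g).
Proof.
move=> TM xg; rewrite le_eqVlt => /orP[/eqP <-|t0].
  by rewrite (semigroup0 hT) subrr rnorm0 mul0r.
have bound h n : 0 <= h -> rnorm (T (n%:R * h) x - x) <= n%:R * (M * rnorm (T h x - x)).
  move=> h0; elim: n => [|n IH].
    by rewrite !mul0r (semigroup0 hT) subrr rnorm0.
  have -> : T (n.+1%:R * h) x - x = T (n%:R * h) (T h x - x) + (T (n%:R * h) x - x).
    rewrite linearB /= -(semigroupD hT) ?mulr_ge0// -natr1 mulrDl mul1r.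
    by rewrite addrA subrK.
  rewrite (le_trans (rnormD _ _))// -natr1 [leRHS]mulrDl mul1r addrC lerD//.
  by rewrite TM// mulr_ge0.
have hn n : 0 < t / n.+1%:R by rewrite divr_gt0.
apply/ler_addgt0Pl => e e0.
have M0 : 0 < t * `|M| + 1 by rewrite ltr_wpDl// mulr_ge0// ltW.
have H : (h^-1)%:C *: (T h x - x) @[h --> 0^'+] --> g by exact: xg.
have [d /= d0 dH] := (cvg_rnormP _ _).1 H _ (divr_gt0 e0 M0).
pose n := Num.truncn (t / d).
have hd : t / n.+1%:R < d.
  by rewrite ltr_pdivrMr// mulrC -ltr_pdivrMr// truncnS_gt.
set h := t / n.+1%:R in hd; have h0 : 0 < h := hn n.
have nh : n.+1%:R * h = t by rewrite /h mulrCA divff ?mulr1// pnatr_eq0.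
have qh : rnorm (h^-1%:C *: (T h x - x) - g) < e / (t * `|M| + 1).
  by apply: dH => //=; rewrite sub0r normrN gtr0_norm.
have := bound h n.+1 (ltW h0); rewrite nh => /le_trans; apply.
have -> : n.+1%:R * (M * rnorm (T h x - x)) = t * (M * rnorm (h^-1%:C *: (T h x - x))).
  by rewrite rnormZr ger0_norm ?invr_ge0 ?(ltW h0)// -nh; field; rewrite gt_eqF.
(* A negative [M] is possible in the zero space. *)
have M0' : 0 <= M \/ forall y : X, rnorm y = 0.
  have [M0'|M0'] := lerP 0 M; [by left|right => y].
  apply/eqP; rewrite eq_le rnorm_ge0 andbT leNgt; apply/negP => y0.
  have := le_trans (rnorm_ge0 _) (TM 0 y (lexx 0)).
  by rewrite leNgt nmulr_rlt0// y0.
case: M0' => [M0'|X0]; last by rewrite !X0 !mulr0 addr0 ltW.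
have le1 : rnorm (h^-1%:C *: (T h x - x)) <= e / (t * `|M| + 1) + rnorm g.
  by have := rnorm_lerB (h^-1%:C *: (T h x - x)) g; move: (ltW qh); lra.
rewrite (@le_trans _ _ (t * (M * (e / (t * `|M| + 1) + rnorm g))))//.
  by rewrite ler_wpM2l ?(ltW t0)// ler_wpM2l.
rewrite ger0_norm// !mulrDr lerD2r mulrA mulrA ler_pdivrMr; last by move: M0; rewrite ger0_norm.
by rewrite mulrDr mulr1 [e * _]mulrC lerDl ltW.
Qed.

End semigroup_integral.

(** * Injectivity of the negative generator and of the regularizer *)

Section negative_generator.
Context (R : realType) (X : completeNormedModType R[i]) (T : R -> {linear X -> X}).
Context (A : set (X * X)).
Hypotheses (hT : bounded_C0_semigroup T) (hA : op_opp A = generator T).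
Implicit Types (x y u v w : X) (nu : fmeas R).

Lemma negative_generatorE x y : A (x, y) <-> generator T (x, - y).
Proof.
rewrite -hA; split=> [xy|[y' xy' /oppr_inj ->]]; last by [].
by exists y.
Qed.

Lemma negative_generatorD x y x' y' : A (x, y) -> A (x', y') -> A (x + x', y + y').
Proof.
move=> /negative_generatorE h /negative_generatorE h'; apply/negative_generatorE.
rewrite /generator /= [- (y + y')]opprD.
have H : (t^-1)%:C *: (T t x - x) + (t^-1)%:C *: (T t x' - x') @[t --> 0^'+] --> - y - y'.
  by apply: cvgD; [exact: h|exact: h'].
apply: (rcvg_near_eq _ H); near=> t.
have -> : T t (x + x') = T t x + T t x' by rewrite linearD.
by rewrite /= -scalerDr [- (x + x')]opprD addrACA.
Unshelve. all: by end_near. Qed.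

Lemma negative_generatorZ (c : R[i]) x y : A (x, y) -> A (c *: x, c *: y).
Proof.
move=> /negative_generatorE h; apply/negative_generatorE.
rewrite /generator /= (_ : - (c *: y) = c *: - y); last by rewrite scalerN.
have H : c *: ((t^-1)%:C *: (T t x - x)) @[t --> 0^'+] --> c *: - y.
  by apply: cvgZr; exact: h.
apply: (rcvg_near_eq _ H); near=> t.
have -> : T t (c *: x) = c *: T t x by rewrite linearZ.
by rewrite /= -scalerBr !scalerA mulrC.
Unshelve. all: by end_near. Qed.

Section resolvent.
Context (a : R) (nu : fmeas R) (a0 : 0 < a) (nua : exponential_law a nu).

Lemma resolvent_in_dom x : A (Tint T nu x, a%:C *: (x - Tint T nu x)).
Proof.
by apply/negative_generatorE; rewrite -scalerN opprB; exact: generator_resolvent.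
Qed.

Lemma resolvent_left_inverse x y : A (x, y) -> Tint T nu (x + a^-1%:C *: y) = x.
Proof.
move=> /negative_generatorE h.
by have := resolvent_of_generator hT a0 nua h; rewrite scalerN opprK.
Qed.

End resolvent.

(** Mean ergodic argument: [lambda (lambda + A)^-1] fixes the kernel of [A] and
    tends to 0 on the range of [A] as [lambda] tends to 0. *)
Lemma negative_generator_injective x : closure (op_ran A) = setT -> A (x, 0) -> x = 0.
Proof.
move=> hran Ax; have [M M0 TM] := semigroup_bound hT.
apply: rnorm_eq0; apply/eqP; rewrite eq_le rnorm_ge0 andbT.
apply/ler_addgt0Pl => e e0; rewrite addr0.
have e2 : 0 < e / 2 by rewrite divr_gt0.
have [y [[u Auy] xy]] : exists y, op_ran A y /\ rnorm (x - y) < e / 2 / M.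
  have : closure (op_ran A) x by rewrite hran.
  move=> /(_ [set y | rnorm (x - y) < e / 2 / M]) [|y [? ?]]; last by exists y.
  have H := (@cvg_rnormP R X _ (nbhs x) (nbhs_filter _) id x).1 cvg_id _ (divr_gt0 e2 M0).
  by apply: (@filterS _ _ (nbhs_filter x) _ _ _ H) => z; rewrite /= rnorm_distC.
(* [y = A u] is near [x]; the rate [l] is so small that [J y = l (u - J u)] is
   small, while [J x = x]. *)
pose C := (M + 1) * rnorm u + 1; have C0 : 0 < C.
  by rewrite ltr_wpDl// mulr_ge0 ?rnorm_ge0// addr_ge0// ltW.
pose l := e / 2 / C; have l0 : 0 < l by rewrite divr_gt0.
have [nu nul] := exponential_law_exists l0.
have JM := resolvent_bound hT nul TM.
have xJ : Tint T nu x = x.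
  by have := resolvent_left_inverse l0 nul Ax; rewrite scaler0 addr0.
have yJ : Tint T nu y = l%:C *: (u - Tint T nu u).
  have := resolvent_left_inverse l0 nul Auy; rewrite linearD linearZ /= => E.
  rewrite -[X in X - _]E addrC addKr scalerA -rmorphM /= mulfV ?scale1r//.
  by rewrite gt_eqF.
have -> : x = Tint T nu (x - y) + Tint T nu y by rewrite -[LHS]xJ -[in LHS](subrK y x) linearD.
rewrite (le_trans (rnormD _ _))//.
rewrite [leRHS]splitr lerD//.
  by rewrite (le_trans (JM _))// mulrC -ler_pdivlMr// ltW.
rewrite yJ rnormZr gtr0_norm// /l mulrAC ler_pdivrMr// ler_pM2l//.
rewrite (le_trans (rnormB _ _))//.
by have := JM u; rewrite /C; lra.
Qed.

(** [1 + J_1 - 2 J_2 = A^2 ((1 + A) (2 + A))^-1] for [J_b = b (b + A)^-1], so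
    the injectivity of [A] is used twice. *)
Lemma regularizer_injective (nu1 nu2 : fmeas R) x : closure (op_ran A) = setT ->
  exponential_law 1 nu1 -> exponential_law 2 nu2 ->
  x + Tint T nu1 x - 2%:R *: Tint T nu2 x = 0 -> x = 0.
Proof.
move=> hran e1 e2; set J1 := Tint T nu1 x; set J2 := Tint T nu2 x => E.
have d1 : A (J1, x - J1).
  by have := resolvent_in_dom ltr01 e1 x; rewrite scale1r.
have d2 : A (J2, 2%:R *: (x - J2)).
  by have := resolvent_in_dom (ltr0Sn _ 1) e2 x; rewrite rmorph_nat.
have W : 2%:R *: J2 = x + J1 by apply/esym/eqP; rewrite -subr_eq0 E.
have two (y : X) : 2%:R *: y - y = y by rewrite scaler_nat mulr2n addrK.
have dx : A (x, x - J1).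
  have := negative_generatorD (negative_generatorZ 2%:R d2) (negative_generatorZ (-1) d1).
  rewrite !scaleN1r W addrK scalerBr W opprD addrA two.
  by rewrite two.
have d0 : A (x - J1, 0).
  have := negative_generatorD dx (negative_generatorZ (-1) d1).
  by rewrite !scaleN1r subrr.
have x1 : x - J1 = 0 := negative_generator_injective hran d0.
have : A (J1, 0) by rewrite -x1.
move=> /(negative_generator_injective hran) J10.
by move: x1; rewrite J10 subr0.
Qed.

End negative_generator.

(** * Approximate eigenvectors *)

Section rotated_semigroup.
Context (R : realType) (X : normedModType R[i]).
Implicit Types (T : R -> {linear X -> X}) (l : R).

(** The semigroup [e^(-s (A - i l))], which moves the spectral point [i l] to
    0. *)
Definition rotate l T (s : R) : {linear X -> X} := cexp (s%:C * (0 +i* l)) \*: T s.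

Lemma Re_real_imag (s l : R) : complex.Re (s%:C * (0 +i* l)) = 0.
Proof. by rewrite cReM /= mulr0 mul0r subr0. Qed.

Lemma cmod_rotation (s l : R) : cmod (cexp (s%:C * (0 +i* l))) = 1.
Proof. by rewrite cmod_cexp Re_real_imag expR0. Qed.

Lemma rotate_C0 T l : bounded_C0_semigroup T -> bounded_C0_semigroup (rotate l T).
Proof.
move=> hT; split.
- by move=> x; rewrite /rotate /= mul0r cexp0 scale1r (semigroup0 hT).
- move=> s t x s0 t0; rewrite /rotate /= (semigroupD hT)// linearZ scalerA -cexpD.
  by rewrite rmorphD mulrDl.
- move=> x; rewrite -[X in _ --> X](scale1r x).
  by apply: cvgZ; [exact: cexp_cvg1|exact: semigroup_cvg0].
- have [M TM] := semigroup_bounded hT; exists M => t x t0.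
  by rewrite /rotate /= rnormZ cmod_rotation mul1r TM.
Qed.

Lemma generator_rotate T l x g : bounded_C0_semigroup T -> generator T (x, g) ->
  generator (rotate l T) (x, g + (0 +i* l) *: x).
Proof.
move=> hT xg; rewrite /generator /=.
have H : cexp (t%:C * (0 +i* l)) *: ((t^-1)%:C *: (T t x - x)) +
    ((t^-1)%:C * (cexp (t%:C * (0 +i* l)) - 1)) *: x @[t --> (0 : R)^'+]
    --> 1 *: g + (0 +i* l) *: x.
  apply: cvgD; last by apply: cvgZr_tmp; exact: cexp_derive0.
  by apply: cvgZ; [exact: cexp_cvg1|exact: xg].
rewrite scale1r in H; apply: (rcvg_near_eq _ H); near=> t.
rewrite /rotate /=; set c := cexp _.
rewrite scalerA [c * _]mulrC -!scalerA -scalerDr; congr (_ *: _).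
by rewrite scalerBr scalerBl scale1r addrA subrK.
Unshelve. all: by end_near. Qed.

Lemma generator_unrotate T l x g : bounded_C0_semigroup T ->
  generator (rotate l T) (x, g) -> generator T (x, g - (0 +i* l) *: x).
Proof.
move=> hT /(@generator_rotate _ (- l) _ _ (rotate_C0 l hT)).
rewrite /generator /= (_ : (0 +i* - l) *: x = - ((0 +i* l) *: x)); last first.
  by rewrite -scaleNr; congr (_ *: _); apply/eqP; rewrite eq_complex /= oppr0 !eqxx.
move=> H; apply: (rcvg_near_eq _ H); near=> t.
rewrite scalerA -cexpD -mulrDr (_ : (0 +i* - l) + (0 +i* l) = 0).
  by rewrite mulr0 cexp0 scale1r.
by apply/eqP; rewrite eq_complex /= addr0 addNr !eqxx.
Unshelve. all: by end_near. Qed.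

End rotated_semigroup.

(** Neumann series. *)
Lemma contraction_fixed_point (R : realType) (X : completeNormedModType R[i])
    (J : {linear X -> X}) (c : X) :
  (forall x, rnorm (J x) <= 2^-1 * rnorm x) -> exists x, x = c + J x.
Proof.
move=> Jh; pose u := fix u n := if n is n'.+1 then c + J (u n') else c.
have uS n : u n.+1 = c + J (u n) by [].
pose q : R := 2^-1; have q0 : 0 <= q by rewrite invr_ge0.
have step n : rnorm (u n.+1 - u n) <= q ^+ n * rnorm c.
  elim: n => [|n IH]; first by rewrite uS /= addrC addKr expr0 mul1r (le_trans (Jh _))// ler_piMl ?rnorm_ge0// invf_le1// ler1n.
  rewrite (uS n.+1) (uS n) opprD addrACA subrr add0r -linearB.
  by rewrite (le_trans (Jh _))// exprS -mulrA ler_wpM2l.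
have far m n : rnorm (u (m + n)%N - u m) <= (q ^+ m - q ^+ (m + n)) * 2 * rnorm c.
  elim: n => [|n IH]; first by rewrite addn0 !subrr rnorm0 !mul0r.
  rewrite addnS (le_trans (rnorm_triangle (u (m + n)%N) _ _))//.
  apply: le_trans (lerD (step (m + n)%N) IH) _.
  rewrite -mulrDl ler_wpM2r ?rnorm_ge0//; set A := q ^+ m; set B := q ^+ (m + n).
  by rewrite exprS -/B /q; lra.
have [x ux] : exists x : X, u n @[n --> \oo] --> x.
  apply: rnorm_cauchy_cvg => e e0.
  have C0 : 0 < 4 * rnorm c + 1 by rewrite ltr_wpDl// mulr_ge0 ?rnorm_ge0.
  have : q ^+ n @[n --> \oo] --> 0.
    by apply: cvg_expr; rewrite ger0_norm// /q invf_lt1// ltr1n.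
  move=> /cvgrPdist_lt/(_ _ (divr_gt0 e0 C0))[N _ HN]; exists N => m n Nm Nn.
  have qN : q ^+ N * (4 * rnorm c) <= e.
    have := HN N (leqnn _); rewrite /= sub0r normrN ger0_norm ?exprn_ge0//.
    rewrite ltr_pdivlMr// mulrDr mulr1 => /ltW; apply: le_trans.
    by rewrite lerDl exprn_ge0.
  have near_N k : (N <= k)%N -> rnorm (u k - u N) <= q ^+ N * 2 * rnorm c.
    move=> Nk; rewrite -(subnKC Nk) (le_trans (far _ _))// ler_wpM2r ?rnorm_ge0//.
    by rewrite ler_wpM2r// gerBl exprn_ge0.
  rewrite (le_trans (rnorm_triangle (u N) _ _))// (le_trans _ qN)//.
  by have := near_N _ Nm; have := near_N _ Nn; rewrite (rnorm_distC (u N)); lra.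
exists x.
have cJ : continuous J by exact: (rnorm_bounded_cts Jh).
have h1 : c + J (u n) @[n --> \oo] --> c + J x.
  by apply: cvgD; [exact: cvg_cst|apply: continuous_cvg => //; exact: cJ].
have h2 : u n.+1 @[n --> \oo] --> x by rewrite (cvg_shiftS u).
exact: rcvg_unique h2 h1.
Qed.

Section approximate_spectrum.
Context (R : realType) (X : completeNormedModType R[i]) (T : R -> {linear X -> X}).
Context (A : set (X * X)).
Hypotheses (hT : bounded_C0_semigroup T) (hA : op_opp A = generator T).

(** A purely imaginary point of the spectrum lies on its boundary, hence is an
    approximate eigenvalue. Were [A - i l] bounded below by [e], then
    [b (b + A - i l)^-1] would be a contraction for [b = e / 3] and a Neumann
    series would invert [A - i l]. *)
Lemma approximate_eigenvector (l e : R) : spectrum A (0 +i* l) -> 0 < e ->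
  exists v w, [/\ A (v, w), v != 0 & rnorm (w - (0 +i* l) *: v) <= e * rnorm v].
Proof.
move=> spl e0; apply: contrapT => nex; apply: spl; set il := 0 +i* l in nex *.
have low v w : A (v, w) -> e * rnorm v <= rnorm (w - il *: v).
  move=> Avw; have [->|vn0] := eqVneq v 0; first by rewrite rnorm0 mulr0 rnorm_ge0.
  by rewrite leNgt; apply/negP => /ltW h; apply: nex; exists v, w.
pose S := rotate l T; have hS : bounded_C0_semigroup S by exact: rotate_C0.
pose b := e / 3; have b0 : 0 < b by rewrite divr_gt0.
have [nu nub] := exponential_law_exists b0.
have AJ x : A (Tint S nu x, il *: Tint S nu x + b%:C *: (x - Tint S nu x)).
  apply/(negative_generatorE hA).
  have g : generator S (Tint S nu x, b%:C *: (Tint S nu x - x)) by exact: generator_resolvent.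
  have := generator_unrotate hT g; rewrite -/il; set P := il *: _.
  have -> : b%:C *: (Tint S nu x - x) - P = - (P + b%:C *: (x - Tint S nu x)); last by [].
  by rewrite [RHS]opprD -[- (b%:C *: _)]scalerN opprB addrC.
have dE x y : il *: x + y - il *: x = y by rewrite addrAC subrr add0r.
have Jh x : rnorm (Tint S nu x) <= 2^-1 * rnorm x.
  have := low _ _ (AJ x); rewrite dE rnormZr gtr0_norm// => h.
  have := rnormB x (Tint S nu x); rewrite -(ler_pM2l b0) => /(le_trans h).
  by rewrite /b; move: e0; nra.
have surj y : exists u, A (u, il *: u - y).
  have [x xE] := contraction_fixed_point (J := Tint S nu) (- (b^-1%:C *: y)) Jh.
  exists (Tint S nu x); have := AJ x.
  have -> : x - Tint S nu x = - (b^-1%:C *: y) by rewrite {1}xE addrK.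
  rewrite scalerN scalerA -rmorphM /= mulfV ?gt_eqF// scale1r.
  by [].
have uniq u u' y : A (u, il *: u - y) -> A (u', il *: u' - y) -> u = u'.
  move=> Au Au'; have := negative_generatorD hA Au (negative_generatorZ hA (-1) Au').
  rewrite !scaleN1r => /low.
  have -> : (il *: u - y) - (il *: u' - y) - il *: (u - u') = 0.
    by rewrite scalerBr opprB addrA subrK subrr.
  rewrite rnorm0 pmulr_rle0// => h.
  apply/eqP; rewrite -subr_eq0; apply/eqP/rnorm_eq0/eqP.
  by rewrite eq_le h rnorm_ge0.
pose B y := projT1 (cid (surj y)).
have BP y : A (B y, il *: B y - y) := projT2 (cid (surj y)).
have Blin : linear B.
  move=> a x y; apply: uniq (BP _) _.
  have := negative_generatorD hA (negative_generatorZ hA a (BP x)) (BP y).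
  congr (A (_, _)).
  by rewrite scalerBr scalerDr opprD addrACA scalerA mulrC -scalerA.
have Bbd y : rnorm (B y) <= e^-1 * rnorm y.
  have := low _ _ (BP y); rewrite addrAC subrr add0r rnormN => h.
  by rewrite mulrC ler_pdivlMr// mulrC.
pose Bmixin := GRing.isLinear.Build R[i] X X *:%R B Blin.
pose BL : {linear X -> X} := HB.pack B Bmixin.
exists BL; split; first exact: (@rnorm_bounded_cts _ _ _ BL e^-1).
apply/seteqP; split => [[y u]|[y u]] /=.
  move=> [y1 [y2 [y1E [w Auw y2E] yE]]]; rewrite /op_of /= in y1E y2E yE *.
  apply: (uniq u (B y) y _ (BP y)).
  by rewrite yE y1E y2E opprB addrC subrK.
rewrite {1}/op_of /= => ->; exists (il *: B y), (- (il *: B y - y)).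
split; [by []|exists (il *: B y - y); [exact: BP|by []]|by rewrite /= opprB addrC subrK].
Qed.

End approximate_spectrum.

(** * Operators on approximate eigenvectors *)

Section approximate_eigenvalues.
Context (R : realType) (X : completeNormedModType R[i]) (T : R -> {linear X -> X}).
Context (A : set (X * X)).
Hypotheses (hT : bounded_C0_semigroup T) (hA : op_opp A = generator T).
Context (l : R).
Local Notation il := (0 +i* l).
Local Notation D := (nonneg_reals (R := R)).
Implicit Types (L : X -> X) (c : R[i]) (v w : X) (nu : fmeas R).

(** [L] acts as multiplication by [c] on approximate eigenvectors of [A] for
    [i l]; this is how the spectral value [g (i l)] of [g(A)] is reached without
    a spectral mapping theorem. *)
Definition spectral_value L c := forall e : R, 0 < e -> exists2 d, 0 < d &
  forall v w, A (v, w) -> rnorm (w - il *: v) <= d * rnorm v ->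
    rnorm (L v - c *: v) <= e * rnorm v.

Lemma spectral_value_id : spectral_value id 1.
Proof. by move=> e e0; exists 1 => // v w _ _; rewrite scale1r subrr rnorm0 mulr_ge0 ?rnorm_ge0// ltW. Qed.

Lemma spectral_valueD L L' c c' : spectral_value L c -> spectral_value L' c' ->
  spectral_value (fun v => L v + L' v) (c + c').
Proof.
move=> Lc Lc' e e0; have e2 : 0 < e / 2 by rewrite divr_gt0.
have [d d0 H] := Lc _ e2; have [d' d'0 H'] := Lc' _ e2.
exists (Num.min d d'); first by rewrite lt_min d0.
move=> v w Avw h; rewrite scalerDl opprD addrACA (le_trans (rnormD _ _))//.
rewrite [e]splitr mulrDl lerD//.
- by apply: (H _ w) => //; apply: (le_trans h); rewrite ler_wpM2r ?rnorm_ge0// ge_min lexx.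
- by apply: (H' _ w) => //; apply: (le_trans h); rewrite ler_wpM2r ?rnorm_ge0// ge_min lexx orbT.
Qed.

Lemma spectral_value_comp (L : {linear X -> X}) L' c c' (M : R) :
  (forall x, rnorm (L x) <= M * rnorm x) ->
  spectral_value L c -> spectral_value L' c' -> spectral_value (fun v => L (L' v)) (c' * c).
Proof.
move=> LM Lc Lc' e e0.
have M0 : 0 < `|M| + 1 by rewrite ltr_wpDl.
have C0 : 0 < cmod c' + 1 by rewrite ltr_wpDl// cmod_ge0.
have e1 : 0 < e / 2 / (`|M| + 1) by rewrite !divr_gt0.
have e2 : 0 < e / 2 / (cmod c' + 1) by rewrite !divr_gt0.
have [d d0 H] := Lc _ e2; have [d' d'0 H'] := Lc' _ e1.
exists (Num.min d d'); first by rewrite lt_min d0.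
move=> v w Avw h.
have -> : L (L' v) - (c' * c) *: v = L (L' v - c' *: v) + c' *: (L v - c *: v).
  by rewrite [L (_ - _)]linearB [L (_ *: _)]linearZ /= [c' *: (_ - _)]scalerBr scalerA addrA subrK.
rewrite (le_trans (rnormD _ _))// [e]splitr mulrDl lerD//.
- have {}H' : rnorm (L' v - c' *: v) <= e / 2 / (`|M| + 1) * rnorm v.
    by apply: (H' _ w) => //; apply: (le_trans h); rewrite ler_wpM2r ?rnorm_ge0// ge_min lexx orbT.
  rewrite (le_trans (LM _))// (@le_trans _ _ ((`|M| + 1) * rnorm (L' v - c' *: v)))//.
    by rewrite ler_wpM2r ?rnorm_ge0// (le_trans (ler_norm _))// lerDl.
  by rewrite -ler_pdivlMl// (le_trans H')// mulrA [_^-1 * _]mulrC.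
- have {}H : rnorm (L v - c *: v) <= e / 2 / (cmod c' + 1) * rnorm v.
    by apply: (H _ w) => //; apply: (le_trans h); rewrite ler_wpM2r ?rnorm_ge0// ge_min lexx.
  rewrite rnormZ (@le_trans _ _ ((cmod c' + 1) * rnorm (L v - c *: v)))//.
    by rewrite ler_wpM2r ?rnorm_ge0// lerDl.
  by rewrite -ler_pdivlMl// (le_trans H)// mulrA [_^-1 * _]mulrC.
Qed.

Lemma spectral_valueZ a L c : spectral_value L c ->
  spectral_value (fun v => a *: L v) (a * c).
Proof.
move=> Lc e e0; have C0 : 0 < cmod a + 1 by rewrite ltr_wpDl// cmod_ge0.
have [d d0 H] := Lc _ (divr_gt0 e0 C0); exists d => // v w Avw h.
rewrite -scalerA -scalerBr rnormZ (@le_trans _ _ ((cmod a + 1) * rnorm (L v - c *: v)))//.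
  by rewrite ler_wpM2r ?rnorm_ge0// lerDl.
by rewrite -ler_pdivlMl// (le_trans (H _ w Avw h))// mulrA [_^-1 * e]mulrC.
Qed.

Lemma spectral_valueB L L' c c' : spectral_value L c -> spectral_value L' c' ->
  spectral_value (fun v => L v - L' v) (c - c').
Proof.
move=> Lc Lc'; have := spectral_valueD Lc (spectral_valueZ (-1) Lc').
by rewrite mulN1r; under [in X in X -> _]eq_fun do rewrite scaleN1r.
Qed.

Lemma spectral_value_pow (J : {linear X -> X}) c (M : R) n :
  (forall x, rnorm (J x) <= M * rnorm x) -> spectral_value J c ->
  spectral_value (iter n J) (c ^+ n).
Proof.
move=> JM Jc; elim: n => [|n IH]; first by rewrite expr0; exact: spectral_value_id.
by rewrite exprSr; apply: (spectral_value_comp JM Jc IH).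
Qed.

(** The increment bound for the rotated semigroup, whose generator maps [v] to
    [- (w - i l v)]. *)
Lemma orbit_deviation (M : R) v w s : 0 <= M ->
  (forall t x, 0 <= t -> rnorm (T t x) <= M * rnorm x) -> A (v, w) -> 0 <= s ->
  rnorm (T s v - cexp (- (s%:C * il)) *: v) <= s * (M * rnorm (w - il *: v)).
Proof.
move=> M0 TM /(negative_generatorE hA) /(@generator_rotate _ _ _ l _ _ hT) g s0.
have SM t x : 0 <= t -> rnorm (rotate l T t x) <= M * rnorm x.
  by move=> t0; rewrite /rotate /= rnormZ cmod_rotation mul1r TM.
have := semigroup_increment (rotate_C0 l hT) SM g s0.
rewrite (_ : - w + il *: v = - (w - il *: v)) ?rnormN; last by rewrite opprB addrC.
rewrite /rotate /= => /(le_trans _); apply.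
rewrite -[leLHS]mul1r -(cmod_rotation s l) -rnormZ scalerBr scalerA -cexpD subrr.
by rewrite cexp0 scale1r.
Qed.

Lemma spectral_value_semigroup t : 0 <= t -> spectral_value (T t) (cexp (- (t%:C * il))).
Proof.
move=> t0 e e0; have [M M0 TM] := semigroup_bound hT.
have C0 : 0 < t * M + 1 by rewrite ltr_wpDl// mulr_ge0// ltW.
exists (e / (t * M + 1)) => [|v w Avw h]; first by rewrite divr_gt0.
rewrite (le_trans (orbit_deviation (ltW M0) TM Avw t0))//.
rewrite (@le_trans _ _ ((t * M + 1) * rnorm (w - il *: v)))//.
  by rewrite mulrA ler_wpM2r ?rnorm_ge0// lerDl.
by rewrite -ler_pdivlMl// (le_trans h)// mulrA [_^-1 * e]mulrC.
Qed.

Lemma Bint_scalar nu (k : R -> R[i]^o) (y : R[i]) v : rlim nu k y -> buc (fun s => k s *: v) ->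
  Bint nu (fun s => k s *: v) = y *: v.
Proof.
move=> ky bk; apply: rcvg_unique (rlim_cvg (rlim_Bint nu bk) ltr01
  (fun m => leqnn (m.+1 ^ 2))) _.
have H := rlim_cvg ky ltr01 (fun m => leqnn (m.+1 ^ 2)).
rewrite (_ : (fun m => _) = (fun m => rsum nu k (1 / m.+1%:R) (m.+1 ^ 2) *: v)).
  by apply: cvgZr_tmp; exact: H.
apply/funext => m; rewrite /rsum scaler_suml.
by apply: eq_bigr => j _; rewrite scalerA.
Qed.

(** Up to time [K] the orbit of [v] follows [e^(-i s l) v] by [orbit_deviation];
    the mass of [nu] beyond [K] is small. *)
Lemma spectral_value_Tint nu : spectral_value (Tint T nu) (lap nu il).
Proof.
move=> e e0; have [M M0 TM] := semigroup_bound hT.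
have il0 : 0 <= complex.Re il by [].
pose m := fine (nu D); have m0 : 0 <= m by rewrite fine_ge0.
have M10 : 0 < M + 1 by rewrite ltr_wpDl// ltW.
have e1 : 0 < e / 2 / (M + 1) by rewrite !divr_gt0.
have [K K0 tailK] := finite_measure_tail nu e1.
have C0 : 0 < K * M * m + 1 by rewrite ltr_wpDl// !mulr_ge0// ltW.
exists (e / 2 / (K * M * m + 1)) => [|v w Avw h]; first by rewrite !divr_gt0.
set d := e / 2 / _ in h.
have bE : buc (fun s => cexp (- (s%:C * il)) *: v).
  have [_ Eu] := kernel_buc il0; split.
    by exists (rnorm v) => s _; rewrite rnormZ cmod_cexp cReN Re_real_imag oppr0 expR0 mul1r.
  move=> e' e'0; have C1 : 0 < rnorm v + 1 by rewrite ltr_wpDl// rnorm_ge0.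
  have [d' d'0 H] := Eu _ (divr_gt0 e'0 C1); exists d' => // s r s0 r0 sr.
  rewrite -scalerBl rnormZ (@le_trans _ _ (e' / (rnorm v + 1) * rnorm v))//.
    by rewrite ler_wpM2r ?rnorm_ge0//; exact: H.
  by rewrite mulrAC ler_pdivrMr// ler_pM2l// lerDl.
have bT := semigroup_buc hT v.
rewrite -(Bint_scalar (lap_rlim nu il0) bE) -scaleN1r -BintZ// -BintD//; last exact: bucZ.
pose g (s : R) := K * (M * rnorm (w - il *: v)) + (M + 1) * rnorm v * \1_[set s : R | K <= s] s.
have mt : measurable ([set s | K <= s] : set (mR R)).
  rewrite (_ : [set s | _ <= s] = `[K, +oo[%classic); first exact: measurable_itv.
  by apply/seteqP; split => s /=; rewrite in_itv /= andbT.
have Fg s : 0 <= s -> rnorm (T s v + -1 *: (cexp (- (s%:C * il)) *: v)) <= g s.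
  move=> s0; rewrite scaleN1r /g indicE; have [Ks|sK] := lerP K s.
    rewrite mem_set// mulr1; apply: ler_wpDl.
      by apply: mulr_ge0; [exact: ltW|apply: mulr_ge0; [exact: ltW|exact: rnorm_ge0]].
    rewrite (le_trans (rnormB _ _))// mulrDl mul1r lerD ?TM//.
    by rewrite rnormZ cmod_cexp cReN Re_real_imag oppr0 expR0 mul1r.
  rewrite memNset ?mulr0 ?addr0; last by rewrite /= leNgt sK.
  rewrite (le_trans (orbit_deviation (ltW M0) TM Avw s0))//.
  by apply: ler_wpM2r; [apply: mulr_ge0; [exact: ltW|exact: rnorm_ge0]|exact: ltW].
have bF : buc (fun s => T s v + -1 *: (cexp (- (s%:C * il)) *: v)) by apply: bucD => //; exact: bucZ.
have mg : measurable_fun (D : set (mR R)) g.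
  by apply: measurable_funD => //; apply: measurable_funM => //; exact: measurable_indic.
rewrite -lee_fin; apply: (le_trans (rlim_bound_le bF (rlim_Bint nu bF) mg Fg)).
pose c1 := K * (M * rnorm (w - il *: v)); pose c2 := (M + 1) * rnorm v.
have c10 : 0 <= c1.
  by apply: mulr_ge0; [exact: ltW|apply: mulr_ge0; [exact: ltW|exact: rnorm_ge0]].
have c20 : 0 <= c2 by apply: mulr_ge0; [exact: ltW|exact: rnorm_ge0].
have -> : (\int[nu]_(s in D) (g s)%:E =
    \int[nu]_(s in D) (c1%:E + c2%:E * (\1_[set s : R | (K <= s)%R] s)%:E))%E.
  by apply: eq_integral => s _; rewrite /g EFinD EFinM.
rewrite ge0_integralD//; first last.
- apply: emeasurable_funM => //.
  by apply/measurable_EFinP; exact: measurable_indic.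
- by move=> s _; rewrite -EFinM lee_fin mulr_ge0.
rewrite ge0_integralZl//; last by apply/measurable_EFinP; exact: measurable_indic.
rewrite integral_cst// integral_indic//.
rewrite [X in (_ * X + _)%E](_ : _ = m%:E); last by rewrite /m fineK// fin_num_measure.
rewrite [e in leRHS]splitr mulrDl EFinD; apply: leeD.
  rewrite -EFinM lee_fin /c1.
  have -> : K * (M * rnorm (w - il *: v)) * m = K * M * m * rnorm (w - il *: v) by ring.
  rewrite (@le_trans _ _ ((K * M * m + 1) * rnorm (w - il *: v)))//.
    by rewrite ler_wpM2r ?rnorm_ge0// lerDl.
  by rewrite -ler_pdivlMl// (le_trans h)// mulrA [_^-1 * _]mulrC.
apply: (@le_trans _ _ (c2%:E * (e / 2 / (M + 1))%:E)%E).
  apply: lee_pmul => //; apply: (le_trans _ (tailK _ (lexx K))).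
  apply: le_measure.
  - by rewrite inE; apply: measurableI => //; exact: measurable_nonneg_reals.
  - by rewrite inE.
  - exact: subIsetl.
rewrite -EFinM lee_fin /c2 mulrC mulrA [_ * (M + 1)]divfK ?gt_eqF//.
Qed.

End approximate_eigenvalues.

(** * Lower bound for the functional calculus *)

(** [(c e - d) / (e + d)] is at least [c - eps] as soon as
    [d (1 + c) <= eps e]. *)
Lemma ratio_lower_bound (R : realType) (c e d N y eps : R) : 0 <= y -> 0 <= N -> 0 <= d ->
  0 <= eps -> d * (1 + c) <= eps * e -> 1 <= (e + d) * N -> (c * e - d) * N <= y ->
  c <= y + eps.
Proof.
move=> y0 N0 d0 eps0 h h1 h2.
have [ce|ce] := lerP c eps; first lra.
have k3 : (c - eps) * (e + d) <= c * e - d by have h3 := mulr_ge0 eps0 d0; lra.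
have k4 : c - eps <= (c - eps) * ((e + d) * N) by rewrite ler_peMr// subr_ge0 ltW.
have k5 : (c - eps) * ((e + d) * N) <= (c * e - d) * N by rewrite mulrA ler_wpM2r.
by rewrite -lerBlDr (le_trans k4)// (le_trans k5).
Qed.

Section functional_calculus_bound.
Context (R : realType) (X : completeNormedModType R[i]) (T : R -> {linear X -> X}).
Context (A : set (X * X)).
Hypotheses (hT : bounded_C0_semigroup T) (hA : op_opp A = generator T).
Local Notation D := (nonneg_reals (R := R)).
Implicit Types (nu : fmeas R) (x y v w : X).

(** The two equal imaginary parts cancel. *)
Definition real_cmeasure (p q : fmeas R) : cmeasure R :=
  CMeasure p q (\d_(0 : mR R) : fmeas R) (\d_(0 : mR R) : fmeas R).

Lemma laplace_real (p q : fmeas R) z :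
  laplace (real_cmeasure p q) z = lap p z - lap q z.
Proof. by rewrite /laplace /= subrr mulr0 addr0. Qed.

Lemma hp_calculus_real (p q : fmeas R) x y :
  hp_calculus T (real_cmeasure p q) (x, y) <-> y = Tint T p x - Tint T q x.
Proof.
have b := semigroup_buc hT x; rewrite /hp_calculus /=; split.
  move=> [y1 [y2 [y3 [y4 [h1 h2 h3 h4 ->]]]]].
  rewrite -(bochner_BintE b h1) -(bochner_BintE b h2) -(bochner_BintE b h3).
  by rewrite -(bochner_BintE b h4) subrr scaler0 addr0.
move=> ->; exists (Tint T p x), (Tint T q x).
exists (Tint T (\d_(0 : mR R) : fmeas R) x), (Tint T (\d_(0 : mR R) : fmeas R) x).
by split; try exact: BintP; rewrite subrr scaler0 addr0.
Qed.

Lemma resolvent_power_graph (b : R) nu x n : 0 < b -> exponential_law b nu ->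
  op_pow (op_inv (op_add (op_of id) (op_scale (b^-1)%:C A))) n (x, iter n (Tint T nu) x).
Proof.
move=> b0 nub; elim: n => [//|n IH]; rewrite /op_pow /=.
exists (iter n (Tint T nu) x) => //=; set y := iter n _ x.
rewrite /op_inv /op_add /=; exists (Tint T nu y), (y - Tint T nu y); split => //=.
  exists (b%:C *: (y - Tint T nu y)); first exact: resolvent_in_dom.
  by rewrite scalerA -rmorphM /= mulVf ?scale1r// gt_eqF.
by rewrite addrC subrK.
Qed.

Lemma euler_defect_graph (n : nat) (t : R) nu x : (0 < n)%N -> 0 < t ->
  exponential_law (n%:R / t) nu ->
  euler_defect A T n t (x, iter n (Tint T nu) x - T t x).
Proof.
move=> n0 t0 nub; have b0 : 0 < n%:R / t by rewrite divr_gt0// ltr0n.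
exists (iter n (Tint T nu) x), (- T t x); split => //=.
  by have := resolvent_power_graph x n b0 nub; rewrite invf_div.
by exists (T t x).
Qed.

(** Partial fractions:
    [z^2 / ((1 + z) (2 + z)) = 1 + 1 / (1 + z) - 2 * (2 / (2 + z))]. *)
Lemma regularizer_laplace : exists nu1 nu2 p q : fmeas R,
  [/\ exponential_law 1 nu1, exponential_law 2 nu2,
      (forall x, Tint T p x - Tint T q x = x + Tint T nu1 x - 2%:R *: Tint T nu2 x) &
      forall z, 0 <= complex.Re z -> lap p z - lap q z = z ^+ 2 / ((1 + z) * (2%:R + z))].
Proof.
have [nu1 e1] := exponential_law_exists (ltr01 : 0 < 1 :> R).
have [nu2 e2] := exponential_law_exists (ltr0Sn _ 1 : 0 < 2 :> R).
pose d0 : fmeas R := \d_(0 : mR R).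
have [p pE] := measure_combination d0 nu1 (ler01 : 0 <= 1 :> R) ler01.
have [q qE] := measure_combination nu2 nu2 (ler01 : 0 <= 1 :> R) ler01.
exists nu1, nu2, p, q; split => //.
- move=> x; have b := semigroup_buc hT x.
  have -> : Tint T p x = x + Tint T nu1 x.
    rewrite /Tint (@Bint_measureD _ _ d0 nu1 p 1 1 _ b); last first.
      by move=> d j dgt0; apply: pE; exact: measurable_cell.
    by rewrite !scale1r (rlim_dirac0 (rlim_Bint _ b)) (semigroup0 hT).
  rewrite /Tint (@Bint_measureD _ _ nu2 nu2 q 1 1 _ b); last first.
    by move=> d j dgt0; apply: qE; exact: measurable_cell.
  by rewrite !scale1r scaler_nat mulr2n.
- move=> z z0.
  have n1 : 1 + z != 0 by apply: Re_gt0_neq0; rewrite cReD /= ltr_wpDr.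
  have n2 : 2%:R + z != 0.
    by apply: Re_gt0_neq0; rewrite cReD -(rmorph_nat (real_complex R)) /= ltr_wpDr.
  rewrite (@lap_measureD _ d0 nu1 p 1 1)//; last first.
    by move=> d j dgt0; apply: pE; exact: measurable_cell.
  rewrite (@lap_measureD _ nu2 nu2 q 1 1)//; last first.
    by move=> d j dgt0; apply: qE; exact: measurable_cell.
  rewrite lap_dirac0// (lap_exponential ltr01 z0 e1) (lap_exponential (ltr0Sn _ 1) z0 e2).
  rewrite rmorph1 rmorph_nat.
  by field; rewrite n1 n2.
Qed.

(** The pairs [(e(A) v, (e f)(A) Delta v)] lie in the graph of [f(A) Delta];
    along approximate eigenvectors [v] for [i l] the ratio of the norms of the
    two components tends to [|f(i l) Delta(i l)|]. *)
Lemma calculus_lower_bound (f : R[i] -> R[i]) (l : R) (n : nat) (t : R) :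
  closure (op_ran A) = setT -> l != 0 -> spectrum A (0 +i* l) -> (0 < n)%N -> 0 < t ->
  holomorphic_on (right_half_plane (R := R)) f ->
  laplace_difference (fun z => z ^+ 2 / ((1 + z) * (2%:R + z)) * f z) ->
  ((cmod (f (0 +i* l) * (((n%:R / t)%:C / ((n%:R / t)%:C + (0 +i* l))) ^+ n
      - cexp (- (t%:C * (0 +i* l))))))%:E
    <= op_norm (op_comp (ext_hp_calculus T f) (euler_defect A T n t)))%E.
Proof.
move=> hran l0 spl n0 t0 hf [p [q pq]]; set il := 0 +i* l.
have ilRe : 0 <= complex.Re il by [].
have iln0 : il != 0 by rewrite eq_complex /= negb_and l0 orbT.
have [nu1 [nu2 [pe [qe [e1 e2 eE elap]]]]] := regularizer_laplace.
have b0 : 0 < n%:R / t by rewrite divr_gt0// ltr0n.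
have [nu nub] := exponential_law_exists b0.
pose lin := Tint_linear hT.
pose J := lin nu.
pose E x := Tint T pe x - Tint T qe x.
pose G x := Tint T p x - Tint T q x.
pose Dl x := iter n J x - T t x.
set ev := il ^+ 2 / ((1 + il) * (2%:R + il)) in pq *.
set dv := _ ^+ n - _.
have [M M0 TM] := semigroup_bound hT.
have JM := resolvent_bound hT nub TM.
have svE : spectral_value A l E ev.
  by rewrite /ev -(elap _ ilRe); apply: spectral_valueB; exact: spectral_value_Tint.
have svDl : spectral_value A l Dl dv.
  apply: spectral_valueB; last exact: spectral_value_semigroup (ltW t0).
  apply: (spectral_value_pow n JM).
  by rewrite -(lap_exponential b0 ilRe nub); exact: spectral_value_Tint.
have [Mp Mp0 MpT] := Tint_bounded hT p; have [Mq Mq0 MqT] := Tint_bounded hT q.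
have svGD : spectral_value A l (fun v => G (Dl v)) (dv * (ev * f il)).
  have -> : dv * (ev * f il) = dv * lap p il - dv * lap q il by rewrite -mulrBr -pq.
  apply: spectral_valueB.
  - by apply: (@spectral_value_comp _ _ _ _ (lin p) _ _ _ _ MpT); [exact: spectral_value_Tint|].
  - by apply: (@spectral_value_comp _ _ _ _ (lin q) _ _ _ _ MqT); [exact: spectral_value_Tint|].
have ab (x1 x2 x3 x4 : X) : (x1 - x2) - (x3 - x4) = (x1 - x3) - (x2 - x4).
  by rewrite !opprB addrACA [RHS]addrACA [- x3 - x2]addrC.
have linB mu x y : Tint T mu (x - y) = Tint T mu x - Tint T mu y := linearB (lin mu) x y.
have EB x y : E (x - y) = E x - E y by rewrite /E !linB ab.
have JE x : iter n J (E x) = E (iter n J x).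
  have step y : J (E y) = E (J y).
    by rewrite /E [LHS]linB; congr (_ - _); exact: Tint_Tint.
  elim: n {b0 nub n0 dv svDl svGD Dl JM} => [//|k IH] /=.
  exact: (etrans (congr1 J IH) (step _)).
have TE x : T t (E x) = E (T t x).
  by rewrite /E linearB; congr (_ - _); apply: Tint_semigroup => //; exact: ltW.
have DlE x : Dl (E x) = E (Dl x) by rewrite /Dl JE TE EB.
have GE x : G (E x) = E (G x).
  by rewrite /G /E !linB ab !(Tint_Tint hT pe) !(Tint_Tint hT qe).
have EZ (r : R) x : E (r%:C *: x) = r%:C *: E x.
  have linZ mu y : Tint T mu (r%:C *: y) = r%:C *: Tint T mu y := linearZ_LR (lin mu) _ _.
  by rewrite /E !linZ scalerBr.
have Einj x x' : E x = E x' -> x = x'.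
  move=> /eqP; rewrite -subr_eq0 -EB => /eqP; rewrite /E eE => Exx'.
  by apply/eqP; rewrite -subr_eq0; apply/eqP/(regularizer_injective hT hA hran e1 e2 Exx').
have graph v : op_comp (ext_hp_calculus T f) (euler_defect A T n t) (E v, G (Dl v)).
  exists (Dl (E v)); first exact: euler_defect_graph.
  split => //; exists (real_cmeasure pe qe), (real_cmeasure p q); split; last first.
    exists (G (Dl (E v))); first exact/hp_calculus_real.
    by apply/hp_calculus_real; rewrite -/(E _) DlE GE.
  split.
    move=> x x' y /hp_calculus_real h /hp_calculus_real h'.
    exact: (Einj _ _ (etrans (esym h) h')).
  move=> z z0; rewrite !laplace_real elap ?ltW// -pq ?ltW//.
  exact: Re_gt0_neq0.
set c := f il * dv.
have evn0 : 0 < cmod ev.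
  rewrite cmod_gt0 /ev mulf_neq0 ?expf_neq0 ?invr_neq0// mulf_neq0//.
    by apply: Re_gt0_neq0; rewrite cReD /= addr0.
  by apply: Re_gt0_neq0; rewrite cReD -(rmorph_nat (real_complex R)) /= addr0.
apply/lee_addgt0Pr => eps eps0.
have c1 : 0 < 1 + cmod c by rewrite ltr_wpDr// cmod_ge0.
(* [d1] keeps the loss on the quotient below [eps]; the bound [cmod ev / 2] keeps
   [E v] away from 0. *)
pose d1 := eps * cmod ev / (1 + cmod c); have d10 : 0 < d1 by rewrite divr_gt0// mulr_gt0.
pose dh := Num.min d1 (cmod ev / 2).
have dh0 : 0 < dh by rewrite lt_min d10 divr_gt0.
have [dE dE0 HE] := svE _ dh0; have [dG dG0 HG] := svGD _ dh0.
have dm0 : 0 < Num.min dE dG by rewrite lt_min dE0.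
have [v [w [Avw vn0 vw]]] := approximate_eigenvector hT hA spl dm0.
have v0 : 0 < rnorm v.
  by rewrite lt_def rnorm_ge0 andbT; apply: contra_neq vn0; exact: rnorm_eq0.
have mE : Num.min dE dG <= dE by rewrite ge_min lexx.
have mG : Num.min dE dG <= dG by rewrite ge_min lexx orbT.
have dh1 : dh <= d1 by rewrite ge_min lexx.
have dh2 : dh <= cmod ev / 2 by rewrite ge_min lexx orbT.
have hE := HE _ _ Avw (le_trans vw (ler_wpM2r (rnorm_ge0 v) mE)).
have Ev0 : 0 < rnorm (E v).
  have h := rnorm_lerB (ev *: v) (E v); rewrite rnorm_distC rnormZ in h.
  have h1 : dh * rnorm v <= cmod ev / 2 * rnorm v by rewrite ler_wpM2r ?rnorm_ge0.
  have h2 : 0 < cmod ev * rnorm v by rewrite mulr_gt0.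
  have h3 := le_trans h (le_trans hE h1); rewrite mulrAC in h3.
  apply: lt_le_trans (_ : cmod ev * rnorm v / 2 <= _); first by rewrite divr_gt0.
  by rewrite -(lerD2l (cmod ev * rnorm v / 2)) -splitr -lerBlDr.
pose r := (rnorm (E v))^-1; have r0 : 0 < r by rewrite invr_gt0.
pose v1 := r%:C *: v; pose w1 := r%:C *: w.
have Avw1 : A (v1, w1) by exact: (negative_generatorZ hA _ Avw).
have vw1 : rnorm (w1 - il *: v1) <= Num.min dE dG * rnorm v1.
  rewrite /v1 /w1 scalerA mulrC -scalerA -scalerBr !rnormZr mulrCA.
  by rewrite ler_wpM2l.
have Ev1 : rnorm (E v1) = 1 by rewrite EZ rnormZr gtr0_norm// mulVf// gt_eqF.
have hE1 := HE _ _ Avw1 (le_trans vw1 (ler_wpM2r (rnorm_ge0 v1) mE)).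
have hG1 := HG _ _ Avw1 (le_trans vw1 (ler_wpM2r (rnorm_ge0 v1) mG)).
set y := rnorm (G (Dl v1)).
have yin : (y%:E <= op_norm (op_comp (ext_hp_calculus T f) (euler_defect A T n t)))%E.
  apply: ereal_sup_ubound; exists (E v1), (G (Dl v1)); split => //.
  by rewrite Ev1.
apply: (@le_trans _ _ (y%:E + eps%:E)%E); last by rewrite leeD2r.
rewrite -EFinD lee_fin.
have N0 := rnorm_ge0 v1; set N := rnorm v1 in N0 hE1 hG1 *.
have k1 : 1 <= (cmod ev + dh) * N.
  have h := rnorm_lerB (E v1) (ev *: v1); rewrite Ev1 rnormZ -/N in h.
  by rewrite mulrDl -lerBlDl (le_trans h).
have k2 : (cmod c * cmod ev - dh) * N <= y.
  have h := rnorm_lerB ((dv * (ev * f il)) *: v1) (G (Dl v1)).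
  rewrite rnorm_distC rnormZ -/N -/y (_ : cmod _ = cmod c * cmod ev) in h; last first.
    by rewrite (cmodM dv) (cmodM ev) /c (cmodM (f il)) mulrA mulrAC (mulrC (cmod dv)).
  rewrite mulrBl lerBlDr -lerBlDl; exact: le_trans h hG1.
apply: (ratio_lower_bound _ N0 (ltW dh0) (ltW eps0) _ k1 k2); first exact: rnorm_ge0.
have <- : d1 * (1 + cmod c) = eps * cmod ev by rewrite /d1 divfK// gt_eqF.
by rewrite ler_wpM2r// ltW.
Qed.

End functional_calculus_bound.

(** * The symbol at the critical frequency *)

Section scalar_bounds.
Context (R : realType).
Local Notation D := (nonneg_reals (R := R)).
Implicit Types (f : R[i] -> R[i]) (m : fmeas R).

(** Bernoulli: [(1 + 1 / n)^n >= 2]. *)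
Lemma bernoulli_half (n : nat) : (0 < n)%N -> (n%:R / n.+1%:R) ^+ n <= 2^-1 :> R.
Proof.
move=> n0; have nR : 0 < n%:R :> R by rewrite ltr0n.
have B (x : R) k : 0 <= x -> 1 + k%:R * x <= (1 + x) ^+ k.
  move=> x0; elim: k => [|k IH]; first by rewrite mul0r addr0 expr0.
  rewrite exprS (le_trans _ (ler_wpM2l _ IH)) ?addr_ge0//.
  by have := mulr_ge0 (mulr_ge0 (ler0n R k) x0) x0; rewrite -natr1; lra.
have h := B (n%:R^-1) n (ltW (_ : 0 < n%:R^-1)); rewrite invr_gt0 nR in h.
have {h} := h isT; rewrite divff ?gt_eqF// => h.
rewrite -[_ / _]invrK invf_div exprVn lef_pV2 ?posrE ?exprn_gt0 ?divr_gt0//.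
by rewrite -[n.+1%:R]natr1 mulrDl divff ?gt_eqF// mul1r.
Qed.

(** The squared modulus of [b / (b + i l)], with [b = n / t] and
    [l^2 = n / t^2], is [n / (n + 1)]. *)
Lemma euler_symbol_lower_bound (n : nat) (t l : R) : (0 < n)%N -> 0 < t ->
  `|l| = Num.sqrt n%:R / t ->
  1 - (Num.sqrt 2)^-1 <=
    cmod (((n%:R / t)%:C / ((n%:R / t)%:C + (0 +i* l))) ^+ n - cexp (- (t%:C * (0 +i* l)))).
Proof.
move=> n0 t0 lE; have nR : 0 < n%:R :> R by rewrite ltr0n.
set b := n%:R / t; have b0 : 0 < b by rewrite divr_gt0.
have l2 : l ^+ 2 = n%:R / t ^+ 2.
  by rewrite -real_normK ?num_real// lE expr_div_n sqr_sqrtr// ltW.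
set q := _ / _; have qE : cmod q ^+ 2 = n%:R / n.+1%:R.
  rewrite /q cmodM cmodV cmod_real gtr0_norm// exprMn exprVn [cmod _]cmod_def.
  rewrite cReD cImD /= addr0 add0r sqr_sqrtr ?addr_ge0 ?sqr_ge0// l2 /b.
  by rewrite -[n.+1%:R]natr1; field; rewrite !gt_eqF// addr_gt0 ?mulr_gt0.
have qn : cmod q ^+ n <= (Num.sqrt 2)^-1.
  rewrite -ler_sqr ?nnegrE ?exprn_ge0 ?cmod_ge0 ?invr_ge0//.
  by rewrite exprAC qE exprVn sqr_sqrtr// bernoulli_half.
have e1 : cmod (cexp (- (t%:C * (0 +i* l)))) = 1.
  by rewrite cmod_cexp cReN cReM /= mulr0 mul0r subr0 oppr0 expR0.
have := @rnorm_lerB R R[i]^o (cexp (- (t%:C * (0 +i* l)))) (q ^+ n).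
rewrite rnorm_distC => h; have {}h : cmod (cexp (- (t%:C * (0 +i* l)))) - cmod (q ^+ n) <= cmod (q ^+ n - cexp (- (t%:C * (0 +i* l)))) := h.
by rewrite (le_trans _ h)// e1 cmodX lerD2l lerN2.
Qed.

Lemma stieltjes_rep_real f a m (s : R) : stieltjes_rep f a m -> 0 < s ->
  0 <= complex.Re (f s%:C) /\ complex.Im (f s%:C) = 0.
Proof.
move=> [a0 fE] s0; have sn0 : s%:C != 0 :> R[i] by rewrite eq_complex /= gt_eqF.
have kt tau : stieltjes_kernel s%:C tau = ((1 + tau) / (s + tau))%:C.
  by rewrite /stieltjes_kernel -rmorphD /= -fmorphV -rmorphM.
have -> : f s%:C = a%:C + cint m D (fun tau => ((1 + tau) / (s + tau))%:C).
  rewrite fE//=; last exact: ltW.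
  by congr (_ + _); apply: eq_cint => tau _; exact: kt.
rewrite cReD cImD /cint /= add0r; split.
  rewrite addr_ge0//; apply: Rintegral_ge0 => tau tau0.
  by apply: divr_ge0; apply: addr_ge0 => //; exact: ltW.
by rewrite Rintegral_cst// mul0r.
Qed.

Lemma laplace_difference_product f f1 f2 a1 a2 m1 m2 :
  stieltjes_rep f1 a1 m1 -> stieltjes_rep f2 a2 m2 ->
  (forall z, 0 <= complex.Re z -> z != 0 -> f z = f1 z * f2 z) ->
  laplace_difference (fun z => z ^+ 2 / ((1 + z) * (2%:R + z)) * f z).
Proof.
move=> r1 r2 fE.
apply: laplace_difference_ext (laplace_differenceM (stieltjes_regularized r1 ltr01)
  (stieltjes_regularized r2 (ltr0Sn _ 1))) => z z0 zn0.
by rewrite fE// rmorph1 rmorph_nat invfM expr2; ring.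
Qed.

End scalar_bounds.

Section lower_bound.
Context (R : realType) (X : completeNormedModType R[i]) (T : R -> {linear X -> X}).
Context (A : set (X * X)).
Hypotheses (hT : bounded_C0_semigroup T) (hA : op_opp A = generator T).
Hypothesis hran : closure (op_ran A) = setT.
Hypothesis hsp : [set `|s| | s in [set s : R | spectrum A (0 +i* s)]]
         = nonneg_reals (R := R).

(** Each of the two factors loses [sqrt 2] on the imaginary axis, which is the
    factor [1 / 2] of the constant. *)
Lemma stieltjes_product_lower_bound f f1 f2 a1 a2 (m1 m2 : fmeas R) (n : nat) (t : R) :
  stieltjes_rep f1 a1 m1 -> stieltjes_rep f2 a2 m2 ->
  (forall z, 0 <= complex.Re z -> z != 0 -> f z = f1 z * f2 z) ->
  (0 < n)%N -> 0 < t ->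
  ((2^-1 * (1 - (Num.sqrt 2)^-1) * complex.Re (f (Num.sqrt n%:R / t)%:C))%:E
    <= op_norm (op_comp (ext_hp_calculus T f) (euler_defect A T n t)))%E.
Proof.
move=> r1 r2 fE n0 t0; set s0 := Num.sqrt n%:R / t.
have s00 : 0 < s0 by rewrite divr_gt0// sqrtr_gt0 ltr0n.
have : nonneg_reals (R := R) s0 by exact: ltW.
rewrite -hsp => -[l spl ls0].
have l0 : l != 0 by rewrite -normr_gt0 ls0.
apply: le_trans (calculus_lower_bound hT hA hran l0 spl n0 t0
  (stieltjes_product_holomorphic r1 r2 fE) (laplace_difference_product r1 r2 fE)).
rewrite lee_fin cmodM mulrAC.
have [p1 i1] := stieltjes_rep_real r1 s00; have [p2 i2] := stieltjes_rep_real r2 s00.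
have b1 := stieltjes_lower_bound r1 l0; have b2 := stieltjes_lower_bound r2 l0.
rewrite ls0 in b1 b2.
apply: ler_pM.
- rewrite mulr_ge0 ?invr_ge0// fE//=; [|exact: ltW|by rewrite eq_complex /= gt_eqF].
  by rewrite cReM i1 mul0r subr0 mulr_ge0.
- by rewrite subr_ge0 invf_le1 ?sqrtr_gt0// -[leLHS]sqrtr1 ler_wsqrtr// ler1n.
- rewrite fE//=; [|exact: ltW|by rewrite eq_complex /= gt_eqF].
  rewrite cReM i1 mul0r subr0 fE//; last by rewrite eq_complex /= negb_and l0 orbT.
  rewrite cmodM mulrC ler_pdivrMr// (le_trans (ler_pM p1 p2 b1 b2))//.
  by rewrite mulrACA -expr2 sqr_sqrtr// mulrC.
- exact: euler_symbol_lower_bound.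
Qed.

Lemma stieltjes2_lower_bound f (n : nat) (t : R) : stieltjes2 f -> (0 < n)%N -> 0 < t ->
  ((2^-1 * (1 - (Num.sqrt 2)^-1) * complex.Re (f (Num.sqrt n%:R / t)%:C))%:E
    <= op_norm (op_comp (ext_hp_calculus T f) (euler_defect A T n t)))%E.
Proof.
move=> [f1 [f2 [/stieltjes_has_rep[a1 [m1 r1]] /stieltjes_has_rep[a2 [m2 r2]] fE]]].
apply: stieltjes_product_lower_bound r1 r2 _ => z z0 zn0; apply: fE => -[zi zr].
by case/eqP: zn0; apply/eqP; rewrite eq_complex zi eqxx eq_le zr z0.
Qed.

End lower_bound.

(** * Homogeneous Stieltjes functions *)

Section polar.
Context (R : realType).
Implicit Types (z : R[i]).

Lemma cos_sin_carg z : z != 0 ->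
  cos (carg z) = complex.Re z / cmod z /\ sin (carg z) = complex.Im z / cmod z.
Proof.
move=> zn0; have r0 : 0 < cmod z by rewrite cmod_gt0.
have q1 : -1 <= complex.Re z / cmod z <= 1.
  by rewrite -ler_norml normf_div (gtr0_norm r0) ler_pdivrMr// mul1r ler_Re_cmod.
have s2 : Num.sqrt (1 - (complex.Re z / cmod z) ^+ 2) = `|complex.Im z| / cmod z.
  rewrite (_ : 1 - _ = (`|complex.Im z| / cmod z) ^+ 2); last first.
    rewrite !expr_div_n real_normK ?num_real//; apply/eqP; rewrite subr_eq -mulrDl.
    rewrite addrC cmod_def sqr_sqrtr ?addr_ge0 ?sqr_ge0// divff// gt_eqF//.
    by move: r0; rewrite cmod_def sqrtr_gt0.
  by rewrite sqrtr_sqr ger0_norm// divr_ge0// ltW.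
rewrite /carg; have [i0|i0] := lerP 0 (complex.Im z).
  by rewrite acosK ?in_itv//= sin_acos// s2 ger0_norm.
by rewrite cosN sinN acosK ?in_itv//= sin_acos// s2 ltr0_norm// mulNr opprK.
Qed.

Lemma polarE z : z != 0 -> z = (cmod z)%:C * cexp (0 +i* carg z).
Proof.
move=> zn0; have [c s] := cos_sin_carg zn0.
have r0 : cmod z != 0 by rewrite gt_eqF// cmod_gt0.
apply/eqP; rewrite eq_complex cReM cImM /= expR0 !mul1r !mul0r subr0 addr0 c s.
by rewrite ![cmod z * _]mulrC !divfK// !eqxx.
Qed.

Lemma ler_norm_carg z : z != 0 -> 0 <= complex.Re z -> `|carg z| <= pi / 2.
Proof.
move=> zn0 z0; have r0 : 0 < cmod z by rewrite cmod_gt0.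
have q0 : 0 <= complex.Re z / cmod z by rewrite divr_ge0// ltW.
have q1 : -1 <= complex.Re z / cmod z <= 1.
  by rewrite -ler_norml normf_div (gtr0_norm r0) ler_pdivrMr// mul1r ler_Re_cmod.
have pi0 := pi_gt0 R; have a0 := acos_ge0 q1; have api := acos_lepi q1.
have -> : `|carg z| = acos (complex.Re z / cmod z).
  by rewrite /carg; case: ifP; rewrite ?normrN ger0_norm.
rewrite leNgt -ltr_cos ?in_itv/= ?a0 ?api//; last by apply/andP; split; lra.
by rewrite cos_pihalf acosK ?in_itv//= -leNgt.
Qed.

Lemma cmod_cexp_imaginary (r : R) : cmod (cexp (0 +i* r)) = 1.
Proof. by rewrite cmod_cexp expR0. Qed.

Lemma cexp_imaginaryD (r s : R) : cexp (0 +i* (r + s)) = cexp (0 +i* r) * cexp (0 +i* s).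
Proof. by rewrite -cexpD; congr cexp; apply/eqP; rewrite eq_complex /= addr0 !eqxx. Qed.

Lemma Re_cexp_imaginary (r : R) : `|r| <= pi / 2 -> 0 <= complex.Re (cexp (0 +i* r)).
Proof. by rewrite ler_norml => h; rewrite /= expR0 mul1r cos_ge0_pihalf. Qed.

(** A function whose derivative vanishes uniformly, up to the end points, is
    constant: subdivide the interval into equal steps. *)
Lemma constant_of_increments (q : R -> R[i]) (a b : R) : a <= b ->
  (forall e, 0 < e -> exists2 d, 0 < d &
     forall x h, a <= x -> x + h <= b -> 0 < h < d -> cmod (q (x + h) - q x) <= e * h) ->
  q b = q a.
Proof.
rewrite le_eqVlt => /predU1P[->//|ab] H; have l0 : 0 < b - a by rewrite subr_gt0.
apply/eqP; rewrite -subr_eq0; apply/eqP/cmod_eq0/eqP.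
rewrite eq_le cmod_ge0 andbT; apply/ler_addgt0Pl => e e0; rewrite addr0.
have [d d0 Hd] := H _ (divr_gt0 e0 l0).
pose N := (Num.truncn ((b - a) / d)).+1; pose h := (b - a) / N%:R.
have N0 : 0 < N%:R :> R by rewrite ltr0n.
have h0 : 0 < h by rewrite divr_gt0.
have hd : h < d.
  rewrite /h ltr_pdivrMr// mulrC -ltr_pdivrMr//.
  exact: truncnS_gt.
have hN : N%:R * h = b - a by rewrite /h mulrC divfK// gt_eqF.
have step k : (k <= N)%N -> cmod (q (a + k%:R * h) - q a) <= k%:R * (e / (b - a) * h).
  elim: k => [_|k IH kN]; first by rewrite !mul0r addr0 subrr cmod0.
  have := cmodD (q (a + k.+1%:R * h) - q (a + k%:R * h)) (q (a + k%:R * h) - q a).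
  rewrite addrA subrK => /le_trans; apply.
  rewrite -natr1 [X in _ <= X]mulrDl mul1r addrC lerD//; first exact: (IH (ltnW kN)).
  rewrite mulrDl mul1r addrA; apply: Hd; last by rewrite h0.
    by rewrite lerDl mulr_ge0// ltW.
  rewrite -addrA -[X in _ + (_ + X)]mul1r -mulrDl natr1 -lerBrDl -hN.
  by rewrite ler_wpM2r ?ler_nat// ltW.
have := step N (leqnn _); rewrite hN [a + _]addrC subrK => /le_trans; apply.
by rewrite mulrCA hN divfK// gt_eqF.
Qed.

End polar.

Section homogeneous.
Context (R : realType).
Local Notation D := (nonneg_reals (R := R)).
Context (f : R[i] -> R[i]) (a : R) (m : fmeas R) (b : R).
Hypothesis fr : stieltjes_rep f a m.
Hypothesis hom : forall h z, 0 <= complex.Re z -> z != 0 ->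
  f ((expR h)%:C * z) = (expR (- (b * h)))%:C * f z.
Implicit Types (z w : R[i]).

Let quot (z : R[i]) (h : R) : R[i] := (h^-1)%:C * (cexp (h%:C * z) - 1).

Let quotE z [h] : 0 < h -> cexp (h%:C * z) - 1 = h%:C * quot z h.
Proof. by move=> h0; rewrite /quot mulrA -rmorphM /= mulfV ?mul1r// gt_eqF. Qed.

Let quot_cvg z : quot z h @[h --> 0^'+] --> (z : R[i]^o).
Proof. exact: cexp_derive0. Qed.

(** Euler's relation: differentiate the homogeneity along the ray through
    [z]. *)
Lemma homogeneous_euler z : 0 <= complex.Re z -> z != 0 ->
  stieltjes_slope m z * z = - b%:C * f z.
Proof.
move=> z0 zn0; set L := stieltjes_slope m z.
have [_ _ [K kK]] := cbounded_stieltjes_kernel z0 zn0.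
have cz : 0 < cmod z by rewrite cmod_gt0.
have K0 : 0 <= K by apply: (le_trans (cmod_ge0 _) (kK 0 _)); exact: lexx.
pose C := (K * (cmod z)^-1 * (cmod z)^-1 * fine (m D)) *+ 2.
have C0 : 0 <= C by rewrite mulrn_wge0// !mulr_ge0 ?invr_ge0 ?cmod_ge0// fine_ge0.
pose G h : R[i]^o := quot (- b%:C) h * f z - L * (quot 1 h * z).
have G1 : G h @[h --> 0^'+] --> (- b%:C * f z - L * z : R[i]^o).
  apply: cvgB.
    by apply: (@cvgM R[i]) (cvg_cst _); exact: quot_cvg.
  rewrite -[X in L * X]mul1r.
  apply: (@cvgM R[i]) (cvg_cst _) _; apply: (@cvgM R[i]) (cvg_cst _); exact: quot_cvg.
suff G0 : G h @[h --> 0^'+] --> (0 : R[i]^o).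
  by apply/eqP; rewrite eq_sym -subr_eq0; apply/eqP; exact: rcvg_unique G1 G0.
apply: (@cvg_rnorm_le R R[i]^o _ _ _ _ _
  (fun h => C * cmod z ^+ 2 * h * cmod (quot 1 h) ^+ 2)); last first.
  have q1 : rnorm (quot 1 h : R[i]^o) @[h --> 0^'+] --> rnorm (1 : R[i]^o).
    by apply: (@cvg_rnorm R R[i]^o); exact: quot_cvg.
  have H : C * cmod z ^+ 2 * h * rnorm (quot 1 h : R[i]^o) ^+ 2 @[h --> 0^'+] -->
      C * cmod z ^+ 2 * 0 * rnorm (1 : R[i]^o) ^+ 2.
    apply: cvgM; last exact: (cvgM q1 q1).
    by apply: cvgM; [exact: cvg_cst|apply: cvg_at_right_filter; exact: cvg_id].
  by rewrite mulr0 mul0r in H.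
near=> h; have h0 : 0 < h by near: h; exact: nbhs_right_gt.
rewrite subr0 -[rnorm _]/(cmod (G h)).
pose w := (expR h)%:C * z.
have eh : 1 <= expR h by rewrite -expR0 ler_expR ltW.
have cw : cmod w = expR h * cmod z by rewrite cmodM cmod_real ger0_norm// expR_ge0.
have w0 : 0 <= complex.Re w by rewrite cReM /= mul0r subr0 mulr_ge0// expR_ge0.
have wn0 : w != 0 by rewrite -cmod_gt0 cw mulr_gt0// expR_gt0.
have wz : w - z = h%:C * (quot 1 h * z).
  by rewrite mulrA -quotE// mulr1 cexp_real mulrBl mul1r.
have fwz : f w - f z = h%:C * (quot (- b%:C) h * f z).
  rewrite hom// mulrA -quotE// -rmorphN -rmorphM cexp_real /= mulrN mulrC.
  by rewrite [h * b]mulrC [RHS]mulrBl mul1r mulrC.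
have := stieltjes_increment fr z0 zn0 w0 wn0 kK.
rewrite fwz wz -/L [L * _]mulrCA -mulrBr -/(G h) 2!(cmodM h%:C) cmod_real gtr0_norm//.
move=> inc; rewrite -(ler_pM2l h0) (le_trans inc)// (cmodM (quot 1 h)).
rewrite [leRHS](_ : _ = C * (h * (cmod (quot 1 h) * cmod z)) ^+ 2); last by ring.
apply: ler_wpM2r; first by rewrite exprn_ge0// !mulr_ge0 ?cmod_ge0// ltW.
rewrite lerMn2r /=; apply: ler_wpM2r; first exact: fine_ge0.
apply: ler_wpM2l; first by rewrite mulr_ge0// invr_ge0 cmod_ge0.
rewrite lef_pV2 ?posrE ?cmod_gt0//.
by rewrite cw ler_peMl// ltW.
Unshelve. all: by end_near. Qed.

(** [|z + tau|] is at least 1 and at least [tau]. *)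
Lemma cmod_stieltjes_kernel_le2 z tau : 0 <= complex.Re z -> cmod z = 1 -> 0 <= tau ->
  cmod (stieltjes_kernel z tau) <= 2.
Proof.
move=> z0 z1 tau0; have zn0 : z != 0 by rewrite -cmod_gt0 z1.
have n0 := add_nonneg_neq0 z0 zn0 tau0.
rewrite cmodM cmodV cmod_real ger0_norm ?addr_ge0// ler_pdivrMr ?cmod_gt0//.
rewrite mulr_natl mulr2n lerD//; first by rewrite -{1}z1 cmod_add_nonneg.
rewrite (le_trans _ (ler_Re_cmod _))// cReD /= (le_trans _ (ler_norm _))//.
by rewrite lerDr.
Qed.

(** By Euler's relation [e^(i b x) f(e^(i x))] has derivative zero; the
    quadratic error of [stieltjes_increment] is uniform on the closed half
    circle, end points included. *)
Lemma homogeneous_unit_circle (r : R) : `|r| <= pi / 2 ->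
  f (cexp (0 +i* r)) = cexp (0 +i* (- (b * r))) * f 1.
Proof.
have alg (bC x1 x2 e eb et : R[i]) : et * eb * x2 - et * x1 =
    et * (eb * (x2 - x1 - - bC * x1 * (e - 1)) + (eb - 1 - bC * (eb * (e - 1))) * x1).
  by ring.
pose q x := cexp (0 +i* (b * x)) * f (cexp (0 +i* x)).
suff qE x y : x <= y -> - (pi / 2) <= x -> y <= pi / 2 -> q y = q x.
  move=> rpi; have p0 : 0 <= pi / 2 :> R by rewrite divr_ge0// pi_ge0.
  have q0 : q r = q 0.
    move: rpi; rewrite ler_norml => /andP[rl ru].
    by have [r0|/ltW r0] := lerP 0 r; [|apply/esym]; apply: qE => //; rewrite oppr_le0.
  have i0 : (0 +i* 0) = 0 :> R[i] by [].
  have -> : f 1 = q 0 by rewrite /q mulr0 i0 cexp0 mul1r.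
  by rewrite -q0 /q mulrA -cexp_imaginaryD addNr i0 cexp0 mul1r.
move=> xy xl yu; have M0 : 0 <= fine (m D) by exact: fine_ge0.
pose C : R := (2 * 1^-1 * 1^-1 * fine (m D)) *+ 2.
pose B : R := `|a| + (2 * fine (m D)) *+ 2.
have fB z : 0 <= complex.Re z -> cmod z = 1 -> cmod (f z) <= B.
  move=> z0 z1; have zn0 : z != 0 by rewrite -cmod_gt0 z1.
  rewrite fr.2// (le_trans (cmodD _ _))// cmod_real lerD2l; apply: cint_bound => //.
    exact: cbounded_stieltjes_kernel.
  by move=> tau tau0; exact: cmod_stieltjes_kernel_le2.
have B0 : 0 <= B by rewrite addr_ge0// mulrn_wge0// mulr_ge0.
pose I : R[i] := 0 +i* 1.
(* [h s h = e^(i b h) (1 - b (e^(i h) - 1)) - 1], the relative increment of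
   [q] to first order. *)
pose s h : R[i]^o := quot (b%:C * I) h - b%:C * (cexp (h%:C * (b%:C * I)) * quot I h).
have s0 : s h @[h --> 0^'+] --> (0 : R[i]^o).
  have : s h @[h --> 0^'+] --> (b%:C * I - b%:C * (1 * I) : R[i]^o).
    have q1 : cexp (h%:C * (b%:C * I)) * quot I h @[h --> 0^'+] --> (1 * I : R[i]^o).
      apply: (@cvgM R[i]); [exact: cexp_cvg1|exact: quot_cvg].
    have q2 : b%:C * (cexp (h%:C * (b%:C * I)) * quot I h) @[h --> 0^'+]
        --> (b%:C * (1 * I) : R[i]^o).
      exact: (@cvgM R[i] _ _ _ _ _ _ _ (cvg_cst _) q1).
    have q3 := @cvgB R[i] R[i]^o _ _ _ _ _ _ _ (@quot_cvg (b%:C * I)) q2.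
    exact: q3.  by rewrite mul1r subrr.
pose G h := C * h * cmod (quot I h) ^+ 2 + B * cmod (s h).
have G0 : G h @[h --> 0^'+] --> 0.
  have q1 : rnorm (quot I h : R[i]^o) @[h --> 0^'+] --> rnorm (I : R[i]^o).
    by apply: (@cvg_rnorm R R[i]^o); exact: quot_cvg.
  have s1 : rnorm (s h) @[h --> 0^'+] --> rnorm (0 : R[i]^o).
    by apply: (@cvg_rnorm R R[i]^o).
  have H : G h @[h --> 0^'+] --> C * 0 * rnorm (I : R[i]^o) ^+ 2 + B * rnorm (0 : R[i]^o).
    apply: cvgD; last exact: (cvgM (cvg_cst _) s1).
    apply: cvgM; last exact: (cvgM q1 q1).
    by apply: cvgM; [exact: cvg_cst|apply: cvg_at_right_filter; exact: cvg_id].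
  by rewrite mulr0 mul0r add0r rnorm0 mulr0 in H.
apply: constant_of_increments => // e e0.
have [d /= d0 Hd] := (cvgrPdist_lt _ _).1 G0 e e0.
exists d => // t h xt thy /andP[h0 hd].
have Ge : G h < e.
  have := Hd h; rewrite /= sub0r normrN gtr0_norm// => /(_ hd h0).
  by rewrite sub0r normrN; exact: le_lt_trans (ler_norm _).
have Ih c : cexp (0 +i* (c * h)) = cexp (h%:C * (c%:C * I)).
  by congr cexp; apply/eqP; rewrite eq_complex /=; apply/andP; split; apply/eqP; ring.
set u := cexp (0 +i* t); set ee := cexp (0 +i* h).
have eE : ee = cexp (h%:C * I) by rewrite /ee -[h in LHS]mul1r Ih mul1r.
have tpi : `|t| <= pi / 2.
  by rewrite ler_norml (le_trans xl)//= (le_trans _ yu)// (le_trans _ thy)// lerDl ltW.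
have thpi : `|t + h| <= pi / 2.
  by rewrite ler_norml (le_trans thy)// andbT (le_trans xl)// (le_trans xt)// lerDl ltW.
have u0 : 0 <= complex.Re u by exact: Re_cexp_imaginary.
have u1 : cmod u = 1 by exact: cmod_cexp_imaginary.
have un0 : u != 0 by exact: cexp_neq0.
have uee : cexp (0 +i* (t + h)) = u * ee by exact: cexp_imaginaryD.
have v0 : 0 <= complex.Re (u * ee) by rewrite -uee; exact: Re_cexp_imaginary.
have v1 : cmod (u * ee) = 1 by rewrite -uee cmod_cexp_imaginary.
have vn0 : u * ee != 0 by rewrite -uee cexp_neq0.
have inc := stieltjes_increment fr u0 un0 v0 vn0
  (fun tau => @cmod_stieltjes_kernel_le2 u tau u0 u1).
have Lu : stieltjes_slope m u * (u * ee - u) = - b%:C * f u * (ee - 1).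
  by rewrite -homogeneous_euler// -mulrA [u * (_ - _)]mulrBr mulr1.
rewrite Lu u1 v1 -/C in inc.
set E := _ - _ in inc.
pose eb := cexp (0 +i* (b * h)).
have hs : h%:C * s h = eb - 1 - b%:C * (eb * (ee - 1)).
  rewrite /eb Ih eE (quotE (b%:C * I) h0) (quotE I h0) /s mulrBr.
  by congr (_ - _); rewrite mulrCA; congr (_ * _); rewrite mulrCA.
have -> : q (t + h) - q t = cexp (0 +i* (b * t)) * (eb * E + h%:C * s h * f u).
  rewrite /q uee -/u mulrDr cexp_imaginaryD -/eb /E hs.
  exact: alg.
rewrite cmodM cmod_cexp_imaginary mul1r (le_trans (cmodD _ _))//.
rewrite cmodM cmod_cexp_imaginary mul1r !cmodM cmod_real gtr0_norm//.
apply: (@le_trans _ _ (G h * h)); last by rewrite ler_wpM2r// ltW.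
rewrite /G mulrDl; apply: lerD.
  apply: le_trans inc _; rewrite -[X in _ - X]mulr1 -mulrBr cmodM u1 mul1r eE (quotE I h0).
  by rewrite cmodM cmod_real gtr0_norm// le_eqVlt; apply/orP; left; apply/eqP; ring.
rewrite [leRHS](_ : _ = h * cmod (s h) * B); last by ring.
by rewrite ler_wpM2l ?fB// mulr_ge0 ?cmod_ge0// ltW.
Qed.

Lemma homogeneous_cpow z : 0 <= complex.Re z -> z != 0 -> f z = cpow z (- b) * f 1.
Proof.
move=> z0 zn0; have r0 : 0 < cmod z by rewrite cmod_gt0.
have c0 := ler_norm_carg zn0 z0.
rewrite {1}(polarE zn0) -{1}(lnK r0) hom//; last by exact: cexp_neq0.
  rewrite homogeneous_unit_circle// /cpow mulrA mulNr; congr (_ %:C * _ * _).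
  by rewrite /powR gt_eqF// mulNr.
exact: Re_cexp_imaginary.
Qed.

End homogeneous.

(** * Lebesgue measure on the logarithmic scale *)

Section power_measure.
Context (R : realType).
Local Notation D := (nonneg_reals (R := R)).
Local Notation leb := (@lebesgue_measure R).

(** Covers translations and the reflection. *)
Lemma lebesgue_isometry_integral (phi : mR R -> mR R) (f : mR R -> \bar R) :
  measurable_fun setT phi ->
  (forall a b, a < b -> leb (phi @^-1` `]a, b]) = leb (`]a, b] : set R)) ->
  measurable_fun setT f -> (forall x, 0 <= f x)%E ->
  (\int[leb]_x f x = \int[leb]_x f (phi x))%E.
Proof.
move=> mphi Hphi mf f0; pose pm : {measure set (mR R) -> \bar R} :=
  measure_function_pushforward__canonical__measure_function_Measure leb mphi.
transitivity (\int[pm]_x f x)%E; last first.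
  by rewrite -[RHS](ge0_integral_pushforward mphi leb (D := setT))// preimage_setT.
apply: eq_measure_integral => A mA _; apply: (@lebesgue_measure_unique R pm) => // _ [[a b]] _ <- /=.
have [ab|ba] := ltP a b; first by rewrite /pushforward Hphi.
by rewrite set_itv_ge -?leNgt// !measure0.
Qed.

Lemma lebesgue_shift_integral (u : R) (f : mR R -> \bar R) :
  measurable_fun setT f -> (forall x, 0 <= f x)%E ->
  (\int[leb]_x f x = \int[leb]_x f (x + u)%R)%E.
Proof.
apply: (@lebesgue_isometry_integral (fun x => x + u)).
  exact: measurable_funD.
move=> a b ab; rewrite (_ : _ @^-1` _ = `]a - u, b - u]%classic); last first.
  by apply/seteqP; split => x /=; rewrite !in_itv/= ltrBlDr lerBrDr.
by rewrite !lebesgue_measure_itv/= !lte_fin ltrD2r ab -!EFinD; congr EFin; ring.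
Qed.

Lemma lebesgue_opp_integral (f : mR R -> \bar R) :
  measurable_fun setT f -> (forall x, 0 <= f x)%E ->
  (\int[leb]_x f x = \int[leb]_x f (- x)%R)%E.
Proof.
apply: (@lebesgue_isometry_integral -%R) => //.
move=> a b ab; rewrite (_ : _ @^-1` _ = `[- b, - a[%classic); last first.
  by apply/seteqP; split => x /=; rewrite !in_itv/= ltrNr lerNl andbC.
by rewrite !lebesgue_measure_itv/= !lte_fin ltrN2 ab -!EFinD; congr EFin; ring.
Qed.

Section density.
Variable (b : R).
Hypotheses (b0 : 0 < b) (b1 : b < 1).

(** The measure [tau^-b / (1 + tau) d tau] in the variable [x = ln tau]. On
    this scale a dilation is a translation, under which Lebesgue measure is
    invariant. *)
Definition power_density (x : mR R) : R := expR ((1 - b) * x) / (1 + expR x).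

Lemma power_density_ge0 x : 0 <= power_density x.
Proof. by rewrite divr_ge0 ?addr_ge0 ?expR_ge0. Qed.

Lemma power_density_le1 x : power_density x <= 1.
Proof.
rewrite ler_pdivrMr ?mul1r; last by rewrite addr_gt0// expR_gt0.
have [x0|x0] := lerP 0 x.
  by rewrite ler_wpDl// ler_expR ler_piMl// lerBlDr lerDl ltW.
apply: (@le_trans _ _ 1); last by rewrite lerDl expR_ge0.
by rewrite -[leRHS]expR0 ler_expR nmulr_lle0// subr_ge0 ltW.
Qed.

Lemma measurable_power_density : measurable_fun setT power_density.
Proof.
rewrite (_ : power_density = fun x => expR ((1 - b) * x) * expR (- ln (1 + expR x))).
  apply: measurable_funM.
    by apply: measurableT_comp => //; exact: measurable_funM.
  apply: measurableT_comp => //; apply: measurableT_comp => //.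
  by apply: measurableT_comp; [exact: measurable_ln|exact: measurable_funD].
apply/funext => x; rewrite expRN lnK// posrE.
by rewrite addr_gt0// expR_gt0.
Qed.

(** The density is at most [e^(- b x)] for [x >= 0] and [e^((1 - b) x)] for
    [x < 0], multiples of exponential densities. *)
Lemma power_density_integral : exists2 I : R, 0 < I &
  (\int[leb]_x (power_density x)%:E = I%:E)%E.
Proof.
have mp := measurable_power_density; have p0 := power_density_ge0.
have mpE : measurable_fun setT (EFin \o power_density) by exact/measurable_EFinP.
have b1' : 0 < 1 - b by rewrite subr_gt0.
have fin : (\int[leb]_x (power_density x)%:E < +oo)%E.
  pose g1 (x : mR R) : \bar R := ((b^-1)%:E * (exponential_pdf b x)%:E)%E.
  pose g2 (x : mR R) : \bar R := (((1 - b)^-1)%:E * (exponential_pdf (1 - b) (- x))%:E)%E.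
  have e1 x : (0 <= (exponential_pdf b x)%:E)%E by rewrite lee_fin exponential_pdf_ge0// ltW.
  have e2 x : (0 <= (exponential_pdf (1 - b) x)%:E)%E by rewrite lee_fin exponential_pdf_ge0// ltW.
  have m1 : measurable_fun setT (EFin \o exponential_pdf b).
    by apply/measurable_EFinP; exact: measurable_exponential_pdf.
  have m2 : measurable_fun setT (EFin \o exponential_pdf (1 - b)).
    by apply/measurable_EFinP; exact: measurable_exponential_pdf.
  have m2' : measurable_fun setT (fun x : mR R => (exponential_pdf (1 - b) (- x))%:E).
    exact: (measurableT_comp m2).
  have g10 x : (0 <= g1 x)%E by rewrite mule_ge0// lee_fin invr_ge0 ltW.
  have g20 x : (0 <= g2 x)%E by rewrite mule_ge0// lee_fin invr_ge0 ltW.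
  have mg1 : measurable_fun setT g1 by exact: measurable_funeM.
  have mg2 : measurable_fun setT g2 by exact: measurable_funeM.
  apply: (@le_lt_trans _ _ (\int[leb]_x (g1 x + g2 x))%E).
    apply: ge0_le_integral => //.
    - by move=> x _; rewrite lee_fin.
    - exact: emeasurable_funD.
    - move=> x _; have [x0|x0] := lerP 0 x.
        apply: (@le_trans _ _ (g1 x)); last by rewrite leeDl.
        rewrite /g1 exponential_pdfE// -EFinM lee_fin mulrA mulVf ?gt_eqF// mul1r.
        rewrite ler_pdivrMr ?addr_gt0 ?expR_gt0//.
        rewrite mulrDr mulr1 -expRD -[leLHS]add0r lerD ?expR_ge0// ler_expR; lra.
      apply: (@le_trans _ _ (g2 x)); last by rewrite leeDr.
      have x0' : 0 <= - x by rewrite oppr_ge0 ltW.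
      rewrite /g2 exponential_pdfE// -EFinM lee_fin mulrA mulVf ?gt_eqF// mul1r mulrNN.
      by rewrite ler_pdivrMr ?addr_gt0 ?expR_gt0// ler_peMr ?expR_ge0// lerDl expR_ge0.
  rewrite ge0_integralD// ge0_integralZl_EFin ?invr_ge0 ?ltW//.
  rewrite ge0_integralZl_EFin ?invr_ge0 ?ltW//.
  rewrite -(@lebesgue_opp_integral (EFin \o exponential_pdf (1 - b)))//.
  by rewrite !integral_exponential_pdf// !mule1 -EFinD ltry.
have nn : (0 <= \int[leb]_x (power_density x)%:E)%E.
  by apply: integral_ge0 => x _; rewrite lee_fin.
have finn : (\int[leb]_x (power_density x)%:E)%E \is a fin_num by rewrite ge0_fin_numE.
exists (fine (\int[leb]_x (power_density x)%:E)%E); last by rewrite fineK.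
pose e : R := (1 + expR 1)^-1; have e0 : 0 < e by rewrite invr_gt0 addr_gt0// expR_gt0.
rewrite fine_gt0// fin andbT; pose I01 : set (mR R) := `[0%R, 1%R]%classic.
have mI : measurable I01 by exact: measurable_itv.
have h : (0 < \int[leb]_(x in I01) e%:E)%E.
  rewrite /I01 integral_cst//= lebesgue_measure_itv/= lte_fin ltr01 -EFinD subr0 mule1.
  by rewrite lte_fin.
apply: lt_le_trans h _.
apply: (@le_trans _ _ (\int[leb]_(x in I01) (power_density x)%:E)%E).
  apply: ge0_le_integral => //.
  - by move=> x _; rewrite lee_fin ltW.
  - exact: measurable_funTS.
  - move=> x; rewrite /I01 /= in_itv/= => /andP[x0 x1]; rewrite lee_fin /e -[leLHS]mul1r.
    apply: ler_pM => //.
    - by rewrite -[leLHS]expR0 ler_expR mulr_ge0// ltW.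
    - by rewrite lef_pV2 ?posrE ?addr_gt0 ?expR_gt0// lerD2l ler_expR.
by apply: ge0_subset_integral => // x _; rewrite lee_fin.
Qed.

End density.
End power_measure.

(** * Powers as Stieltjes functions *)

Section stieltjes_power.
Context (R : realType).
Local Notation D := (nonneg_reals (R := R)).
Local Notation leb := (@lebesgue_measure R).
Variable (b : R).
Hypotheses (b0 : 0 < b) (b1 : b < 1).

(** Normalized to total mass 1, which makes its Stieltjes transform take the
    value 1 at 1, as the kernel is 1 there. *)
Lemma power_measure : exists (m : fmeas R) (c : R),
  [/\ 0 < c, fine (m D) = 1 & forall f : R -> R[i], cbounded (D : set (mR R)) f ->
      cint m D f = cint leb setT (fun x => (c * power_density b x)%:C * f (expR x))].
Proof.
have [I I0 IE] := power_density_integral b0 b1.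
have I0' : 0 <= I^-1 by rewrite invr_ge0 ltW.
pose g x := I^-1 * power_density b x.
have g0 x : 0 <= g x by rewrite mulr_ge0// power_density_ge0.
have mg : measurable_fun setT g by apply: measurable_funM => //; exact: measurable_power_density.
have gI : (\int[leb]_x (g x)%:E = 1)%E.
  under eq_integral do rewrite EFinM.
  rewrite ge0_integralZl_EFin//.
  - by rewrite IE -EFinM mulVf// gt_eqF.
  - by move=> x _; rewrite lee_fin power_density_ge0.
  - by apply/measurable_EFinP; exact: measurable_power_density.
have [|nu nuE] := @weighted_finite_measure _ (mR R) R leb g setT measurableT mg (fun x _ => g0 x).
  by rewrite gI ltry.
have mexp : measurable_fun setT (expR : mR R -> mR R) by [].
have [m mE] := pushforward_finite_measure nu mexp.
have preD : (expR : mR R -> mR R) @^-1` D = setT.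
  by apply/seteqP; split => // x _; exact: expR_ge0.
have H (f : mR R -> \bar R) : measurable_fun D f -> (forall x, D x -> 0 <= f x)%E ->
    (\int[m]_(x in D) f x = \int[leb]_x (f (expR x) * (g x)%:E))%E.
  move=> mf f0; rewrite mE// preD nuE// ?setTI//.
    apply: (measurable_comp (F := D)) => //.
    by move=> _ [x _ <-]; exact: expR_ge0.
  by move=> x _; apply: f0; exact: expR_ge0.
exists m, I^-1; split; first by rewrite invr_gt0.
- have := H (cst 1%E) (measurable_cst _) (fun _ _ => lee01).
  rewrite integral_cst// mul1e => h.
  rewrite [X in fine X](_ : _ = 1%E)// [LHS]h -[RHS]gI.
  by apply: eq_integral => x _; rewrite mul1e.
- move=> f bf; rewrite (@cint_change _ _ (mR R) (mR R) R m leb D setT expR g)//.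
Qed.

(** The Stieltjes transform of [power_measure] is homogeneous of degree [- b]:
    a dilation of [z] amounts to a translation of [x]. *)
Lemma stieltjes_power_rep : exists m : fmeas R,
  stieltjes_rep (fun z => cpow z (- b)) 0 m.
Proof.
have [m [c [c0 mD1 mE]]] := power_measure; exists m; split => // z z0 zn0.
pose f w := 0%:C + cint m D (stieltjes_kernel w).
have fr : stieltjes_rep f 0 m by split.
pose psi w x := (c * power_density b x)%:C * stieltjes_kernel w (expR x).
have fpsi w : 0 <= complex.Re w -> w != 0 -> f w = cint leb setT (psi w).
  by move=> w0 wn0; rewrite /f add0r mE//; exact: cbounded_stieltjes_kernel.
have bpsi w : 0 <= complex.Re w -> w != 0 -> cbounded (setT : set (mR R)) (psi w).
  move=> w0 wn0; apply: cboundedM.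
    split => /=.
    - by apply: measurable_funM => //; exact: measurable_power_density.
    - exact: measurable_cst.
    - exists c => x _; rewrite cmod_real ger0_norm ?mulr_ge0 ?power_density_ge0 ?(ltW c0)//.
      by rewrite ler_piMr ?power_density_le1// ltW.
  have [kr ki [K kK]] := cbounded_stieltjes_kernel w0 wn0.
  have sub : (expR : mR R -> mR R) @` setT `<=` D by move=> _ [x _ <-]; exact: expR_ge0.
  split.
  - exact: (measurable_comp _ sub kr).
  - exact: (measurable_comp _ sub ki).
  - by exists K => x _; apply: kK; exact: expR_ge0.
have alg (C E H B Y w : R[i]) : 1 + Y * H != 0 -> 1 + Y != 0 -> H != 0 -> w + Y != 0 ->
    C * (E * (H * B) / (1 + Y * H)) * ((1 + Y * H) / (H * w + Y * H)) =
    C * (E / (1 + Y)) * (B * ((1 + Y) / (w + Y))).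
  move=> n1 n2 n3 n4; rewrite [Y * H in X in _ * (_ / X)]mulrC -mulrDr.
  by field; rewrite n1 n2 n3 n4.
have hom h w : 0 <= complex.Re w -> w != 0 ->
    f ((expR h)%:C * w) = (expR (- (b * h)))%:C * f w.
  move=> w0 wn0; set v := _ * w.
  have v0 : 0 <= complex.Re v by rewrite /v cReM /= mul0r subr0 mulr_ge0// expR_ge0.
  have en0 : (expR h)%:C != 0 :> R[i] by rewrite eq_complex /= gt_eqF// expR_gt0.
  have vn0 : v != 0 by rewrite mulf_neq0.
  have psiE x : psi v (x + h) = (c * power_density b x)%:C *
      ((expR (- (b * h)))%:C * stieltjes_kernel w (expR x)).
    have n1 (y : R) : 0 <= y -> 1 + y%:C != 0 :> R[i].
      by move=> y0; apply: add_nonneg_neq0; rewrite ?oner_neq0//=; exact: ler01.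
    have n2 := add_nonneg_neq0 w0 wn0 (expR_ge0 x).
    have n3 := n1 _ (expR_ge0 x).
    have n4 : 1 + (expR x)%:C * (expR h)%:C != 0 :> R[i].
      by rewrite -rmorphM; apply: n1; rewrite mulr_ge0 ?expR_ge0.
    rewrite /psi /stieltjes_kernel /power_density mulrDr !expRD /v.
    have -> : expR ((1 - b) * h) = expR h * expR (- (b * h)).
      by rewrite -expRD; congr expR; ring.
    rewrite !(rmorphM, rmorphD, fmorphV, rmorph1) /=; exact: alg.
  rewrite fpsi// (@cint_change _ _ (mR R) (mR R) R leb leb setT setT (fun x => x + h) (cst 1)) //.
  - transitivity (cint leb setT (fun x => (c * power_density b x)%:C *
        ((expR (- (b * h)))%:C * stieltjes_kernel w (expR x)))).
      by apply: eq_cint => x _; rewrite mul1r psiE.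
    rewrite -(mE (fun y => (expR (- (b * h)))%:C * stieltjes_kernel w y)).
      rewrite cintZ//; last exact: cbounded_stieltjes_kernel.
      by rewrite /f add0r.
    by apply: cboundedM; [exact: cbounded_cst|exact: cbounded_stieltjes_kernel].
  - move=> F mF F0; rewrite (@lebesgue_shift_integral _ h)//.
      by apply: eq_integral => x _; rewrite mule1.
    by move=> x; exact: F0.
  - exact: bpsi.
have f1 : f 1 = 1.
  rewrite /f add0r -[RHS](_ : cint m D (fun=> 1) = 1).
    apply: eq_cint => tau tau0.
    by rewrite (stieltjes_kernelE (ler01 : 0 <= complex.Re 1) (oner_neq0 _) tau0) subrr mul0r addr0.
  by rewrite cint_cst// mul1r mD1.
by rewrite -[RHS]/(f z) (homogeneous_cpow fr hom)// f1 mulr1.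
Qed.

End stieltjes_power.

(** * The lower bounds for products and powers *)

Section complex_powers.
Context (R : realType).
Local Notation D := (nonneg_reals (R := R)).
Implicit Types (z : R[i]).

Lemma cpowD z (a b : R) : z != 0 -> cpow z (a + b) = cpow z a * cpow z b.
Proof.
move=> zn0; rewrite /cpow powRD; last by apply/implyP => _; rewrite gt_eqF// cmod_gt0.
by rewrite rmorphM mulrDl cexp_imaginaryD mulrACA.
Qed.

Lemma cpowN1 z : z != 0 -> cpow z (-1) = z^-1.
Proof.
move=> zn0; rewrite /cpow powR_inv1 ?cmod_ge0// [in RHS](polarE zn0) invfM fmorphV; congr (_ * _).
by rewrite -cexpN; congr cexp; apply/eqP; rewrite eq_complex /= oppr0 mulN1r !eqxx.
Qed.

Lemma cpow_real (s a : R) : 0 < s -> cpow s%:C a = (s `^ a)%:C.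
Proof.
move=> s0; have cs : cmod s%:C = s by rewrite cmod_real gtr0_norm.
rewrite /cpow cs /carg cs /= lexx divff ?gt_eqF// acos1 mulr0.
by rewrite (_ : (0 +i* 0) = 0 :> R[i])// cexp0 mulr1.
Qed.

(** For the exponent 1 the measure degenerates to a unit mass at 0. *)
Lemma stieltjes_inv_rep : exists m : fmeas R, stieltjes_rep (fun z => cpow z (-1)) 0 m.
Proof.
exists (\d_(0 : mR R)); split => // z z0 zn0; rewrite add0r cpowN1//.
have D0 : D 0 by exact: lexx.
have [kr ki _] := cbounded_stieltjes_kernel z0 zn0.
have Rd (f : mR R -> R) : measurable_fun D f -> Rintegral (\d_(0 : mR R)) D f = f 0.
  move=> mf; rewrite /Rintegral integral_dirac//; last exact/measurable_EFinP.
  by rewrite diracE mem_set// mul1e.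
have k0 : stieltjes_kernel z 0 = z^-1 by rewrite /stieltjes_kernel !addr0 rmorph1 mul1r.
rewrite /cint (Rd _ kr) (Rd _ ki) k0.
by case: (z^-1).
Qed.

Lemma stieltjes_negative_power (b : R) : 0 < b -> b <= 1 ->
  exists m : fmeas R, stieltjes_rep (fun z => cpow z (- b)) 0 m.
Proof.
move=> b0; rewrite le_eqVlt => /predU1P[->|b1]; first exact: stieltjes_inv_rep.
exact: stieltjes_power_rep.
Qed.

End complex_powers.

Theorem theorem6p3 (R : realType) (X : completeNormedModType R[i])
  (T : R -> {linear X -> X}) (A : set (X * X))
  (hT : bounded_C0_semigroup T)
  (hA : op_opp A = generator T)
  (hran : closure (op_ran A) = setT)
  (hsp : [set `|s| | s in [set s : R | spectrum A (0 +i* s)]]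
         = nonneg_reals (R := R)) :
  let c : R := 2^-1 * (1 - (Num.sqrt 2)^-1) in
  (forall f : R[i] -> R[i], stieltjes2 f ->
     forall (n : nat) (t : R), (0 < n)%N -> 0 < t ->
       ((c * complex.Re (f (Num.sqrt n%:R / t)%:C))%:E
         <= op_norm (op_comp (ext_hp_calculus T f) (euler_defect A T n t)))%E)
  /\
  (forall alpha : R, 0 < alpha -> alpha <= 2 ->
     forall (n : nat) (t : R), (0 < n)%N -> 0 < t ->
       ((c * (t / Num.sqrt n%:R) `^ alpha)%:E
         <= op_norm (op_comp (ext_hp_calculus T (fun z => cpow z (- alpha)))
                             (euler_defect A T n t)))%E).
Proof.
move=> c; split=> [f f2 n t n0 t0|alpha a0 a2 n t n0 t0].
  exact: (stieltjes2_lower_bound hT hA hran hsp f2 n0 t0).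
have [m mE] : exists m : fmeas R, stieltjes_rep (fun z => cpow z (- (alpha / 2))) 0 m.
  by apply: stieltjes_negative_power; rewrite ?divr_gt0// ler_pdivrMr// mul1r.
have pE z : 0 <= complex.Re z -> z != 0 ->
    cpow z (- alpha) = cpow z (- (alpha / 2)) * cpow z (- (alpha / 2)).
  by move=> _ zn0; rewrite -cpowD// -opprD -splitr.
have s0 : 0 < Num.sqrt n%:R / t by rewrite divr_gt0// sqrtr_gt0 ltr0n.
have := stieltjes_product_lower_bound hT hA hran hsp mE mE pE n0 t0.
rewrite cpow_real// -/c [complex.Re _]/= -(invf_div (Num.sqrt n%:R) t).
rewrite (_ : (_ / t)^-1 `^ alpha = (Num.sqrt n%:R / t) `^ (- alpha))//.
by rewrite -powR_inv1 ?(ltW s0)// -powRrM mulN1r.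
Qed.
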